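(* Assume that $\phi$ is a meromorphic function in a neighborhood of the origin with the local expression $$\phi(z)=\frac{1-\delta^2}{2z^2}+\frac{a_1}{z}+a_2+\cdots\quad\text{as } z\to 0,\qquad \delta\in\mathbb C.$$ Let $U$ be a punctured disk neighborhood of $0$ on which $\phi$ is holomorphic, and let $\gamma_\phi$ be the generator of the holonomy group of the complex projective structure on $U$ induced by $\phi$. Then: (a) if $\delta$ is not an integer, the generator $\gamma_\phi$ is a non-identity elliptic transformation; (b) if $\delta=0$, the generator $\gamma_\phi$ is a parabolic transformation; (c) if $\delta$ is an integer with $|\delta|\ge 1$, the generator $\gamma_\phi$ is a parabolic transformation or the identity; furthermore, with $d=|\delta|$, the generator is equal to the identity if and only if $\phi$ satisfies additionally the condition $$\det\begin{pmatrix} a_1 & k_1 & 0 & \cdots & 0\\ a_2 & a_1 & k_2 & \cdots & 0\\ \vdots & \vdots & \vdots & & \vdots\\ a_{d-1} & a_{d-2} & a_{d-3} & \cdots & k_{d-1}\\ a_d & a_{d-1} & a_{d-2} & \cdots & a_1\end{pmatrix}=0,\qquad k_j=2j(j-d),\ j=1,\dots,d-1.$$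
   Context: $S_f=\frac{f'''}{f'}-\frac32\left(\frac{f''}{f'}\right)^2$ is the Schwarzian derivative of $f$. Holonomy: let $\phi$ be holomorphic on a domain $U$. On a disk $D\subset U$ the equation $S_f=\phi$ has a solution $f_0:D\to\widehat{\mathbb C}$, unique up to post-composition by a Möbius transformation, and $(f_0,D)$ continues analytically along every path in $U$ starting in $D$. For a path $p$ in $U$ with $p(0)=p(1)\in D$, continuation along $p$ gives another solution $f_p=\gamma_p\circ f_0$ on $D$, where $\gamma_p$ is a Möbius transformation determined by the homotopy class of $p$ and the choice of $f_0$. The group formed by the $\gamma_p$, well defined up to conjugation by a Möbius transformation, is the holonomy group $G_\phi$ of the complex projective structure on $U$ induced by $\phi$. When $U$ is a punctured disk, $\pi_1(U)\cong\mathbb Z$ and $G_\phi$ is generated by a single Möbius transformation $\gamma_\phi$, associated with the simple loop around the puncture. Either $\gamma_\phi$ is hyperbolic or elliptic (and its conjugacy class is determined by its eigenvalue at fixed points), or $\gamma_\phi$ is conjugate to the parabolic transformation $z\mapsto z+1$, or $\gamma_\phi$ is the identity. In (c), the matrix is $d\times d$ with $(i,j)$ entry $a_{i-j+1}$ for $i\ge j$, $k_i$ for $j=i+1$, and $0$ for $j>i+1$ (for $d=1$ the condition is $a_1=0$).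
   Formalization: In (a), the generator is shown to be non-identity for every non-integer δ, elliptic if δ is real, and hyperbolic (including loxodromic) if δ is not real; ''elliptic'' fails for non-real δ, e.g. δ = i, φ = 1/z², where the generator is multiplication by exp(±2π). *)

(* Defs.v *)
From HB Require Import structures.
From mathcomp Require Import all_boot all_order all_algebra.
From mathcomp Require Import complex.
From mathcomp Require Import all_classical all_reals all_analysis.
Import Order.TTheory GRing.Theory Num.Theory numFieldNormedType.Exports.

Set Implicit Arguments.
Unset Strict Implicit.
Unset Printing Implicit Defensive.

Local Open Scope classical_set_scope.
Local Open Scope ring_scope.

(* MathComp-Analysis puts the topology of a numFieldType on K itself, keyed on
   the structure K rather than on the type R[i]; hence this packed version. *)
Definition Cplx (R : realType) : numClosedFieldType := R[i].

(* Below, K is meant to be the field of complex numbers.  Differentiability and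
   derivatives are then complex ones, and a radius e : K with 0 < e is a
   positive real number. *)

Definition holomorphic_on (K : numFieldType) (U : set K) (f : K -> K) : Prop :=
  forall z, U z -> derivable f z 1.

Definition schwarzian (K : numFieldType) (f : K -> K) (z : K) : K :=
  derive1n 3 f z / derive1n 1 f z
  - 3 / 2 * (derive1n 2 f z / derive1n 1 f z) ^+ 2.

Definition punctured_disk (K : numFieldType) (r : K) : set K :=
  [set z | 0 < `|z| < r].

(* The Riemann sphere; None is the point at infinity. *)
Definition sphere (K : numFieldType) : Type := option K.

Definition moebius (K : numFieldType) (M : 'M[K]_2) (w : sphere K) : sphere K :=
  let a := M 0 0 in let b := M 0 1 in let c := M 1 0 in let d := M 1 1 in
  match w with
  | Some x => if c * x + d == 0 then None else Some ((a * x + b) / (c * x + d))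
  | None => if c == 0 then None else Some (a / c)
  end.

Definition is_moebius (K : numFieldType) (g : sphere K -> sphere K) : Prop :=
  exists2 M : 'M[K]_2, M \in unitmx & g = moebius M.

Definition moebius_conj (K : numFieldType) (g h : sphere K -> sphere K) : Prop :=
  exists2 p, is_moebius p & p \o g = h \o p.

(* option_map f is the extension of f : K -> K to the sphere fixing infinity. *)
Definition parabolic (K : numFieldType) (g : sphere K -> sphere K) : Prop :=
  moebius_conj g (option_map (fun z : K => z + 1)).

(* The identity is elliptic, with multiplier l = 1. *)
Definition elliptic (K : numFieldType) (g : sphere K -> sphere K) : Prop :=
  exists2 l : K, `|l| = 1 & moebius_conj g (option_map (fun z : K => l * z)).

(* The multiplier need not be real: loxodromic transformations are included. *)
Definition hyperbolic (K : numFieldType) (g : sphere K -> sphere K) : Prop :=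
  exists2 l : K, l != 0 /\ `|l| != 1 &
    moebius_conj g (option_map (fun z : K => l * z)).

Definition sphere_inv (K : numFieldType) (w : sphere K) : sphere K :=
  match w with
  | Some x => if x == 0 then None else Some x^-1
  | None => Some 0
  end.

(* f : D -> sphere is meromorphic with S_f = phi on D.  Near a pole, S_f is read
   in the chart 1/f, as S_f = S_(1/f).  The requirement g' <> 0 is part of the
   equation: at a critical point S_g has a double pole, whereas division by 0
   is 0 here. *)
Definition schwarz_solution (K : numFieldType) (phi : K -> K) (D : set K)
    (f : K -> sphere K) : Prop :=
  forall z, D z -> exists g : K -> K,
    [/\ (\forall w \near z, derivable g w 1),
        derive1 g z != 0,
        schwarzian g z = phi z
      & (\forall w \near z, f w = Some (g w)) \/
        (\forall w \near z, f w = sphere_inv (Some (g w)))].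

(* Analytic continuation, through solutions of S_f = phi, along the path p in U:
   a function element F t on a disk of radius e t about p t for each time t,
   those at nearby times agreeing on the overlap of their disks. *)
Definition continuation_along (R : realType) (K : numFieldType) (phi : K -> K)
    (U : set K) (p : R -> K) (F : R -> K -> sphere K) (e : R -> K) : Prop :=
  forall t : R, 0 <= t <= 1 ->
    [/\ 0 < e t,
        ball (p t) (e t) `<=` U,
        schwarz_solution phi (ball (p t) (e t)) (F t)
      & \forall s \near t, 0 <= s <= 1 ->
          ball (p t) (e t) (p s) /\
          (forall w, ball (p t) (e t) w -> ball (p s) (e s) w ->
             F s w = F t w)].

(* g = gamma_p for the loop p in U with p 0 = p 1 in D: the continuation of f0
   along p ends with the germ of g \o f0 at p 1. *)
Definition holonomy_along (R : realType) (K : numFieldType) (phi : K -> K)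
    (U D : set K) (f0 : K -> sphere K) (p : R -> K)
    (g : sphere K -> sphere K) : Prop :=
  [/\ {within [set t : R | 0 <= t <= 1], continuous p},
      (forall t : R, 0 <= t <= 1 -> U (p t)),
      p 0 = p 1, D (p 0)
    & exists (F : R -> K -> sphere K) (e : R -> K),
      [/\ continuation_along phi U p F e,
          (\forall w \near p 0, F 0 w = f0 w)
        & (\forall w \near p 1, F 1 w = g (f0 w))]].

Definition holonomy_group (R : realType) (K : numFieldType) (phi : K -> K)
    (U D : set K) (f0 : K -> sphere K) : set (sphere K -> sphere K) :=
  [set g | is_moebius g /\
           exists p : R -> K, holonomy_along phi U D f0 p g].

Definition generates (K : numFieldType) (gamma : sphere K -> sphere K)
    (G : set (sphere K -> sphere K)) : Prop :=
  exists2 M : 'M[K]_2, M \in unitmx &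
    gamma = moebius M /\ G = [set moebius (M ^ n) | n in [set: int]].

(* Rows and columns are numbered from 0, so the entry (i, j) is the paper's
   (i + 1, j + 1), and k_(j+1) stands at (j, j + 1). *)
Definition holonomy_matrix (K : numFieldType) (a : nat -> K) (d : nat) :
    'M[K]_d :=
  \matrix_(i < d, j < d)
    if (j <= i)%N then a (i - j).+1
    else if j == i.+1 :> nat then 2 * j%:R * (j%:R - d%:R)
    else 0.

(* Main.v *)
Require Import Defs.
From HB Require Import structures.
From mathcomp Require Import all_boot all_order all_algebra.
From mathcomp Require Import complex ring lra.
From mathcomp Require Import all_classical all_reals all_analysis.
Import Order.TTheory GRing.Theory Num.Theory numFieldNormedType.Exports.

(** In the coordinate x, z = exp x, the punctured disk is the quotient of a left
half-plane by x |-> x + tau, tau = 2 pi i, and the equation S_f = phi is solved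
by the quotients of solutions of the linear equation u'' = Q(exp x) u, where
Q(z) = (1/2 - z^2 phi(z)) / 2 has the power series delta^2/4 - a_1 z/2 - a_2 z^2/2
and so on.  The method of Frobenius gives two independent solutions
<<
  u1 = exp(delta x/2) h(exp x),   u2 = beta x u1 + exp(- delta x/2) k(exp x)
>>
with power series h and k ([frobenius_basis]).  The recursion for k reads
n (n - delta) k_n = lower terms.  If delta is not an integer it can be solved
with beta = 0.  If delta = 0, beta = 1 is possible.  If delta = d > 0, its step
n = d does not involve k_d, and holds for one value of beta only,
a nonzero multiple of the sum of the a_(d-i) k_i over i < d.  The rows of the
matrix in (c) express the steps 1, ..., d - 1 and the vanishing of this sum, so
beta = 0 if and only if the determinant is zero ([holonomy_det]).

The quotient Phi = u2 / u1 satisfies Phi(x + m tau) = T_m (Phi x) with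
T_m w = exp(- m tau delta) w + m tau beta ([Phi_shift]).  Every solution of
S_f = phi near exp x is M o Phi near x for a Moebius transformation M
([schwarz_local]), and M is unique ([moebius_uniq]).  Continuation along a loop
keeps M and moves x to some x + m tau ([continuation_factor]), so the holonomy
of any loop is conjugate to some T_m ([holonomy_conj]), and T_1 occurs, for the
simple loop ([simple_loop]).  In particular gamma is conjugate to some T_m; and
if gamma is the identity, then so is the whole group, hence T_1.  Therefore
gamma = id exactly when T_1 = id, and the type of gamma can be read off T_m:
the multiplier exp(- m tau delta), of modulus exp(2 pi m Im delta), if
beta = 0, and the translation by m tau beta if delta is an integer.

Complex analysis enters through the expansion of a complex-differentiable
function in a power series on a whole disk ([taylor_disk]).  It is needed for
phi, whose expansion is only given near 0, and for the solutions f, which are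
only supposed to be differentiable once.  It follows from Cauchy's formula,
which in turn comes from Goursat's subdivision argument applied to the family
of circles that shrinks the given circle to a point ([cauchy_annulus]). *)

Set Implicit Arguments.
Unset Strict Implicit.
Unset Printing Implicit Defensive.

Local Open Scope classical_set_scope.
Local Open Scope ring_scope.

(** * Modulus, real and imaginary parts *)

Section ComplexModulus.
Variable R : realType.
Local Notation C := (Cplx R).

Definition cmod (z : C) : R := complex.Re `|z|.
Definition ofR (x : R) : C := (x%:C)%C.
Definition Rep (z : C) : R := complex.Re z.
Definition Imp (z : C) : R := complex.Im z.
Definition ic : C := ('i)%C.

Lemma normE (z : C) : `|z| = ofR (cmod z).
Proof. by rewrite /cmod /ofR normc_def. Qed.

Lemma ofRI : injective ofR. Proof. by move=> x y []. Qed.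
Lemma ofR_le x y : (ofR x <= ofR y) = (x <= y). Proof. exact: lecR. Qed.
Lemma ofR_lt x y : (ofR x < ofR y) = (x < y). Proof. exact: ltcR. Qed.
Lemma ofRD x y : ofR (x + y) = ofR x + ofR y. Proof. exact: rmorphD. Qed.
Lemma ofRM x y : ofR (x * y) = ofR x * ofR y. Proof. exact: rmorphM. Qed.
Lemma ofRN x : ofR (- x) = - ofR x. Proof. exact: rmorphN. Qed.
Lemma ofRB x y : ofR (x - y) = ofR x - ofR y. Proof. exact: rmorphB. Qed.
Lemma ofR0 : ofR 0 = 0. Proof. exact: rmorph0. Qed.
Lemma ofR1 : ofR 1 = 1. Proof. exact: rmorph1. Qed.
Lemma ofRV x : ofR x^-1 = (ofR x)^-1. Proof. exact: fmorphV. Qed.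
Lemma ofRX x n : ofR (x ^+ n) = ofR x ^+ n. Proof. exact: rmorphXn. Qed.
Lemma ofR_nat n : ofR n%:R = n%:R. Proof. exact: rmorph_nat. Qed.
Lemma ofR_eq0 x : (ofR x == 0) = (x == 0). Proof. exact: fmorph_eq0. Qed.

Lemma cmodE (z : C) : cmod z = Num.sqrt (Rep z ^+ 2 + Imp z ^+ 2).
Proof. by rewrite /cmod normc_def. Qed.
Lemma cmod_ge0 z : 0 <= cmod z.
Proof. by rewrite -ofR_le ofR0 -normE normr_ge0. Qed.
Lemma cmodM x y : cmod (x * y) = cmod x * cmod y.
Proof. by apply: ofRI; rewrite ofRM -!normE normrM. Qed.
Lemma cmod0 : cmod 0 = 0. Proof. by apply: ofRI; rewrite -normE normr0 ofR0. Qed.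
Lemma cmod1 : cmod 1 = 1. Proof. by apply: ofRI; rewrite -normE normr1 ofR1. Qed.
Lemma cmodN x : cmod (- x) = cmod x. Proof. by apply: ofRI; rewrite -!normE normrN. Qed.
Lemma cmodD x y : cmod (x + y) <= cmod x + cmod y.
Proof. by rewrite -ofR_le ofRD -!normE ler_normD. Qed.
Lemma cmodB x y : cmod (x - y) <= cmod x + cmod y.
Proof. by rewrite -(cmodN y) cmodD. Qed.
Lemma cmodX x n : cmod (x ^+ n) = cmod x ^+ n.
Proof. by apply: ofRI; rewrite ofRX -!normE normrX. Qed.
Lemma cmodV x : cmod x^-1 = (cmod x)^-1.
Proof. by apply: ofRI; rewrite ofRV -!normE normfV. Qed.
Lemma cmod_eq0 x : (cmod x == 0) = (x == 0).
Proof. by rewrite -ofR_eq0 -normE normr_eq0. Qed.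
Lemma cmod_gt0 x : (0 < cmod x) = (x != 0).
Proof. by rewrite lt_neqAle cmod_ge0 andbT eq_sym cmod_eq0. Qed.
Lemma cmod_distC x y : cmod (x - y) = cmod (y - x).
Proof. by rewrite -cmodN opprB. Qed.
Lemma cmod_ofR x : cmod (ofR x) = `|x|.
Proof. by rewrite cmodE /= expr0n /= addr0 sqrtr_sqr. Qed.
Lemma cmod_nat n : cmod n%:R = n%:R.
Proof. by rewrite -ofR_nat cmod_ofR ger0_norm. Qed.
Lemma cmod_ic : cmod ic = 1.
Proof. by rewrite cmodE /= expr0n /= add0r expr1n sqrtr1. Qed.
Lemma cmod_triangle x y z : cmod (x - z) <= cmod (x - y) + cmod (y - z).
Proof. by apply: le_trans (cmodD _ _); rewrite subrKA. Qed.
Lemma cmod_sub_ge x y : cmod x - cmod y <= cmod (x - y).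
Proof. by rewrite lerBlDr -{1}(subrK y x) cmodD. Qed.
Lemma cmod_sum (I : Type) (s : seq I) (P : pred I) (f : I -> C) :
  cmod (\sum_(i <- s | P i) f i) <= \sum_(i <- s | P i) cmod (f i).
Proof.
elim/big_rec2: _ => [|i x y _ H]; first by rewrite cmod0.
by apply: le_trans (cmodD _ _) _; rewrite lerD2l.
Qed.

Lemma RepD x y : Rep (x + y) = Rep x + Rep y. Proof. by case: x y => ? ? []. Qed.
Lemma ImpD x y : Imp (x + y) = Imp x + Imp y. Proof. by case: x y => ? ? []. Qed.
Lemma RepN x : Rep (- x) = - Rep x. Proof. by case: x. Qed.
Lemma ImpN x : Imp (- x) = - Imp x. Proof. by case: x. Qed.
Lemma RepB x y : Rep (x - y) = Rep x - Rep y. Proof. by rewrite RepD RepN. Qed.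
Lemma ImpB x y : Imp (x - y) = Imp x - Imp y. Proof. by rewrite ImpD ImpN. Qed.
Lemma RepM x y : Rep (x * y) = Rep x * Rep y - Imp x * Imp y.
Proof. by case: x y => ? ? []. Qed.
Lemma ImpM x y : Imp (x * y) = Rep x * Imp y + Imp x * Rep y.
Proof. by case: x y => ? ? []. Qed.
Lemma ImpE z : Imp z = Rep (- ic * z).
Proof. by rewrite RepM RepN ImpN /= oppr0 mul0r sub0r mulN1r opprK. Qed.
Lemma cplxE z : z = ofR (Rep z) + ic * ofR (Imp z).
Proof. exact: complexE. Qed.
Lemma cplx_eq x y : Rep x = Rep y -> Imp x = Imp y -> x = y.
Proof. by case: x y => ? ? [? ?] /= -> ->. Qed.
Lemma Rep_ofR x : Rep (ofR x) = x. Proof. by []. Qed.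
Lemma Imp_ofR x : Imp (ofR x) = 0. Proof. by []. Qed.
Lemma icic : ic * ic = -1. Proof. exact: sqr_i. Qed.

Lemma Rep_le z : `|Rep z| <= cmod z.
Proof. by rewrite cmodE -sqrtr_sqr ler_sqrt ?addr_ge0 ?sqr_ge0// lerDl sqr_ge0. Qed.
Lemma Imp_le z : `|Imp z| <= cmod z.
Proof. by rewrite cmodE -sqrtr_sqr ler_sqrt ?addr_ge0 ?sqr_ge0// lerDr sqr_ge0. Qed.
Lemma cmod_le z : cmod z <= `|Rep z| + `|Imp z|.
Proof.
rewrite {1}(cplxE z); apply: le_trans (cmodD _ _) _.
by rewrite cmodM cmod_ic mul1r !cmod_ofR.
Qed.

(** An element e : C with 0 < e is automatically real: this reduces
neighbourhoods in C to radii in R. *)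
Lemma gt0_ofR (e : C) : 0 < e -> exists2 d : R, 0 < d & e = ofR d.
Proof.
case: e => a b; rewrite ltcE /= => /andP[/eqP -> h]; by exists a.
Qed.

Lemma nbhsCP (z : C) (P : set C) :
  nbhs z P <-> exists2 d : R, 0 < d & forall w, cmod (w - z) < d -> P w.
Proof.
split.
  move=> /nbhs_ballP[e /= e0 h]; have [d d0 E] := gt0_ofR e0; subst e.
  exists d => // w hw; apply: h; rewrite /ball /= normE ofR_lt.
  by rewrite cmod_distC.
case=> d d0 h; apply/nbhs_ballP; exists (ofR d) => /=.
  by rewrite -ofR0 ofR_lt.
by move=> w; rewrite /ball /= normE ofR_lt cmod_distC => /h.
Qed.

Lemma cvgCP (T : Type) (F : set_system T) {FF : Filter F} (f : T -> C) (l : C) :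
  f @ F --> l <-> forall e : R, 0 < e -> \forall x \near F, cmod (f x - l) < e.
Proof.
split.
  move=> /cvgrPdist_lt h e e0; have /h : 0 < ofR e by rewrite -ofR0 ofR_lt.
  by apply: filterS => x; rewrite normE ofR_lt cmod_distC.
move=> h; apply/cvgrPdist_lt => e /gt0_ofR [d d0 ->].
by apply: filterS (h d d0) => x; rewrite normE ofR_lt cmod_distC.
Qed.

Lemma contCP (f : C -> C) (z : C) : {for z, continuous f} <->
  forall e : R, 0 < e -> exists2 d : R, 0 < d &
    forall w, cmod (w - z) < d -> cmod (f w - f z) < e.
Proof.
have H := @cvgCP C (nbhs z) _ f (f z).
split; first by move=> /H h e e0; apply/nbhsCP; exact: h.
by move=> h; apply/H => e e0; apply/nbhsCP; exact: h.
Qed.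

End ComplexModulus.
Arguments ofR {R} x.
Arguments ic {R}.

(** Without a division by h, the expansion also makes sense at h = 0, which
spares punctured neighbourhoods in the proofs of the differentiation rules. *)
Lemma is_deriveP (K : numFieldType) (f : K -> K) (z d : K) :
  is_derive z 1 f d <-> forall e : K, 0 < e ->
    \forall h \near 0, `|f (z + h) - f z - d * h| <= e * `|h|.
Proof.
have -> : is_derive z 1 f d <->
  (fun h : K => h^-1 *: (f (h *: 1 + z) - f z)) @ 0^' --> d.
  split; first by case=> /[swap] <-.
  move=> H; have dv : derivable f z 1 by apply/cvg_ex; exists d.
  by apply: DeriveDef => //; apply: cvg_lim H.
split.
  move=> /cvgrPdist_le H e e0.
  have He : nbhs (0 : K) (fun h : K => h != 0 ->
      `|d - h^-1 *: (f (h *: 1 + z) - f z)| <= e) := H e e0.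
  apply: filterS He => h He; have [->|h0] := eqVneq h 0.
    by rewrite addr0 subrr mulr0 subr0 !normr0 mulr0.
  have := He h0; rewrite /GRing.scale /= mulr1 [h + z]addrC => H1.
  have -> : f (z + h) - f z - d * h = - (d - h^-1 * (f (z + h) - f z)) * h.
    by field.
  by rewrite normrM normrN ler_wpM2r.
move=> H; apply/cvgrPdist_le => e e0.
suff He : nbhs (0 : K) (fun h : K => h != 0 ->
    `|d - h^-1 *: (f (h *: 1 + z) - f z)| <= e) by exact: He.
apply: filterS (H e e0) => h H1 h0.
rewrite /GRing.scale /= mulr1 [h + z]addrC.
have -> : d - h^-1 * (f (z + h) - f z) = - (f (z + h) - f z - d * h) / h.
  by field.
by rewrite normrM normrN normfV ler_pdivrMr // normr_gt0.
Qed.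

(** * The complex derivative *)

Section ComplexDerivative.
Variable R : realType.
Local Notation C := (Cplx R).
Implicit Types f g : C -> C.

Definition dC f (z d : C) : Prop := is_derive z 1 f d.

Lemma dC_epsP f z d : dC f z d <-> forall e : R, 0 < e ->
  exists2 r : R, 0 < r & forall h, cmod h < r ->
    cmod (f (z + h) - f z - d * h) <= e * cmod h.
Proof.
rewrite /dC is_deriveP; split.
  move=> H e e0; have /H/nbhsCP[r r0 hr] : 0 < ofR e by rewrite -ofR0 ofR_lt.
  exists r => // h hh; have := hr h; rewrite subr0 => /(_ hh).
  by rewrite !normE -ofRM ofR_le.
move=> H e /gt0_ofR[d0 d00 ->]; have [r r0 hr] := H d0 d00.
apply/nbhsCP; exists r => // h; rewrite subr0 => hh.
by rewrite !normE -ofRM ofR_le hr.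
Qed.

Lemma dC_derivable f z : derivable f z 1 -> dC f z (derive1 f z).
Proof. by move=> /derivableP H; rewrite derive1E. Qed.

Lemma dC_ex f z d : dC f z d -> derivable f z 1.
Proof. by case. Qed.

Lemma dC_derive1 f z d : dC f z d -> derive1 f z = d.
Proof. by case=> _ <-; rewrite derive1E. Qed.

Lemma dC_uniq f z d d' : dC f z d -> dC f z d' -> d = d'.
Proof. by move=> /dC_derive1 <- /dC_derive1. Qed.

Lemma dC_eq f z d d' : d = d' -> dC f z d -> dC f z d'.
Proof. by move=> ->. Qed.

Lemma dC_cst (a z : C) : dC (fun=> a) z 0.
Proof. exact: is_derive_cst. Qed.

Lemma dC_id (z : C) : dC (fun w => w) z 1.
Proof. exact: is_derive_id. Qed.

Lemma dCD f g z a b : dC f z a -> dC g z b -> dC (fun w => f w + g w) z (a + b).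
Proof. exact: is_deriveD. Qed.

Lemma dCN f z a : dC f z a -> dC (fun w => - f w) z (- a).
Proof. exact: is_deriveN. Qed.

Lemma dCB f g z a b : dC f z a -> dC g z b -> dC (fun w => f w - g w) z (a - b).
Proof. by move=> ? ?; apply: dCD => //; exact: dCN. Qed.

Lemma dCM f g z a b : dC f z a -> dC g z b ->
  dC (fun w => f w * g w) z (a * g z + f z * b).
Proof.
move=> ha hb; apply: dC_eq (is_deriveM ha hb).
by rewrite /GRing.scale /= addrC; congr (_ + _); rewrite mulrC.
Qed.

Lemma dCMl (c : C) f z a : dC f z a -> dC (fun w => c * f w) z (c * a).
Proof.
by move=> ha; apply: dC_eq (dCM (dC_cst c z) ha); rewrite mul0r add0r.
Qed.

Lemma near0_shift (z : C) (P : C -> Prop) : (\forall w \near z, P w) ->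
  \forall h \near 0, P (z + h).
Proof.
move=> /nbhsCP[d d0 H]; apply/nbhsCP; exists d => // w; rewrite subr0 => hw.
by apply: H; rewrite addrC addKr.
Qed.

Lemma dC_near f g z a : (\forall w \near z, f w = g w) -> dC f z a -> dC g z a.
Proof.
move=> E /is_deriveP H; apply/is_deriveP => e e0.
have Ez := nbhs_singleton E; have Es := near0_shift E.
by near=> h; rewrite -Ez -(near Es h)//; near: h; exact: H.
Unshelve. all: by end_near. Qed.

Lemma dC_cont f z a : dC f z a -> {for z, continuous f}.
Proof.
by case=> d _; apply: differentiable_continuous; apply/derivable1_diffP.
Qed.

Lemma dC_comp f g z a b : dC g z a -> dC f (g z) b ->
  dC (fun w => f (g w)) z (b * a).
Proof.
move=> /dC_epsP hg /dC_epsP hf; apply/dC_epsP => e e0.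
pose M := cmod a + 1; have M0 : 0 < M by rewrite /M; have := cmod_ge0 a; lra.
pose N := cmod b + 1; have N0 : 0 < N by rewrite /N; have := cmod_ge0 b; lra.
pose e1 := e / (2 * M); have e10 : 0 < e1 by rewrite divr_gt0 ?mulr_gt0.
pose e2 := Num.min 1 (e / (2 * N)).
have e20 : 0 < e2 by rewrite lt_min ltr01 divr_gt0 ?mulr_gt0.
have [r1 r10 h1] := hf e1 e10; have [r2 r20 h2] := hg e2 e20.
exists (Num.min r2 (r1 / M)); first by rewrite lt_min r20 divr_gt0.
move=> h; rewrite lt_min => /andP[hr2]; rewrite ltr_pdivlMr// => hr1.
have E2 := h2 h hr2.
pose k := g (z + h) - g z.
have kM : cmod k <= cmod h * M.
  have -> : k = (g (z + h) - g z - a * h) + a * h by rewrite /k; ring.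
  apply: le_trans (cmodD _ _) _; rewrite cmodM.
  have : e2 * cmod h <= 1 * cmod h by rewrite ler_wpM2r ?cmod_ge0// ge_min lexx.
  rewrite /M; lra.
have /h1 : cmod k < r1 by lra.
rewrite {1}/k subrKC => E1.
have -> : f (g (z + h)) - f (g z) - b * a * h =
  (f (g (z + h)) - f (g z) - b * k) + b * (g (z + h) - g z - a * h).
  by rewrite /k; ring.
apply: le_trans (cmodD _ _) _; rewrite cmodM.
have A1 : e1 * cmod k <= e / 2 * cmod h.
  apply: (@le_trans _ _ (e1 * (cmod h * M))); first by rewrite ler_wpM2l// ltW.
  rewrite le_eqVlt; apply/orP; left; apply/eqP; rewrite /e1; field.
  by rewrite gt_eqF.
have A2 : cmod b * cmod (g (z + h) - g z - a * h) <= e / 2 * cmod h.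
  apply: (@le_trans _ _ (N * (e2 * cmod h))).
    by apply: ler_pM; rewrite ?cmod_ge0// /N; lra.
  have : e2 <= e / (2 * N) by rewrite ge_min lexx orbT.
  rewrite ler_pdivlMr ?mulr_gt0// => X.
  have := cmod_ge0 h; move: X; move: (cmod h) => y X y0; nra.
have -> : e * cmod h = e / 2 * cmod h + e / 2 * cmod h by field.
by apply: le_trans (lerD E1 (lexx _)) _; rewrite lerD.
Qed.

Lemma dC_inv (z : C) : z != 0 -> dC (fun w => w^-1) z (- (z ^+ 2)^-1).
Proof.
move=> z0; have n0 : 0 < cmod z by rewrite cmod_gt0.
apply/dC_epsP => e e0; pose M := cmod z ^+ 3.
have M0 : 0 < M by rewrite exprn_gt0.
exists (Num.min (cmod z / 2) (e * M / 2)).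
  by rewrite lt_min divr_gt0//= divr_gt0// mulr_gt0.
move=> h; rewrite lt_min => /andP[h1 h2].
have n1 : cmod z / 2 <= cmod (z + h).
  by have := cmod_sub_ge z (- h); rewrite opprK cmodN; lra.
have zh0 : z + h != 0 by rewrite -cmod_gt0; apply: lt_le_trans n1; lra.
have -> : (z + h)^-1 - z^-1 - - (z ^+ 2)^-1 * h = h * h / (z ^+ 2 * (z + h)).
  by field; rewrite zh0 z0.
have P0 : 0 < cmod (z ^+ 2 * (z + h)) by rewrite cmod_gt0 mulf_neq0// expf_neq0.
rewrite cmodM cmodV ler_pdivrMr// [cmod (h * h)]cmodM [leRHS]mulrAC.
rewrite ler_wpM2r ?cmod_ge0//; apply: le_trans (ltW h2) _.
rewrite -mulrA ler_wpM2l ?(ltW e0)// [cmod (_ ^+ 2 * _)]cmodM cmodX.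
by rewrite /M exprSr -mulrA ler_wpM2l// exprn_ge0// ltW.
Qed.

Lemma dCV f z a : f z != 0 -> dC f z a -> dC (fun w => (f w)^-1) z (- a / f z ^+ 2).
Proof.
move=> f0 df; apply: dC_eq (dC_comp df (dC_inv f0)).
by rewrite mulNr mulNr mulrC.
Qed.

Lemma dC_div f g z a b : g z != 0 -> dC f z a -> dC g z b ->
  dC (fun w => f w / g w) z ((a * g z - f z * b) / g z ^+ 2).
Proof.
move=> g0 ha hb; apply: dC_eq (dCM ha (dCV g0 hb)); field.
exact: g0.
Qed.

Lemma dCX f z a n : dC f z a ->
  dC (fun w => f w ^+ n) z (n%:R * f z ^+ n.-1 * a).
Proof.
move=> ha; elim: n => [|n IH].
  by rewrite /= !mul0r; exact: (dC_cst 1 z).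
have -> : (fun w => f w ^+ n.+1) = (fun w => f w * f w ^+ n).
  by apply/funext => w; rewrite exprS.
apply: dC_eq (dCM ha IH); case: n IH => [|n] _ /=; first by rewrite expr0; ring.
by rewrite exprS -(natr1 n.+1); ring.
Qed.

Lemma dC_Re f (t : R) d : dC f (ofR t) d ->
  is_derive t 1 (fun s : R => Rep (f (ofR s))) (Rep d).
Proof.
move=> /dC_epsP H; apply/is_deriveP => e e0; have [r r0 h] := H e e0.
apply/nbhs_ballP; exists r => //= s; rewrite /ball /= sub0r normrN => sr.
have := h (ofR s); rewrite cmod_ofR => /(_ sr); apply: le_trans.
rewrite ofRD; apply: le_trans (Rep_le _).
by rewrite !RepB RepM Imp_ofR Rep_ofR mulr0 subr0.
Qed.

Lemma dC_Im f (t : R) d : dC f (ofR t) d ->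
  is_derive t 1 (fun s : R => Imp (f (ofR s))) (Imp d).
Proof.
move=> /(dCMl (- ic))/dC_Re; rewrite -ImpE.
by under eq_fun do rewrite -ImpE.
Qed.

Lemma derive_bound_real (g dg : R -> R) (M : R) :
  (forall t : R, 0 <= t <= 1 -> is_derive t 1 g (dg t)) ->
  (forall t : R, 0 <= t <= 1 -> `|dg t| <= M) -> `|g 1 - g 0| <= M.
Proof.
move=> H B; have [] := @MVT_segment R g dg 0 1 ler01.
- by move=> x /[!in_itv]/= /andP[x0 x1]; apply: H; rewrite !ltW.
- apply: derivable_within_continuous => x /[!in_itv]/= hx.
  by have [] := H x hx.
by move=> c /[!in_itv]/= hc ->; rewrite subr0 mulr1; exact: B.
Qed.

(** The real mean value theorem applies to the real and the imaginary part
separately; adding the two bounds costs the factor 2. *)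
Lemma mean_value f (f' : C -> C) z h (M : R) :
  (forall t : R, 0 <= t <= 1 -> dC f (z + ofR t * h) (f' (z + ofR t * h))) ->
  (forall t : R, 0 <= t <= 1 -> cmod (f' (z + ofR t * h)) <= M) ->
  cmod (f (z + h) - f z) <= 2 * (M * cmod h).
Proof.
move=> H B.
pose F w := f (z + w * h).
have dF t : 0 <= t <= 1 -> dC F (ofR t) (f' (z + ofR t * h) * h).
  move=> t01; apply: (@dC_comp f (fun w => z + w * h)); last exact: H.
  apply: dC_eq (dCD (dC_cst z _) (dCM (dC_id _) (dC_cst h _))).
  by rewrite mul1r mulr0 addr0 add0r.
have bF t : 0 <= t <= 1 -> cmod (f' (z + ofR t * h) * h) <= M * cmod h.
  by move=> t01; rewrite cmodM ler_wpM2r ?cmod_ge0// B.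
have F1 : f (z + h) = F (ofR 1) by rewrite /F ofR1 mul1r.
have F0 : f z = F (ofR 0) by rewrite /F ofR0 mul0r addr0.
rewrite F1 F0; apply: le_trans (cmod_le _) _.
rewrite mulr_natl mulr2n RepB ImpB; apply: lerD.
  apply: (@derive_bound_real (fun t => Rep (F (ofR t))) (fun t => Rep (f' (z + ofR t * h) * h))) => t ht.
    by apply: dC_Re; exact: dF.
  exact: le_trans (Rep_le _) (bF t ht).
apply: (@derive_bound_real (fun t => Imp (F (ofR t))) (fun t => Imp (f' (z + ofR t * h) * h))) => t ht.
  by apply: dC_Im; exact: dF.
exact: le_trans (Imp_le _) (bF t ht).
Qed.

Lemma dC0_segment f z h :
  (forall t : R, 0 <= t <= 1 -> dC f (z + ofR t * h) 0) -> f (z + h) = f z.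
Proof.
move=> H; apply/eqP; rewrite -subr_eq0 -cmod_eq0 eq_le cmod_ge0 andbT.
have := @mean_value f (fun=> 0) z h 0 H; rewrite mul0r mulr0; apply.
by move=> t _; rewrite cmod0.
Qed.

Lemma dC0_near f z : (\forall w \near z, dC f w 0) ->
  \forall w \near z, f w = f z.
Proof.
move=> /nbhsCP[r r0 H]; apply/nbhsCP; exists r => // w hw.
rewrite -[w](subrKC z); apply: dC0_segment => t /andP[t0 t1].
apply: H; rewrite addrC addKr cmodM cmod_ofR ger0_norm//.
by apply: le_lt_trans hw; rewrite ler_piMl ?cmod_ge0.
Qed.

End ComplexDerivative.

(** * The complex exponential *)

Section ComplexExponential.
Variable R : realType.
Local Notation C := (Cplx R).

Definition cexp (z : C) : C :=
  ofR (expR (Rep z)) * (ofR (cos (Imp z)) + ic * ofR (sin (Imp z))).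

Lemma cexpD z w : cexp (z + w) = cexp z * cexp w.
Proof.
rewrite /cexp RepD ImpD expRD cosD sinD.
rewrite !(ofRM, ofRD, ofRN).
have := icic R; move: (ic) => i Hi; ring: Hi.
Qed.

Lemma cexp0 : cexp 0 = 1.
Proof. by rewrite /cexp /= expR0 cos0 sin0 !(ofR0, ofR1) mulr0 addr0 mulr1. Qed.

Lemma cexpNM z : cexp (- z) * cexp z = 1.
Proof. by rewrite -cexpD addNr cexp0. Qed.

Lemma cexp_neq0 z : cexp z != 0.
Proof.
apply/eqP => H; have := cexpNM z; rewrite H mulr0 => /eqP.
by rewrite eq_sym oner_eq0.
Qed.

Lemma cexpN z : cexp (- z) = (cexp z)^-1.
Proof. by rewrite -[RHS]mul1r -(cexpNM z) mulfK ?cexp_neq0. Qed.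

Lemma cexpB z w : cexp (z - w) = cexp z / cexp w.
Proof. by rewrite cexpD cexpN. Qed.

Lemma cexpMn z n : cexp (n%:R * z) = cexp z ^+ n.
Proof.
elim: n => [|n IH]; first by rewrite mul0r cexp0.
by rewrite -natr1 mulrDl mul1r cexpD IH exprSr.
Qed.

Lemma Rep_cs (a b : R) : Rep (ofR a + ic * ofR b) = a.
Proof. by rewrite RepD RepM /= mul0r mulr0 subrr addr0. Qed.

Lemma Imp_cs (a b : R) : Imp (ofR a + ic * ofR b) = b.
Proof. by rewrite ImpD ImpM /= mul0r add0r mul1r add0r. Qed.

Lemma Rep_ofRM (a : R) z : Rep (ofR a * z) = a * Rep z.
Proof. by rewrite RepM Imp_ofR mul0r subr0. Qed.

Lemma Imp_ofRM (a : R) z : Imp (ofR a * z) = a * Imp z.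
Proof. by rewrite ImpM Imp_ofR mul0r addr0. Qed.

Lemma cmod_cexp z : cmod (cexp z) = expR (Rep z).
Proof.
rewrite cmodM cmod_ofR ger0_norm ?expR_ge0//.
by rewrite cmodE Rep_cs Imp_cs cos2Dsin2 sqrtr1 mulr1.
Qed.

Lemma taylor1_real (f : R -> R) d : is_derive (0 : R) 1 f d ->
  forall e : R, 0 < e -> exists2 r : R, 0 < r & forall h, `|h| < r ->
    `|f h - f 0 - d * h| <= e * `|h|.
Proof.
move=> /is_deriveP H e /H /nbhs_ballP [r /= r0 hr]; exists r => // h hh.
by have := hr h; rewrite /ball /= sub0r normrN add0r => /(_ hh).
Qed.

(** The first order expansions of the real exp, cos and sin at 0 give that of
[cexp]; by [cexpD] the derivative at this one point determines all others. *)
Lemma dC_cexp0 : dC cexp 0 1.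
Proof.
apply/dC_epsP => e e0; rewrite cexp0.
pose d := e / 10; have d0 : 0 < d by rewrite divr_gt0.
have [r1 r10 H1] := taylor1_real (is_derive_expR 0) d0.
have [r2 r20 H2] := taylor1_real (is_derive_cos 0) d0.
have [r3 r30 H3] := taylor1_real (is_derive_sin 0) d0.
have [r4 r40 H4] := taylor1_real (is_derive_expR 0) ltr01.
exists (Num.min (Num.min r1 r2) (Num.min (Num.min r3 r4) (Num.min (1/2) d))).
  by rewrite !lt_min r10 r20 r30 r40 d0 divr_gt0.
move=> h; rewrite !lt_min => /andP[/andP[h1 h2] /andP[/andP[h3 h4] /andP[h5 h6]]].
rewrite add0r mul1r.
have hx := Rep_le h; have hy := Imp_le h.
have {}H1 := H1 _ (le_lt_trans hx h1); have {}H2 := H2 _ (le_lt_trans hy h2).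
have {}H3 := H3 _ (le_lt_trans hy h3); have {}H4 := H4 _ (le_lt_trans hx h4).
move: H1 H2 H3 H4; rewrite expR0 cos0 sin0 oppr0 mul0r !(subr0, addr0) !mul1r => H1 H2 H3 H4.
have E2 : expR (Rep h) <= 2.
  move: H4 hx h5; rewrite ler_norml => /andP[_ H4].
  by have := ler_norm (Rep h); lra.
have E1 : `|expR (Rep h) - 1| <= 2 * cmod h.
  have -> : expR (Rep h) - 1 = (expR (Rep h) - 1 - Rep h) + Rep h by ring.
  by apply: le_trans (ler_normD _ _) _; lra.
have E0 := expR_ge0 (Rep h).
apply: le_trans (cmod_le _) _.
have -> : Rep (cexp h - 1 - h) =
   (expR (Rep h) - 1 - Rep h) + expR (Rep h) * (cos (Imp h) - 1).
  by rewrite !RepB Rep_ofRM Rep_cs /=; ring.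
have -> : Imp (cexp h - 1 - h) =
   expR (Rep h) * (sin (Imp h) - Imp h) + (expR (Rep h) - 1) * Imp h.
  by rewrite !ImpB Imp_ofRM Imp_cs /=; ring.
have D1 : d * `|Rep h| <= d * cmod h by rewrite ler_wpM2l// ltW.
have D2 : d * `|Imp h| <= d * cmod h by rewrite ler_wpM2l// ltW.
have N0 := cmod_ge0 h.
have T1 : `|expR (Rep h) * (cos (Imp h) - 1)| <= 2 * (d * cmod h).
  by rewrite normrM ger0_norm//; apply: ler_pM => //; exact: le_trans H2 D2.
have T2 : `|expR (Rep h) * (sin (Imp h) - Imp h)| <= 2 * (d * cmod h).
  by rewrite normrM ger0_norm//; apply: ler_pM => //; exact: le_trans H3 D2.
have T3 : `|(expR (Rep h) - 1) * Imp h| <= 2 * (d * cmod h).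
  rewrite normrM; apply: (@le_trans _ _ (2 * cmod h * cmod h)).
    by apply: ler_pM.
  by rewrite -mulrA ler_wpM2l// ler_wpM2r// ltW.
have T0 := le_trans H1 D1.
have := ler_normD (expR (Rep h) - 1 - Rep h) (expR (Rep h) * (cos (Imp h) - 1)).
have := ler_normD (expR (Rep h) * (sin (Imp h) - Imp h)) ((expR (Rep h) - 1) * Imp h).
have -> : e = 10 * d by rewrite /d; field.
have : 0 <= d * cmod h by rewrite mulr_ge0// ltW.
rewrite -(mulrA 10); move: T0 T1 T2 T3.
move: (d * cmod h) => q; lra.
Qed.

Lemma dC_cexp z : dC cexp z (cexp z).
Proof.
apply/dC_epsP => e e0; have N0 : 0 < cmod (cexp z) by rewrite cmod_cexp expR_gt0.
have e10 : 0 < e / cmod (cexp z) by rewrite divr_gt0.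
have [r r0 H] := (dC_epsP _ _ _).1 dC_cexp0 _ e10.
exists r => // h /H; rewrite add0r cexp0 mul1r cexpD => H1.
have -> : cexp z * cexp h - cexp z - cexp z * h = cexp z * (cexp h - 1 - h) by ring.
rewrite cmodM; apply: le_trans (ler_wpM2l (ltW N0) H1) _.
by rewrite mulrA [_ * (e / _)]mulrC divfK// gt_eqF.
Qed.

Lemma dC_cexp_comp f z a : dC f z a -> dC (fun w => cexp (f w)) z (cexp (f z) * a).
Proof. by move=> H; apply: dC_comp H (dC_cexp _). Qed.

Definition tau : C := ic * ofR (pi *+ 2).

Lemma Rep_tau : Rep tau = 0.
Proof. by rewrite /tau RepM /= mul0r mul1r subrr. Qed.

Lemma Imp_tau : Imp tau = pi *+ 2.
by rewrite /tau ImpM [Rep ic]/= [Imp ic]/= mul0r mul1r add0r. Qed.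

Lemma cexp_tau : cexp tau = 1.
Proof.
by rewrite /cexp Rep_tau Imp_tau expR0 cos2pi sin2pi !(ofR0, ofR1) mulr0 addr0 mulr1.
Qed.

Lemma cexp_int (k : int) : cexp (k%:~R * tau) = 1.
Proof.
case: k => n; rewrite ?NegzE.
  by rewrite -pmulrn cexpMn cexp_tau expr1n.
by rewrite mulrNz mulNr cexpN -pmulrn cexpMn cexp_tau expr1n invr1.
Qed.

Lemma Rep_int (k : int) (z : C) : Rep (k%:~R * z) = k%:~R * Rep z.
Proof. by rewrite -(rmorph_int (real_complex R)) Rep_ofRM. Qed.

Lemma Imp_int (k : int) (z : C) : Imp (k%:~R * z) = k%:~R * Imp z.
Proof. by rewrite -(rmorph_int (real_complex R)) Imp_ofRM. Qed.

Lemma cos_eq1 (y : R) : cos y = 1 -> - pi <= y <= pi -> y = 0.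
Proof.
wlog y0 : y / 0 <= y.
  move=> H cy hy; have [/H|/ltW y0] := leP 0 y; first exact.
  apply/eqP; rewrite -oppr_eq0; apply/eqP; apply: H.
  - by rewrite oppr_ge0.
  - by rewrite cosN.
  - by move: hy; rewrite lerN2 lerNl andbC.
move=> cy /andP[_ hy]; apply: cos_inj; rewrite ?in_itv/= ?lexx ?pi_ge0 ?y0//.
by rewrite cos0.
Qed.

(** The modulus of exp z shows that Re z = 0.  After subtraction of a multiple
of tau, Im z lies between - pi and pi, where cos is 1 only at 0. *)
Lemma cexp_eq1 z : cexp z = 1 -> exists k : int, z = k%:~R * tau.
Proof.
move=> H.
have x0 : Rep z = 0.
  by apply: expR_inj; rewrite -cmod_cexp H cmod1 expR0.
have p0 : 0 < pi *+ 2 :> R by rewrite pmulrn_rgt0// pi_gt0.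
pose k := Num.floor ((Imp z + pi) / (pi *+ 2)).
exists k; apply/eqP; rewrite -subr_eq0; apply/eqP.
have cy : cos (Imp (z - k%:~R * tau)) = 1.
  have : Rep (cexp (z - k%:~R * tau)) = 1.
    by rewrite cexpB cexp_int divr1 H.
  by rewrite Rep_ofRM Rep_cs RepB Rep_int Rep_tau mulr0 subr0 x0 expR0 mul1r.
have iy : Imp (z - k%:~R * tau) = 0.
  apply: cos_eq1 => //; rewrite ImpB Imp_int Imp_tau.
  have /andP[] := mem_rg1_floor ((Imp z + pi) / (pi *+ 2)).
  rewrite -/k ler_pdivlMr// ltr_pdivrMr// mulrDl mul1r.
  move: (k%:~R * (pi *+ 2)) => q; move: (@pi_gt0 R); lra.
apply: cplx_eq; rewrite ?iy// RepB x0 Rep_int Rep_tau mulr0 subr0//.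
Qed.

Lemma cexp_eq z w : cexp z = cexp w -> exists k : int, z = w + k%:~R * tau.
Proof.
move=> H; have [|k hk] := @cexp_eq1 (z - w).
  by rewrite cexpB H divff ?cexp_neq0.
by exists k; rewrite -hk subrKC.
Qed.

Lemma cexp_surj z : z != 0 -> exists w, cexp w = z.
Proof.
rewrite -cmod_gt0 => n0.
pose x := Rep z / cmod z; pose y := Imp z / cmod z.
have xy : x ^+ 2 + y ^+ 2 = 1.
  have n2 : cmod z ^+ 2 = Rep z ^+ 2 + Imp z ^+ 2.
    by rewrite cmodE sqr_sqrtr// addr_ge0// sqr_ge0.
  rewrite /x /y !exprMn -mulrDl -n2 exprVn divff// expf_neq0//.
  by rewrite gt_eqF.
have x1 : -1 <= x <= 1.
  rewrite -ler_norml -(@ler_sqr _ `|x|) ?nnegrE// real_normK ?num_real//.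
  by rewrite expr1n -xy lerDl sqr_ge0.
have [t ct st] : exists2 t, cos t = x & sin t = y.
  have sa : sin (acos x) = `|y|.
    by rewrite sin_acos// -xy addrC addKr sqrtr_sqr.
  have [y0|y0] := leP 0 y.
    by exists (acos x); [rewrite acosK ?in_itv|rewrite sa ger0_norm].
  exists (- acos x); first by rewrite cosN acosK ?in_itv.
  by rewrite sinN sa ltr0_norm// opprK.
exists (ofR (ln (cmod z)) + ic * ofR t).
rewrite /cexp Rep_cs Imp_cs ct st lnK ?posrE//.
apply: cplx_eq; rewrite ?Rep_ofRM ?Imp_ofRM ?Rep_cs ?Imp_cs.
  by rewrite mulrC divfK// gt_eqF.
by rewrite mulrC divfK// gt_eqF.
Qed.

End ComplexExponential.
Arguments tau {R}.

(** * Power series *)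

Section PowerSeries.
Variable R : realType.
Local Notation C := (Cplx R).

Lemma geo_sum (q : R) n : 0 <= q < 1 -> \sum_(i < n) q ^+ i <= (1 - q)^-1.
Proof.
move=> /andP[q0 q1]; have d0 : 0 < 1 - q by lra.
rewrite -[leRHS]mul1r ler_pdivlMr//.
have -> : (\sum_(i < n) q ^+ i) * (1 - q) = 1 - q ^+ n.
  elim: n => [|n IH]; first by rewrite big_ord0 mul0r expr0 subrr.
  by rewrite big_ord_recr /= mulrDl IH exprS; ring.
by rewrite gerBl exprn_ge0.
Qed.

Lemma nat_geo (q : R) n : 0 <= q < 1 -> n%:R * q ^+ n <= (1 - q)^-1.
Proof.
move=> q01; apply: le_trans (geo_sum n q01); case/andP: q01 => q0 q1.
rewrite mulr_natl -[n in _ *+ n]card_ord -sumr_const; apply: ler_sum => i _.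
by apply: ler_wiXn2l => //; [exact: ltW|exact: ltnW].
Qed.

Lemma geo_lim0 (B q : R) : 0 <= q < 1 -> forall e : R, 0 < e ->
  exists N, forall n, (N <= n)%N -> B * q ^+ n < e.
Proof.
move=> /andP[q0 q1] e e0.
have H : (fun n => B * q ^+ n) @ \oo --> (0 : R).
  by apply: (@cvg_geometric R B q); rewrite ger0_norm.
move/cvgrPdist_lt : H => /(_ e e0) [N _ hN].
exists N => n /hN /=; rewrite sub0r normrN; apply: le_lt_trans; exact: ler_norm.
Qed.

Lemma cvgC_ReIm (u : nat -> C) (a b : R) :
  (fun n => Rep (u n)) @ \oo --> a -> (fun n => Imp (u n)) @ \oo --> b ->
  u @ \oo --> ofR a + ic * ofR b.
Proof.
move=> /cvgrPdist_lt ha /cvgrPdist_lt hb; apply/cvgCP => e e0.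
have e20 : 0 < e / 2 by rewrite divr_gt0.
near=> n; apply: le_lt_trans (cmod_le _) _.
rewrite RepB ImpB Rep_cs Imp_cs.
have : `|a - Rep (u n)| < e / 2 by near: n; exact: ha.
have : `|b - Imp (u n)| < e / 2 by near: n; exact: hb.
by rewrite (distrC a) (distrC b); lra.
Unshelve. all: by end_near. Qed.

Lemma summableC (u : nat -> C) (B q : R) : 0 <= q < 1 ->
  (forall n, cmod (u n) <= B * q ^+ n) ->
  exists l : C, (fun n => \sum_(i < n) u i) @ \oo --> l.
Proof.
move=> q01 H.
have key (v : nat -> R) : (forall n, `|v n| <= B * q ^+ n) ->
    exists a : R, (fun n => \sum_(i < n) v i) @ \oo --> a.
  move=> Hv; apply/cvg_ex.
  have -> : (fun n => \sum_(i < n) v i) = series v by rewrite seriesEord.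
  apply: normed_cvg; apply: (@series_le_cvg _ _ (geometric B q)).
  - by move=> n; exact: normr_ge0.
  - by move=> n; exact: le_trans (normr_ge0 _) (Hv n).
  - exact: Hv.
  by apply: is_cvg_geometric_series; case/andP: q01 => q0 q1; rewrite ger0_norm.
have [a ha] := key (fun n => Rep (u n)) (fun n => le_trans (Rep_le _) (H n)).
have [b hb] := key (fun n => Imp (u n)) (fun n => le_trans (Imp_le _) (H n)).
exists (ofR a + ic * ofR b); apply: cvgC_ReIm.
  suff -> : (fun n => Rep (\sum_(i < n) u i)) = (fun n => \sum_(i < n) Rep (u i)) by [].
  apply/funext => n; apply: (big_morph (@Rep R)) => //; exact: RepD.
suff -> : (fun n => Imp (\sum_(i < n) u i)) = (fun n => \sum_(i < n) Imp (u i)) by [].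
apply/funext => n; apply: (big_morph (@Imp R)) => //; exact: ImpD.
Qed.

Lemma cvg_cmod_le (f : nat -> C) (l a : C) (M : R) : f @ \oo --> l ->
  (forall n, cmod (f n - a) <= M) -> cmod (l - a) <= M.
Proof.
move=> /cvgCP H B; apply/ler_addgt0Pr => e /H /= [N _ hN].
have := hN N (leqnn N) => /= h; apply: le_trans (cmod_triangle l (f N) a) _.
by have := B N; rewrite cmod_distC; lra.
Qed.

Definition psum (c : nat -> C) (z : C) (n : nat) : C := \sum_(i < n) c i * z ^+ i.
Definition PS (c : nat -> C) (z : C) : C := lim (psum c z @ \oo).
(** The radius of convergence is at least r.  Asking for bounds at every s < r
rather than at r makes the property stable under multiplication of c n by n. *)
Definition radius_ge (c : nat -> C) (r : R) : Prop :=
  forall s, 0 < s < r -> exists B : R, forall n, cmod (c n) * s ^+ n <= B.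

Lemma radius_le c r r' : r' <= r -> radius_ge c r -> radius_ge c r'.
Proof. by move=> h H s /andP[s0 sr]; apply: H; rewrite s0 (lt_le_trans sr). Qed.

(** Comparison of x with a larger s < r turns boundedness into geometric
decay, from which the convergence statements on power series follow. *)
Lemma radius_geometric c r x : radius_ge c r -> 0 <= x < r -> exists B q : R,
  [/\ 0 <= B, 0 <= q < 1 & forall n, cmod (c n) * x ^+ n <= B * q ^+ n].
Proof.
move=> H /andP[x0 xr]; pose s := (x + r) / 2.
have s0 : 0 < s by rewrite /s; lra.
have [|B hB] := H s; first by rewrite s0 /s; lra.
have B0 : 0 <= B by have := hB 0%N; rewrite expr0 mulr1; have := cmod_ge0 (c 0%N); lra.
exists B, (x / s); split => //.
  by rewrite divr_ge0 ?(ltW s0)//= ltr_pdivrMr// mul1r /s; lra.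
move=> n; have -> : x ^+ n = s ^+ n * (x / s) ^+ n.
  by rewrite -exprMn mulrC divfK// gt_eqF.
by rewrite mulrA ler_wpM2r// exprn_ge0// divr_ge0// ltW.
Qed.

Lemma psum_cvg c r z : radius_ge c r -> cmod z < r -> psum c z @ \oo --> PS c z.
Proof.
move=> H zr; have [|B [q [B0 q01 hB]]] := radius_geometric H (x := cmod z).
  by rewrite cmod_ge0.
have [|l hl] := @summableC (fun n => c n * z ^+ n) B q q01.
  by move=> n; rewrite cmodM cmodX.
by rewrite /PS (cvg_lim _ hl).
Qed.

Lemma PS_lim c z l : psum c z @ \oo --> l -> PS c z = l.
Proof. by move=> hl; apply: cvg_lim. Qed.

Lemma PS0 c : PS c 0 = c 0%N.
Proof.
apply: PS_lim; apply/cvgCP => e e0; exists 1%N => //= -[//|n] _.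
rewrite /psum big_ord_recl expr0 mulr1 big1 ?addr0 ?subrr ?cmod0// => i _.
by rewrite exprS mul0r mulr0.
Qed.

Lemma radius_natM c r : radius_ge c r -> radius_ge (fun n => n%:R * c n) r.
Proof.
move=> H s /andP[s0 sr].
pose t := (s + r) / 2; have t0 : 0 < t by rewrite /t; lra.
have [|B hB] := H t; first by rewrite t0 /t; lra.
have q01 : 0 <= s / t < 1.
  by rewrite divr_ge0 ?(ltW s0) ?(ltW t0)//= ltr_pdivrMr// mul1r /t; lra.
exists ((1 - s / t)^-1 * B) => n.
have -> : cmod (n%:R * c n) * s ^+ n = (n%:R * (s / t) ^+ n) * (cmod (c n) * t ^+ n).
  have -> : s ^+ n = (s / t) ^+ n * t ^+ n by rewrite -exprMn divfK// gt_eqF.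
  by rewrite cmodM cmod_nat; ring.
apply: ler_pM; rewrite ?nat_geo//; apply: mulr_ge0; rewrite ?cmod_ge0 ?exprn_ge0//.
  by case/andP: q01.
exact: ltW.
Qed.

Lemma radius_scale c r (a : C) : radius_ge c r -> radius_ge (fun n => a * c n) r.
Proof.
move=> H s /H[B hB]; exists (cmod a * B) => n.
by rewrite cmodM -mulrA ler_wpM2l ?cmod_ge0.
Qed.

Lemma radius_add c d r : radius_ge c r -> radius_ge d r -> radius_ge (fun n => c n + d n) r.
Proof.
move=> H1 H2 s hs; have [B hB] := H1 s hs; have [D hD] := H2 s hs.
case/andP: hs => s0 _; exists (B + D) => n; apply: le_trans (lerD (hB n) (hD n)).
by rewrite -mulrDl ler_wpM2r ?cmodD// exprn_ge0// ltW.
Qed.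

Lemma radius_shift c r : radius_ge c r -> radius_ge (fun n => c n.+1) r.
Proof.
move=> H s hs; have [B hB] := H s hs; case/andP: hs => s0 _.
exists (B / s) => n; rewrite ler_pdivlMr//; apply: le_trans (hB n.+1).
by rewrite exprSr mulrA.
Qed.

Definition unshift (d : nat) (c : nat -> C) n : C :=
  if (n < d)%N then 0 else c (n - d)%N.

Lemma radius_unshift d c r : radius_ge c r -> radius_ge (unshift d c) r.
Proof.
move=> H s hs; have [B hB] := H s hs; case/andP: hs => s0 _.
have B0 : 0 <= B by have := hB 0%N; rewrite expr0 mulr1; have := cmod_ge0 (c 0%N); lra.
have sd : 0 <= s ^+ d by rewrite exprn_ge0// ltW.
exists (B * s ^+ d) => n; rewrite /unshift; case: ltnP => h.
  by rewrite cmod0 mul0r mulr_ge0.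
by rewrite -{2}(subnK h) exprD mulrA ler_wpM2r.
Qed.

Lemma PS_add c d r z : radius_ge c r -> radius_ge d r -> cmod z < r ->
  PS (fun n => c n + d n) z = PS c z + PS d z.
Proof.
move=> hc hd zr; apply: PS_lim.
have -> : psum (fun n => c n + d n) z = (fun n => psum c z n + psum d z n).
  apply/funext => n; rewrite /psum -big_split; apply: eq_bigr => i _.
  by rewrite mulrDl.
by apply: cvgD; apply: psum_cvg; eassumption.
Qed.

Lemma PS_scale c r z (a : C) : radius_ge c r -> cmod z < r ->
  PS (fun n => a * c n) z = a * PS c z.
Proof.
move=> hc zr; apply: PS_lim.
have -> : psum (fun n => a * c n) z = (fun n => a * psum c z n).
  apply/funext => n; rewrite /psum mulr_sumr; apply: eq_bigr => i _.
  by rewrite mulrA.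
by apply: cvgM; [exact: cvg_cst|apply: psum_cvg; eassumption].
Qed.

Lemma PS_recl c r z : radius_ge c r -> cmod z < r ->
  PS c z = c 0%N + z * PS (fun n => c n.+1) z.
Proof.
move=> hc zr; apply: PS_lim; rewrite -(cvg_shiftS (psum c z)).
have -> : (fun n => psum c z n.+1) = (fun n => c 0%N + z * psum (fun n => c n.+1) z n).
  apply/funext => n; rewrite /psum big_ord_recl expr0 mulr1; congr (_ + _).
  by rewrite mulr_sumr; apply: eq_bigr => i _; rewrite exprS mulrCA.
apply: cvgD; first exact: cvg_cst.
apply: cvgM; first exact: cvg_cst.
by apply: (psum_cvg _ zr); exact: radius_shift.
Qed.

Lemma PS_unshift d c r z : radius_ge c r -> cmod z < r ->
  PS (unshift d c) z = z ^+ d * PS c z.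
Proof.
move=> hc zr; elim: d => [|d IH].
  rewrite expr0 mul1r; congr PS; apply/funext => n.
  by rewrite /unshift ltn0 subn0.
rewrite (PS_recl (radius_unshift d.+1 hc) zr) /unshift /= add0r exprS -mulrA -IH.
by congr (_ * PS _ _); apply/funext => n; rewrite /unshift ltnS subSS.
Qed.

Lemma PS_theta c r z : radius_ge c r -> cmod z < r ->
  PS (fun n => n%:R * c n) z = z * PS (fun n => n.+1%:R * c n.+1) z.
Proof.
by move=> hc zr; rewrite (PS_recl (radius_natM hc) zr) mul0r add0r.
Qed.

(** Second order Taylor bound for the n-th power; the factor s ^+ 2 on the
left avoids a truncated exponent n - 2 on the right. *)
Lemma expr_taylor2 (z h : C) (s : R) n : cmod z <= s -> cmod (z + h) <= s ->
  s ^+ 2 * cmod ((z + h) ^+ n - z ^+ n - n%:R * z ^+ n.-1 * h)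
    <= n%:R ^+ 2 * s ^+ n * cmod h ^+ 2.
Proof.
move=> z1 z2; have s0 : 0 <= s by apply: le_trans z1; exact: cmod_ge0.
elim: n => [|n IH].
  by rewrite !expr0 mul0r mul0r subrr subr0 cmod0 mulr0 expr0n !mul0r.
have -> : (z + h) ^+ n.+1 - z ^+ n.+1 - n.+1%:R * z ^+ n.+1.-1 * h =
   n%:R * z ^+ n.-1 * h ^+ 2 +
   (z + h) * ((z + h) ^+ n - z ^+ n - n%:R * z ^+ n.-1 * h).
  rewrite !exprS -natr1 /=; case: n {IH} => [|n]; first by rewrite !expr0; ring.
  by rewrite !exprS /=; ring.
apply: le_trans (ler_wpM2l (exprn_ge0 2 s0) (cmodD _ _)) _.
have -> : n.+1%:R ^+ 2 * s ^+ n.+1 * cmod h ^+ 2 =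
  (n.+1%:R *+ 2 - 1) * s ^+ n.+1 * cmod h ^+ 2 + s * (n%:R ^+ 2 * s ^+ n * cmod h ^+ 2) :> R.
  by rewrite [s ^+ n.+1]exprS -natr1; ring.
rewrite mulrDr; apply: lerD; last first.
  rewrite cmodM mulrCA; apply: ler_pM => //; rewrite ?cmod_ge0//.
  by rewrite mulr_ge0 ?cmod_ge0// exprn_ge0.
rewrite [cmod (_ * h ^+ 2)]cmodM cmodX mulrA ler_wpM2r ?exprn_ge0 ?cmod_ge0//.
rewrite cmodM cmod_nat cmodX.
apply: (@le_trans _ _ (n%:R * s ^+ n.+1)); last first.
  rewrite ler_wpM2r ?exprn_ge0// -natr1.
  by have : 0 <= n%:R :> R by []; lra.
case: n {IH} => [|n] /=; first by rewrite !mul0r mulr0.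
rewrite mulrCA ler_wpM2l// -(addn2 n) exprD mulrC ler_wpM2r ?exprn_ge0//.
by rewrite lerXn2r ?nnegrE ?cmod_ge0.
Qed.

(** Summation of [expr_taylor2] over all terms bounds the error of the first
order expansion by a multiple of the square of |h|. *)
Lemma dC_PS c r z : radius_ge c r -> cmod z < r ->
  dC (PS c) z (PS (fun n => n.+1%:R * c n.+1) z).
Proof.
move=> hc zr; pose s := (cmod z + r) / 2.
have z0 := cmod_ge0 z.
have s0 : 0 < s by rewrite /s; lra.
have sr : s < r by rewrite /s; lra.
have zs : cmod z < s by rewrite /s; lra.
have hc2 := radius_natM (radius_natM hc).
have hc1 : radius_ge (fun n => n.+1%:R * c n.+1) r by exact: radius_shift (radius_natM hc).
have [|B [q [B0 q01 hB]]] := radius_geometric hc2 (x := s); first by rewrite sr ltW.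
pose K := B / (1 - q) / s ^+ 2.
have K0 : 0 <= K.
  by case/andP: q01 => _ q1; rewrite !divr_ge0 ?sqr_ge0// subr_ge0 ltW.
have main h : cmod h < s - cmod z ->
   cmod (PS c (z + h) - PS c z - PS (fun n => n.+1%:R * c n.+1) z * h) <= K * cmod h ^+ 2.
  move=> hh; have zhs : cmod (z + h) <= s by have := cmodD z h; lra.
  pose f n := psum c (z + h) n.+1 - psum c z n.+1 - psum (fun n => n.+1%:R * c n.+1) z n * h.
  have hf : f @ \oo --> PS c (z + h) - PS c z - PS (fun n => n.+1%:R * c n.+1) z * h.
    apply: cvgB; first apply: cvgB.
    - rewrite (cvg_shiftS (psum c (z + h))); apply: (psum_cvg hc); exact: le_lt_trans sr.
    - by rewrite (cvg_shiftS (psum c z)); apply: (psum_cvg hc).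
    by apply: cvgM; [exact: (psum_cvg hc1)|exact: cvg_cst].
  rewrite -[X in cmod X]subr0; apply: (cvg_cmod_le hf) => n; rewrite subr0.
  have -> : f n = \sum_(i < n.+1) c i * ((z + h) ^+ i - z ^+ i - i%:R * z ^+ i.-1 * h).
    rewrite /f /psum.
    have -> : \sum_(i < n) i.+1%:R * c i.+1 * z ^+ i =
       \sum_(i < n.+1) i%:R * c i * z ^+ i.-1.
      by rewrite big_ord_recl !mul0r add0r.
    rewrite mulr_suml -!sumrB; apply: eq_bigr => i _.
    by ring.
  apply: le_trans (cmod_sum _ _ _) _.
  have s20 : 0 < s ^+ 2 by rewrite exprn_gt0.
  rewrite /K mulrAC ler_pdivlMr// mulrC mulr_sumr.
  apply: (@le_trans _ _ (\sum_(i < n.+1) B * q ^+ i * cmod h ^+ 2)).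
    apply: ler_sum => i _; rewrite cmodM mulrCA.
    have := expr_taylor2 i (ltW zs) zhs => /(ler_wpM2l (cmod_ge0 (c i))) H.
    apply: le_trans H _; rewrite mulrA ler_wpM2r ?sqr_ge0//.
    by apply: le_trans (hB i); rewrite !cmodM cmod_nat; rewrite le_eqVlt; apply/orP; left; apply/eqP; ring.
  rewrite -mulr_suml ler_wpM2r ?sqr_ge0// -mulr_sumr ler_wpM2l//.
  exact: geo_sum.
apply/dC_epsP => e e0; exists (Num.min (s - cmod z) (e / (K + 1))).
  by rewrite lt_min subr_gt0 zs/= divr_gt0//; lra.
move=> h; rewrite lt_min => /andP[h1 h2]; apply: le_trans (main h h1) _.
rewrite expr2 mulrA ler_wpM2r ?cmod_ge0//.
have K1 : 0 < K + 1 by lra.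
move: h2; rewrite ltr_pdivlMr// => h2.
by apply: le_trans (ltW h2); rewrite mulrC mulrDr mulr1 lerDl cmod_ge0.
Qed.

Lemma PS_cont c r z : radius_ge c r -> cmod z < r -> {for z, continuous (PS c)}.
Proof. by move=> hc zr; apply: dC_cont (dC_PS hc zr). Qed.

Lemma dC_PS_cexp c r z : radius_ge c r -> cmod (cexp z) < r ->
  dC (fun w => PS c (cexp w)) z (PS (fun n => n%:R * c n) (cexp z)).
Proof.
move=> hc zr; rewrite (PS_theta hc zr) mulrC.
by apply: dC_comp (dC_cexp z) (dC_PS hc zr).
Qed.

Definition cauchy_prod (a b : nat -> C) (n : nat) : C := \sum_(i < n.+1) a i * b (n - i)%N.

Lemma psum_cauchy_prod a b z n :
  psum (cauchy_prod a b) z n = \sum_(i < n) a i * z ^+ i * psum b z (n - i)%N.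
Proof.
have psS c k : psum c z k.+1 = psum c z k + c k * z ^+ k by rewrite /psum big_ord_recr.
have ps0 c : psum c z 0 = 0 by rewrite /psum big_ord0.
elim: n => [|n IH]; first by rewrite ps0 big_ord0.
rewrite psS IH [RHS]big_ord_recr /= subSnn psS ps0 add0r expr0 mulr1.
rewrite /cauchy_prod big_ord_recr /= subnn mulrDl addrA; congr (_ + _); last by ring.
rewrite mulr_suml -big_split /=; apply: eq_bigr => i _.
rewrite subSn 1?ltnW// psS mulrDr; congr (_ + _).
have -> : z ^+ n = z ^+ i * z ^+ (n - i).
  by rewrite -exprD subnKC// ltnW.
by ring.
Qed.

(** The product of the partial sums and the partial sum of the product differ
by at most n ^ 2 terms, each bounded by a multiple of t ^+ n with t < 1. *)
Lemma PS_mul_cvg a b r z : radius_ge a r -> radius_ge b r -> cmod z < r ->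
  psum (cauchy_prod a b) z @ \oo --> PS a z * PS b z.
Proof.
move=> ha hb zr; have z0 := cmod_ge0 z.
have hz : 0 <= cmod z < r by rewrite z0.
have [A [p [A0 p01 hA]]] := radius_geometric ha hz.
have [B [q [B0 q01 hB]]] := radius_geometric hb hz.
pose t := Num.max p q.
have t01 : 0 <= t < 1 by rewrite le_max gt_max; case/andP: p01 => -> ->; case/andP: q01 => _ ->.
have [t0 t1] := andP t01.
have hA' n : cmod (a n) * cmod z ^+ n <= A * t ^+ n.
  apply: le_trans (hA n) _; rewrite ler_wpM2l//.
  have [p0 _] := andP p01.
  by rewrite lerXn2r ?nnegrE// /t le_max lexx.
have hB' n : cmod (b n) * cmod z ^+ n <= B * t ^+ n.
  apply: le_trans (hB n) _; rewrite ler_wpM2l//.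
  have [q0 _] := andP q01.
  by rewrite lerXn2r ?nnegrE// /t le_max lexx orbT.
have hprod : (fun n => psum a z n * psum b z n) @ \oo --> PS a z * PS b z.
  by apply: cvgM; [exact: (psum_cvg ha)|exact: (psum_cvg hb)].
have diff n : cmod (psum (cauchy_prod a b) z n - psum a z n * psum b z n) <=
    A * B * (n%:R ^+ 2 * t ^+ n).
  rewrite psum_cauchy_prod {1}/psum mulr_suml -sumrB; apply: le_trans (cmod_sum _ _ _) _.
  have -> : A * B * (n%:R ^+ 2 * t ^+ n) = \sum_(i < n) A * B * (n%:R * t ^+ n).
    by rewrite sumr_const card_ord -mulr_natl; ring.
  apply: ler_sum => i _; rewrite -mulrBr cmodM.
  have -> : A * B * (n%:R * t ^+ n) = (A * t ^+ i) * (n%:R * (B * t ^+ (n - i))).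
    have -> : t ^+ n = t ^+ i * t ^+ (n - i) by rewrite -exprD subnKC// ltnW.
    by ring.
  apply: ler_pM; rewrite ?cmod_ge0//; first by rewrite cmodM cmodX.
  rewrite cmod_distC.
  have -> : psum b z n - psum b z (n - i)%N = \sum_((n - i)%N <= j < n) b j * z ^+ j.
    rewrite /psum -!(big_mkord predT (fun j => b j * z ^+ j)).
    by rewrite (@big_cat_nat _ _ _ (n - i)%N) ?leq_subr//= addrAC subrr add0r.
  apply: le_trans (cmod_sum _ _ _) _.
  apply: (@le_trans _ _ (\sum_((n - i)%N <= j < n) B * t ^+ (n - i))).
    rewrite big_nat_cond [leRHS]big_nat_cond; apply: ler_sum => j.
    rewrite andbT => /andP[h1 h2]; rewrite cmodM cmodX.
    by apply: le_trans (hB' j) _; rewrite ler_wpM2l// ler_wiXn2l// ltW.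
  rewrite sumr_const_nat subKn 1?ltnW// -[leLHS]mulr_natl ler_wpM2r//.
    by rewrite mulr_ge0// exprn_ge0.
  by rewrite ler_nat ltnW.
have rad1 : radius_ge (fun n => n%:R * (n%:R * 1)) 1.
  apply: radius_natM; apply: radius_natM => s /andP[s0 s1]; exists 1 => n.
  by rewrite cmod1 mul1r exprn_ile1// ltW.
have [D [u [D0 u01 hD]]] := radius_geometric rad1 t01.
have diff2 n : cmod (psum (cauchy_prod a b) z n - psum a z n * psum b z n) <= A * B * D * u ^+ n.
  apply: le_trans (diff n) _; rewrite -[leRHS]mulrA ler_wpM2l ?mulr_ge0//.
  by apply: le_trans (hD n); rewrite !cmodM cmod_nat cmod1 mulr1 expr2.
apply/cvgCP => e e0; have e20 : 0 < e / 2 by rewrite divr_gt0.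
have [N hN] := geo_lim0 (A * B * D) u01 e20.
have [M _ hM] := (cvgCP _ _).1 hprod _ e20.
exists (maxn N M) => // n /=; rewrite geq_max => /andP[hn1 hn2].
have := hM n hn2 => /= hn3.
apply: le_lt_trans (cmod_triangle _ (psum a z n * psum b z n) _) _.
have := diff2 n; have := hN n hn1; lra.
Qed.

Lemma PS_mul a b r z : radius_ge a r -> radius_ge b r -> cmod z < r ->
  PS (cauchy_prod a b) z = PS a z * PS b z.
Proof. by move=> ha hb zr; apply: PS_lim; exact: PS_mul_cvg ha hb zr. Qed.

(** The constant coefficient is the value at 0, a limit of zeros; then the
series is divided by z and the argument repeated. *)
Lemma PS_eq0 c r s : radius_ge c r -> 0 < r -> 0 < s ->
  (forall z, 0 < cmod z < s -> PS c z = 0) -> forall n, c n = 0.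
Proof.
move=> hc r0 s0 H0.
pose m := Num.min s r.
have m0 : 0 < m by rewrite lt_min s0.
have base (d : nat -> C) : radius_ge d r -> (forall z, 0 < cmod z < m -> PS d z = 0) -> d 0%N = 0.
  move=> hd Hd; apply/eqP; rewrite -cmod_eq0 eq_le cmod_ge0 andbT.
  apply/ler_addgt0Pr => e e0; rewrite add0r.
  have zr : cmod (0 : C) < r by rewrite cmod0.
  have [x x0 hx] := (contCP _ _).1 (PS_cont hd zr) _ e0.
  pose y := Num.min (x / 2) (m / 2).
  have y0 : 0 < y by rewrite lt_min !divr_gt0.
  have yx : y < x by rewrite gt_min; apply/orP; left; lra.
  have ys : y < m by rewrite gt_min; apply/orP; right; lra.
  have := hx (ofR y); rewrite subr0 cmod_ofR gtr0_norm// => /(_ yx).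
  by rewrite Hd ?cmod_ofR ?gtr0_norm ?y0// PS0 sub0r cmodN => /ltW.
have step n : radius_ge (fun k => c (k + n)%N) r /\
   forall z, 0 < cmod z < m -> PS (fun k => c (k + n)%N) z = 0.
  elim: n => [|n [hd Hd]].
    have -> : (fun k => c (k + 0)%N) = c by apply/funext => k; rewrite addn0.
    by split => // z; rewrite lt_min => /and3P[z0 zs _]; apply: H0; rewrite z0.
  have E : (fun k => c (k + n.+1)%N) = (fun k => c (k.+1 + n)%N).
    by apply/funext => k; rewrite addnS addSn.
  rewrite E; split; first exact: (radius_shift hd).
  move=> z hz; have := hz; rewrite lt_min => /and3P[z0 _ zr].
  have := PS_recl hd zr; rewrite (Hd z hz) (base _ hd Hd) add0r => /esym/eqP.
  by rewrite mulf_eq0 -cmod_eq0 gt_eqF//= => /eqP.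
by move=> n; have [hd Hd] := step n; exact: (base _ hd Hd).
Qed.

Lemma PS_inj c d r s : radius_ge c r -> radius_ge d r -> 0 < r -> 0 < s -> s <= r ->
  (forall z, 0 < cmod z < s -> PS c z = PS d z) -> forall n, c n = d n.
Proof.
move=> hc hd r0 s0 sr H n.
have hd' : radius_ge (fun n => -1 * d n) r by exact: radius_scale.
apply/eqP; rewrite -subr_eq0; apply/eqP.
have -> : c n - d n = c n + -1 * d n by rewrite mulN1r.
apply: (PS_eq0 (c := fun n => c n + -1 * d n) (r := r) (s := s)) => //.
  exact: radius_add.
move=> z /andP[z0 zs]; have zr := lt_le_trans zs sr.
rewrite (PS_add hc hd' zr) (PS_scale (-1) hd zr) H ?z0//.
by rewrite mulN1r subrr.
Qed.

End PowerSeries.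

(** * Complex integrals over a real segment *)

Section ContinuityRules.
Variable R : realType.
Local Notation C := (Cplx R).

Lemma contC_comp (f g : C -> C) z : {for z, continuous g} ->
  {for g z, continuous f} -> {for z, continuous (fun w => f (g w))}.
Proof.
move=> /contCP hg /contCP hf; apply/contCP => e /hf[d d0 hd].
by have [s s0 hs] := hg d d0; exists s => // w /hs /hd.
Qed.

Lemma contCM (f g : C -> C) z : {for z, continuous f} ->
  {for z, continuous g} -> {for z, continuous (fun w => f w * g w)}.
Proof. by move=> hf hg; exact: (cvgM hf hg). Qed.

Lemma contCB (f g : C -> C) z : {for z, continuous f} ->
  {for z, continuous g} -> {for z, continuous (fun w => f w - g w)}.
Proof. by move=> hf hg; exact: (cvgB hf hg). Qed.

Lemma contC_cst (a z : C) : {for z, continuous (fun _ : C => a)}.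
Proof. by apply/contCP => e e0; exists 1 => // w _; rewrite subrr cmod0. Qed.

End ContinuityRules.

Section SegmentIntegral.
Variable R : realType.
Local Notation C := (Cplx R).
Local Notation mu := (@lebesgue_measure R).

Definition cont_on (g : R -> R) (s t : R) : Prop :=
  forall u : R, s <= u <= t -> {for u, continuous g}.

Definition rint (g : R -> R) (s t : R) : R := \int[mu]_(u in `[s, t]) g u.

Lemma cont_on_integrable g s t : cont_on g s t ->
  mu.-integrable `[s, t] (EFin \o g).
Proof.
move=> H; apply: continuous_compact_integrable; first exact: segment_compact.
by apply: continuous_in_subspaceT => u; rewrite inE /= in_itv /=; exact: H.
Qed.

Lemma rintD g k s t : cont_on g s t -> cont_on k s t ->
  rint (fun u => g u + k u) s t = rint g s t + rint k s t.
Proof.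
by move=> hg hk; apply: RintegralD => //; exact: cont_on_integrable.
Qed.

Lemma rintZ g a s t : cont_on g s t -> rint (fun u => a * g u) s t = a * rint g s t.
Proof. by move=> hg; apply: RintegralZl => //; exact: cont_on_integrable. Qed.

Lemma rint_eq g k s t : (forall u, s <= u <= t -> g u = k u) -> rint g s t = rint k s t.
Proof.
by move=> H; apply: eq_Rintegral => u; rewrite inE /= in_itv /=; exact: H.
Qed.

Lemma rint_bound g s t (M : R) : s <= t -> cont_on g s t ->
  (forall u, s <= u <= t -> `|g u| <= M) -> `|rint g s t| <= M * (t - s).
Proof.
move=> st hg hM; have ig := cont_on_integrable hg.
apply: le_trans (le_normr_Rintegral _ ig) _ => //.
have -> : M * (t - s) = \int[mu]_(u in `[s, t]) M.
  rewrite Rintegral_cst//= lebesgue_measure_itv /= lte_fin.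
  by move: st; rewrite le_eqVlt => /orP[/eqP <-|->]; rewrite ?ltxx ?subrr ?mulr0.
have ic : mu.-integrable `[s, t] (EFin \o (fun=> M)).
  by apply: cont_on_integrable => u _; exact: cvg_cst.
by apply: (le_Rintegral _ (integrable_norm ig) ic) => // u; rewrite /= in_itv /=; exact: hM.
Qed.

Lemma rint_chasles g s m t : s <= m <= t -> cont_on g s t ->
  rint g s t = rint g s m + rint g m t.
Proof.
move=> /andP[sm mt] hg; have ig := cont_on_integrable hg.
apply/eqP; rewrite -subr_eq0 opprD addrA subr_eq0; apply/eqP.
rewrite /rint (Rintegral_itvB ig) ?bnd_simp//.
apply: Rintegral_itv_obnd_cbnd.
apply: integrableS ig => // u /=; rewrite !in_itv /= => /andP[h1 h2].
by rewrite h2 (le_trans sm)// ltW.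
Qed.

Lemma rint_FTC g G s t : s <= t -> cont_on g s t ->
  (forall u : R, s <= u <= t -> is_derive u 1 G (g u)) ->
  rint g s t = G t - G s.
Proof.
rewrite le_eqVlt => /orP[/eqP <- _ _|st hg hG].
  by rewrite subrr /rint set_itv1 Rintegral_set1.
have cG u : s <= u <= t -> {for u, continuous G}.
  move=> hu; have [dG _] := hG u hu.
  by apply: differentiable_continuous; apply/derivable1_diffP.
have -> : G t - G s = fine ((G t)%:E - (G s)%:E)%E by [].
congr fine; apply: continuous_FTC2 => //.
- by apply: continuous_in_subspaceT => u; rewrite inE /= in_itv /=; exact: hg.
- split.
  + move=> u; rewrite in_itv /= => /andP[h1 h2].
    by have [] := hG u; rewrite ?ltW.
  + by apply: cvg_at_right_filter; apply: cG; rewrite lexx ltW.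
  + by apply: cvg_at_left_filter; apply: cG; rewrite lexx ltW.
move=> u; rewrite in_itv /= => /andP[h1 h2]; rewrite derive1E.
by have [] := hG u; rewrite ?ltW.
Qed.

Definition ccont (f : C -> C) (s t : R) : Prop :=
  forall u : R, s <= u <= t -> {for ofR u, continuous f}.

(** The integrand is a function on C, although only its values on the real axis
matter, so that complex continuity and derivatives apply to it. *)
Definition cint (f : C -> C) (s t : R) : C :=
  ofR (rint (fun u => Rep (f (ofR u))) s t) + ic * ofR (rint (fun u => Imp (f (ofR u))) s t).

Lemma Re_cont (f : C -> C) (u : R) : {for ofR u, continuous f} ->
  {for u, continuous (fun v : R => Rep (f (ofR v)))}.
Proof.
move=> /contCP H; apply/cvgrPdist_lt => e e0; have [d d0 hd] := H e e0.
apply/nbhs_ballP; exists d => //= v; rewrite /ball /= => vd.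
rewrite -RepB; apply: le_lt_trans (Rep_le _) _; rewrite cmod_distC; apply: hd.
by rewrite -ofRB cmod_ofR distrC.
Qed.

Lemma Im_cont (f : C -> C) (u : R) : {for ofR u, continuous f} ->
  {for u, continuous (fun v : R => Imp (f (ofR v)))}.
Proof.
move=> hf; have -> : (fun v : R => Imp (f (ofR v))) = (fun v => Rep (- ic * f (ofR v))).
  by apply/funext => v; exact: ImpE.
by apply: (@Re_cont (fun w => - ic * f w)); apply: contCM; [exact: contC_cst|exact: hf].
Qed.

Lemma ccont_Re f s t : ccont f s t -> cont_on (fun u => Rep (f (ofR u))) s t.
Proof. by move=> H u /H; exact: Re_cont. Qed.
Lemma ccont_Im f s t : ccont f s t -> cont_on (fun u => Imp (f (ofR u))) s t.
Proof. by move=> H u /H; exact: Im_cont. Qed.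

Lemma cint_eq f g s t : (forall u : R, s <= u <= t -> f (ofR u) = g (ofR u)) ->
  cint f s t = cint g s t.
Proof.
by move=> H; congr (ofR _ + _ * ofR _); apply: rint_eq => u /H ->.
Qed.

Lemma cintD f g s t : ccont f s t -> ccont g s t ->
  cint (fun u => f u + g u) s t = cint f s t + cint g s t.
Proof.
move=> hf hg; rewrite /cint.
rewrite -[X in _ = X]addrACA -mulrDr -!ofRD; congr (ofR _ + _ * ofR _).
  rewrite -rintD; [|exact: ccont_Re..].
  by apply: rint_eq => u _; rewrite RepD.
rewrite -rintD; [|exact: ccont_Im..].
by apply: rint_eq => u _; rewrite ImpD.
Qed.

Lemma cintZ f (a : C) s t : ccont f s t ->
  cint (fun u => a * f u) s t = a * cint f s t.
Proof.
move=> hf; have hR := ccont_Re hf; have hI := ccont_Im hf.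
have E1 : rint (fun u => Rep (a * f (ofR u))) s t =
    Rep a * rint (fun u => Rep (f (ofR u))) s t + - Imp a * rint (fun u => Imp (f (ofR u))) s t.
  rewrite -!rintZ// -rintD.
  - by apply: rint_eq => u _; rewrite RepM mulNr.
  - by move=> u /hR H; apply: cvgM H; exact: cvg_cst.
  - by move=> u /hI H; apply: cvgM H; exact: cvg_cst.
have E2 : rint (fun u => Imp (a * f (ofR u))) s t =
    Rep a * rint (fun u => Imp (f (ofR u))) s t + Imp a * rint (fun u => Rep (f (ofR u))) s t.
  rewrite -!rintZ// -rintD.
  - by apply: rint_eq => u _; rewrite ImpM.
  - by move=> u /hI H; apply: cvgM H; exact: cvg_cst.
  - by move=> u /hR H; apply: cvgM H; exact: cvg_cst.
rewrite /cint E1 E2 [X in _ = X * _](cplxE a) !ofRD !ofRM ofRN.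
by have := icic R; move: (ic) => i Hi; ring: Hi.
Qed.

Lemma cint_bound f s t (M : R) : s <= t -> ccont f s t ->
  (forall u : R, s <= u <= t -> cmod (f (ofR u)) <= M) ->
  cmod (cint f s t) <= 2 * (M * (t - s)).
Proof.
move=> st hf hM; apply: le_trans (cmod_le _) _; rewrite Rep_cs Imp_cs.
rewrite mulr_natl mulr2n; apply: lerD; apply: rint_bound => //.
- exact: ccont_Re.
- by move=> u /hM; apply: le_trans; exact: Rep_le.
- exact: ccont_Im.
- by move=> u /hM; apply: le_trans; exact: Imp_le.
Qed.

Lemma cint_chasles f s m t : s <= m <= t -> ccont f s t ->
  cint f s t = cint f s m + cint f m t.
Proof.
move=> smt hf; rewrite /cint (rint_chasles smt (ccont_Re hf)) (rint_chasles smt (ccont_Im hf)).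
by rewrite !ofRD mulrDr addrACA.
Qed.

Lemma cint_FTC f F s t : s <= t -> ccont f s t ->
  (forall u : R, s <= u <= t -> dC F (ofR u) (f (ofR u))) ->
  cint f s t = F (ofR t) - F (ofR s).
Proof.
move=> st hf hF.
have E1 : rint (fun u => Rep (f (ofR u))) s t = Rep (F (ofR t)) - Rep (F (ofR s)).
  apply: (@rint_FTC _ (fun u => Rep (F (ofR u)))) => //; first exact: ccont_Re.
  by move=> u /hF; exact: dC_Re.
have E2 : rint (fun u => Imp (f (ofR u))) s t = Imp (F (ofR t)) - Imp (F (ofR s)).
  apply: (@rint_FTC _ (fun u => Imp (F (ofR u)))) => //; first exact: ccont_Im.
  by move=> u /hF; exact: dC_Im.
by rewrite /cint E1 E2 -RepB -ImpB -cplxE.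
Qed.

End SegmentIntegral.

(** * Goursat's theorem on a parametrized rectangle *)

Section Bisection.
Variable R : realType.
Local Notation C := (Cplx R).

Lemma nested_point (a b : nat -> R) : (forall m n, a m <= b n) ->
  exists x, forall n, a n <= x <= b n.
Proof.
move=> H; exists (sup (range a)) => n.
have hs : has_sup (range a).
  split; first by exists (a 0%N), 0%N.
  by exists (b 0%N) => _ [m _ <-].
rewrite sup_upper_bound//=; last by exists n.
by apply: ge_sup; [exists (a 0%N), 0%N|move=> _ [m _ <-]].
Qed.

Lemma dyadic_small (P e : R) : 0 < e -> exists n, P / 2 ^+ n < e.
Proof.
move=> e0; have h : 0 <= (1 / 2 : R) < 1 by lra.
have [N hN] := geo_lim0 P h e0; exists N.
by have := hN N (leqnn N); rewrite expr_div_n expr1n mul1r.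
Qed.

(** One of the four quarters of a rectangle carries at least a quarter of the
value m.  Iteration gives nested rectangles that shrink to a point (x, y); the
n-th one carries at least 4 ^- n times |m|, and the estimate at (x, y) bounds
this by e times 4 ^- n times a constant. *)
Lemma bisection (m : R -> R -> R -> R -> C) (x0 x1 y0 y1 : R) :
  x0 <= x1 -> y0 <= y1 ->
  (forall a b c d e, x0 <= a -> a <= b -> b <= c -> c <= x1 ->
     y0 <= d -> d <= e -> e <= y1 -> m a c d e = m a b d e + m b c d e) ->
  (forall a b c d e, x0 <= a -> a <= b -> b <= x1 ->
     y0 <= c -> c <= d -> d <= e -> e <= y1 -> m a b c e = m a b c d + m a b d e) ->
  (forall x y, x0 <= x <= x1 -> y0 <= y <= y1 -> forall e : R, 0 < e ->
     exists2 r : R, 0 < r & forall a b c d, x0 <= a -> a <= x <= b -> b <= x1 ->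
       y0 <= c -> c <= y <= d -> d <= y1 -> b - a < r -> d - c < r ->
       cmod (m a b c d) <= e * ((b - a) + (d - c)) ^+ 2) ->
  m x0 x1 y0 y1 = 0.
Proof.
move=> hx hy splitx splity loc.
pose P := x1 - x0; pose Q := y1 - y0.
have P0 : 0 <= P by rewrite subr_ge0.
have Q0 : 0 <= Q by rewrite subr_ge0.
pose p n : R := P / 2 ^+ n; pose q n : R := Q / 2 ^+ n.
have two n : 0 < 2 ^+ n :> R by rewrite exprn_gt0.
have pS n : p n = p n.+1 + p n.+1 by rewrite /p exprS; field; rewrite gt_eqF.
have qS n : q n = q n.+1 + q n.+1 by rewrite /q exprS; field; rewrite gt_eqF.
have p0 n : 0 <= p n by rewrite divr_ge0// ltW.
have q0 n : 0 <= q n by rewrite divr_ge0// ltW.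
have half (u v : C) : ~~ (cmod (u + v) <= 2 * cmod u) -> cmod (u + v) <= 2 * cmod v.
  by rewrite -ltNge => h; have := cmodD u v; lra.
pose good n (w : R * R) := [/\ x0 <= w.1, w.1 + p n <= x1, y0 <= w.2 & w.2 + q n <= y1].
pose M n (w : R * R) := cmod (m w.1 (w.1 + p n) w.2 (w.2 + q n)).
have step n w : good n w -> exists w', good n.+1 w' /\ [/\
    w.1 <= w'.1, w'.1 + p n.+1 <= w.1 + p n, w.2 <= w'.2,
    w'.2 + q n.+1 <= w.2 + q n & M n w <= 4 * M n.+1 w'].
  case: w => a c [/= g1 g2 g3 g4]; have := p0 n.+1; have := q0 n.+1.
  have := pS n; have := qS n => Eq Ep hq hp.
  have [a' [A1 A2 A3]] : exists a', [/\ a <= a', a' + p n.+1 <= a + p n &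
      cmod (m a (a + p n) c (c + q n)) <= 2 * cmod (m a' (a' + p n.+1) c (c + q n))].
    have E := splitx a (a + p n.+1) (a + p n) c (c + q n).
    rewrite E ?lerDl ?p0 ?q0//; last by rewrite lerD2l Ep lerDl.
    have [h|/half h] := boolP (cmod (m a (a + p n.+1) c (c + q n) +
      m (a + p n.+1) (a + p n) c (c + q n)) <= 2 * cmod (m a (a + p n.+1) c (c + q n))).
      by exists a; split => //; lra.
    exists (a + p n.+1); have -> : a + p n.+1 + p n.+1 = a + p n by lra.
    by split => //; lra.
  have [c' [C1 C2 C3]] : exists c', [/\ c <= c', c' + q n.+1 <= c + q n &
      cmod (m a' (a' + p n.+1) c (c + q n)) <= 2 * cmod (m a' (a' + p n.+1) c' (c' + q n.+1))].
    have E := splity a' (a' + p n.+1) c (c + q n.+1) (c + q n).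
    rewrite E ?lerDl ?p0 ?q0//; first last.
    - by rewrite lerD2l Eq lerDl.
    - exact: le_trans A2 g2.
    - exact: le_trans g1 A1.
    have [h|/half h] := boolP (cmod (m a' (a' + p n.+1) c (c + q n.+1) +
      m a' (a' + p n.+1) (c + q n.+1) (c + q n)) <= 2 * cmod (m a' (a' + p n.+1) c (c + q n.+1))).
      by exists c; split => //; lra.
    exists (c + q n.+1); have -> : c + q n.+1 + q n.+1 = c + q n by lra.
    by split => //; lra.
  exists (a', c'); rewrite /M /good /=; split; first by split; lra.
  by split => //; lra.
have [w [w0 hw]] : exists w : nat -> R * R, w 0%N = (x0, y0) /\
    forall n, good n (w n) -> good n.+1 (w n.+1) /\ [/\
    (w n).1 <= (w n.+1).1, (w n.+1).1 + p n.+1 <= (w n).1 + p n, (w n).2 <= (w n.+1).2,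
    (w n.+1).2 + q n.+1 <= (w n).2 + q n & M n (w n) <= 4 * M n.+1 (w n.+1)].
  have step' n w : exists w', good n w -> good n.+1 w' /\ [/\
    w.1 <= w'.1, w'.1 + p n.+1 <= w.1 + p n, w.2 <= w'.2,
    w'.2 + q n.+1 <= w.2 + q n & M n w <= 4 * M n.+1 w'].
    have [/step [w' h]|h] := pselect (good n w); first by exists w'.
    by exists w.
  pose F := fix F n := if n is k.+1 then projT1 (cid (step' k (F k))) else (x0, y0).
  exists F; split => // n hn; exact: (projT2 (cid (step' n (F n))) hn).
have gw n : good n (w n).
  elim: n => [|n /hw [] //]; rewrite w0 /good /p /q /P /Q /= expr0 !divr1.
  by split; lra.
have mono1 i k : (w i).1 <= (w (i + k)%N).1.
  elim: k => [|k]; first by rewrite addn0.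
  by rewrite addnS => /le_trans; apply; have [_ []] := hw _ (gw (i + k)%N).
have mono2 i k : (w i).2 <= (w (i + k)%N).2.
  elim: k => [|k]; first by rewrite addn0.
  by rewrite addnS => /le_trans; apply; have [_ []] := hw _ (gw (i + k)%N).
have mono3 i k : (w (i + k)%N).1 + p (i + k)%N <= (w i).1 + p i.
  elim: k => [|k]; first by rewrite addn0.
  by rewrite addnS; apply: le_trans; have [_ []] := hw _ (gw (i + k)%N).
have mono4 i k : (w (i + k)%N).2 + q (i + k)%N <= (w i).2 + q i.
  elim: k => [|k]; first by rewrite addn0.
  by rewrite addnS; apply: le_trans; have [_ []] := hw _ (gw (i + k)%N).
have [|x hx'] := @nested_point (fun n => (w n).1) (fun n => (w n).1 + p n).
  move=> i n; apply: le_trans (mono1 i n) _; rewrite addnC.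
  by have := mono3 n i; have := p0 (n + i)%N; lra.
have [|y hy'] := @nested_point (fun n => (w n).2) (fun n => (w n).2 + q n).
  move=> i n; apply: le_trans (mono2 i n) _; rewrite addnC.
  by have := mono4 n i; have := q0 (n + i)%N; lra.
have MM n : M 0%N (w 0%N) <= 4 ^+ n * M n (w n).
  elim: n => [|n IH]; first by rewrite expr0 mul1r.
  have [_ [_ _ _ _ h]] := hw _ (gw n); apply: le_trans IH _.
  by rewrite exprSr -mulrA ler_wpM2l// exprn_ge0.
apply/eqP; rewrite -cmod_eq0 eq_le cmod_ge0 andbT.
apply/ler_addgt0Pr => e e0; rewrite add0r.
have -> : cmod (m x0 x1 y0 y1) = M 0%N (w 0%N).
  by rewrite /M w0 /= /p /q expr0 !divr1 /P /Q !subrKC.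
pose K := (P + Q) ^+ 2 + 1; have K0 : 0 < K by rewrite /K; have := sqr_ge0 (P + Q); lra.
have ek0 : 0 < e / K by rewrite divr_gt0.
have hx0 : x0 <= x <= x1.
  by have := hx' 0%N; rewrite w0 /= /p expr0 divr1 /P subrKC.
have hy0 : y0 <= y <= y1.
  by have := hy' 0%N; rewrite w0 /= /q expr0 divr1 /Q subrKC.
have [r r0 hr] := loc x y hx0 hy0 _ ek0.
have [n hn] := dyadic_small (P + Q) r0.
have [g1 g2 g3 g4] := gw n.
have pq : p n + q n < r by rewrite /p /q -mulrDl.
have := hr _ _ _ _ g1 (hx' n) g2 g3 (hy' n) g4.
rewrite ![_ + _ - _]addrAC !subrr !add0r -/(M n (w n)) => H.
have {}H : M n (w n) <= e / K * (p n + q n) ^+ 2.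
  by apply: H; have := p0 n; have := q0 n; lra.
apply: le_trans (MM n) _.
apply: (@le_trans _ _ (4 ^+ n * (e / K * (p n + q n) ^+ 2))).
  by rewrite ler_wpM2l// exprn_ge0.
have -> : 4 ^+ n * (e / K * (p n + q n) ^+ 2) = e * ((P + Q) ^+ 2 / K).
  have -> : (4 : R) ^+ n = 2 ^+ n * 2 ^+ n by rewrite -exprMn; congr (_ ^+ _); ring.
  by rewrite /p /q; field; rewrite !gt_eqF.
by rewrite ler_piMr ?(ltW e0)// ler_pdivrMr// mul1r /K; lra.
Qed.

End Bisection.

Section GoursatSquare.
Variable R : realType.
Local Notation C := (Cplx R).
Variables (W W1 W2 : C -> C -> C) (x0 x1 y0 y1 L : R).
Hypothesis L0 : 0 <= L.
Hypothesis hW1 : forall x y : R, x0 <= x <= x1 -> y0 <= y <= y1 ->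
  dC (W^~ (ofR y)) (ofR x) (W1 (ofR x) (ofR y)).
Hypothesis hW2 : forall x y : R, x0 <= x <= x1 -> y0 <= y <= y1 ->
  dC (W (ofR x)) (ofR y) (W2 (ofR x) (ofR y)).
Hypothesis cW1 : forall x y : R, x0 <= x <= x1 -> y0 <= y <= y1 ->
  {for ofR x, continuous (W1^~ (ofR y))}.
Hypothesis cW2 : forall x y : R, x0 <= x <= x1 -> y0 <= y <= y1 ->
  {for ofR y, continuous (W2 (ofR x))}.
Hypothesis bW1 : forall x y : R, x0 <= x <= x1 -> y0 <= y <= y1 ->
  cmod (W1 (ofR x) (ofR y)) <= L.
Hypothesis bW2 : forall x y : R, x0 <= x <= x1 -> y0 <= y <= y1 ->
  cmod (W2 (ofR x) (ofR y)) <= L.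

Definition xside (G : C -> C) (a b c : R) : C :=
  cint (fun u => G (W u (ofR c)) * W1 u (ofR c)) a b.
Definition yside (G : C -> C) (c d b : R) : C :=
  cint (fun u => G (W (ofR b) u) * W2 (ofR b) u) c d.
(** The integral of G(w) dw along the image under W of the boundary of the
rectangle [a, b] x [c, d]. *)
Definition circulation (G : C -> C) (a b c d : R) : C :=
  xside G a b c + yside G c d b - xside G a b d - yside G c d a.

Definition cont_image (G : C -> C) := forall x y : R, x0 <= x <= x1 ->
  y0 <= y <= y1 -> {for W (ofR x) (ofR y), continuous G}.

Lemma xside_cont G a b c : cont_image G -> x0 <= a -> b <= x1 -> y0 <= c <= y1 ->
  ccont (fun u => G (W u (ofR c)) * W1 u (ofR c)) a b.
Proof.
move=> hG xa bx yc u /andP[au ub].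
have ux : x0 <= u <= x1 by rewrite (le_trans xa au) (le_trans ub bx).
apply: contCM; last exact: cW1.
by apply: (@contC_comp R G (W^~ (ofR c))); [exact: dC_cont (hW1 ux yc)|exact: hG].
Qed.

Lemma yside_cont G c d b : cont_image G -> y0 <= c -> d <= y1 -> x0 <= b <= x1 ->
  ccont (fun u => G (W (ofR b) u) * W2 (ofR b) u) c d.
Proof.
move=> hG yc dy xb u /andP[cu ud].
have uy : y0 <= u <= y1 by rewrite (le_trans yc cu) (le_trans ud dy).
apply: contCM; last exact: cW2.
by apply: (@contC_comp R G (W (ofR b))); [exact: dC_cont (hW2 xb uy)|exact: hG].
Qed.

Lemma rect_sub a b c d : x0 <= a -> a <= b -> b <= x1 -> y0 <= c -> c <= d ->
  d <= y1 -> [/\ x0 <= a <= x1, x0 <= b <= x1, y0 <= c <= y1 & y0 <= d <= y1].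
Proof.
move=> h1 h2 h3 h4 h5 h6.
by rewrite h1 h3 h4 h6 (le_trans h2 h3) (le_trans h1 h2) (le_trans h5 h6) (le_trans h4 h5).
Qed.

Lemma circulationD G H a b c d : cont_image G -> cont_image H ->
  x0 <= a -> a <= b -> b <= x1 -> y0 <= c -> c <= d -> d <= y1 ->
  circulation (fun w => G w + H w) a b c d = circulation G a b c d + circulation H a b c d.
Proof.
move=> hG hH h1 h2 h3 h4 h5 h6; have [ha hb hc hd] := rect_sub h1 h2 h3 h4 h5 h6.
have EX y : y0 <= y <= y1 -> xside (fun w => G w + H w) a b y = xside G a b y + xside H a b y.
  move=> hy; rewrite /xside -cintD; [|exact: xside_cont..].
  by apply: cint_eq => u _; rewrite mulrDl.
have EY x : x0 <= x <= x1 -> yside (fun w => G w + H w) c d x = yside G c d x + yside H c d x.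
  move=> hx; rewrite /yside -cintD; [|exact: yside_cont..].
  by apply: cint_eq => u _; rewrite mulrDl.
have E (p p' q q' s s' t t' : C) : p + p' + (q + q') - (s + s') - (t + t') =
    (p + q - s - t) + (p' + q' - s' - t') by ring.
by rewrite /circulation !EX// !EY//; exact: E.
Qed.

Lemma circulation_exact (G P : C -> C) a b c d : cont_image G ->
  (forall w, dC P w (G w)) ->
  x0 <= a -> a <= b -> b <= x1 -> y0 <= c -> c <= d -> d <= y1 ->
  circulation G a b c d = 0.
Proof.
move=> hG hP h1 h2 h3 h4 h5 h6; have [ha hb hc hd] := rect_sub h1 h2 h3 h4 h5 h6.
have EX y : y0 <= y <= y1 -> xside G a b y = P (W (ofR b) (ofR y)) - P (W (ofR a) (ofR y)).
  move=> hy; rewrite /xside (@cint_FTC _ _ (fun u => P (W u (ofR y)))) //.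
    exact: xside_cont.
  move=> u /andP[au ub]; apply: (@dC_comp _ P (W^~ (ofR y))); last exact: hP.
  by apply: hW1; rewrite // (le_trans h1 au) (le_trans ub h3).
have EY x : x0 <= x <= x1 -> yside G c d x = P (W (ofR x) (ofR d)) - P (W (ofR x) (ofR c)).
  move=> hx; rewrite /yside (@cint_FTC _ _ (fun u => P (W (ofR x) u))) //.
    exact: yside_cont.
  move=> u /andP[cu ud]; apply: (@dC_comp _ P (W (ofR x))); last exact: hP.
  by apply: hW2; rewrite // (le_trans h4 cu) (le_trans ud h6).
by rewrite /circulation !EX// !EY//; ring.
Qed.

Lemma circulation_bound G a b c d (M : R) : cont_image G -> 0 <= M ->
  x0 <= a -> a <= b -> b <= x1 -> y0 <= c -> c <= d -> d <= y1 ->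
  (forall x y : R, a <= x <= b -> c <= y <= d -> cmod (G (W (ofR x) (ofR y))) <= M) ->
  cmod (circulation G a b c d) <= 4 * (M * L * ((b - a) + (d - c))).
Proof.
move=> hG M0 h1 h2 h3 h4 h5 h6 hM; have [ha hb hc hd] := rect_sub h1 h2 h3 h4 h5 h6.
have EX y : c <= y <= d -> cmod (xside G a b y) <= 2 * (M * L * (b - a)).
  move=> /andP[cy yd]; have hy : y0 <= y <= y1 by rewrite (le_trans h4 cy) (le_trans yd h6).
  apply: cint_bound => //; first exact: xside_cont.
  move=> u /andP[au ub]; rewrite cmodM; apply: ler_pM; rewrite ?cmod_ge0//.
    by apply: hM; rewrite ?au ?cy.
  by apply: bW1; rewrite // (le_trans h1 au) (le_trans ub h3).
have EY x : a <= x <= b -> cmod (yside G c d x) <= 2 * (M * L * (d - c)).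
  move=> /andP[ax xb]; have hx : x0 <= x <= x1 by rewrite (le_trans h1 ax) (le_trans xb h3).
  apply: cint_bound => //; first exact: yside_cont.
  move=> u /andP[cu ud]; rewrite cmodM; apply: ler_pM; rewrite ?cmod_ge0//.
    by apply: hM; rewrite ?ax ?cu.
  by apply: bW2; rewrite // (le_trans h4 cu) (le_trans ud h6).
rewrite /circulation.
have e1 := EX c; have e2 := EX d; have e3 := EY a; have e4 := EY b.
rewrite lexx h5 in e1; rewrite h5 lexx in e2; rewrite lexx h2 in e3; rewrite h2 lexx in e4.
have {}e1 := e1 isT; have {}e2 := e2 isT; have {}e3 := e3 isT; have {}e4 := e4 isT.
apply: le_trans (cmodB _ _) _; apply: le_trans (lerD (cmodB _ _) (lexx _)) _.
apply: le_trans (lerD (lerD (cmodD _ _) (lexx _)) (lexx _)) _.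
move: e1 e2 e3 e4; move: (xside _ _ _ _) (xside _ _ _ _) (yside _ _ _ _) (yside _ _ _ _).
move=> p q s t; have -> : 4 * (M * L * (b - a + (d - c))) =
  2 * (M * L * (b - a)) + 2 * (M * L * (d - c)) + 2 * (M * L * (b - a)) + 2 * (M * L * (d - c)).
  by ring.
move: (2 * (M * L * (b - a))) (2 * (M * L * (d - c))) => A B; lra.
Qed.

Lemma square_lip (x y x' y' : R) : x0 <= x <= x1 -> y0 <= y <= y1 ->
  x0 <= x' <= x1 -> y0 <= y' <= y1 ->
  cmod (W (ofR x) (ofR y) - W (ofR x') (ofR y')) <= 2 * (L * (`|x - x'| + `|y - y'|)).
Proof.
move=> hx hy hx' hy'.
have seg (u v s t w : R) : s <= u <= t -> s <= v <= t -> 0 <= w <= 1 ->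
    s <= u + w * (v - u) <= t.
  move=> /andP[h1 h2] /andP[h3 h4] /andP[h5 h6].
  have a1 : 0 <= w * (v - s) by rewrite mulr_ge0 ?subr_ge0.
  have a2 : 0 <= (1 - w) * (u - s) by rewrite mulr_ge0 ?subr_ge0.
  have a3 : 0 <= w * (t - v) by rewrite mulr_ge0 ?subr_ge0.
  have a4 : 0 <= (1 - w) * (t - u) by rewrite mulr_ge0 ?subr_ge0.
  by apply/andP; split; lra.
have A : cmod (W (ofR x) (ofR y) - W (ofR x') (ofR y)) <= 2 * (L * `|x - x'|).
  have := @mean_value _ (W^~ (ofR y)) (W1^~ (ofR y)) (ofR x') (ofR (x - x')) L.
  rewrite -ofRD subrKC cmod_ofR; apply => t ht; rewrite -ofRM -ofRD.
    by apply: hW1 => //; exact: seg.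
  by apply: bW1 => //; exact: seg.
have B : cmod (W (ofR x') (ofR y) - W (ofR x') (ofR y')) <= 2 * (L * `|y - y'|).
  have := @mean_value _ (W (ofR x')) (W2 (ofR x')) (ofR y') (ofR (y - y')) L.
  rewrite -ofRD subrKC cmod_ofR; apply => t ht; rewrite -ofRM -ofRD.
    by apply: hW2 => //; exact: seg.
  by apply: bW2 => //; exact: seg.
by rewrite mulrDr mulrDr; apply: le_trans (cmod_triangle _ _ _) (lerD A B).
Qed.

(** On a small rectangle F is an affine function, which has a primitive and
does not contribute, plus an error that is small compared with the side lengths;
the integral of the error along the boundary is small compared with their
square.  W may be degenerate, as F only matters at the points of W. *)
Lemma goursat_square (F : C -> C) : x0 <= x1 -> y0 <= y1 ->
  (forall x y : R, x0 <= x <= x1 -> y0 <= y <= y1 ->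
     exists d, dC F (W (ofR x) (ofR y)) d) ->
  circulation F x0 x1 y0 y1 = 0.
Proof.
move=> hx hy dF.
have cF : cont_image F by move=> x y hx' hy'; have [d /dC_cont] := dF x y hx' hy'.
have splitxE (p1 p2 yc q1 q2 ya yb : C) :
    p1 + p2 + yc - (q1 + q2) - ya = (p1 + yb - q1 - ya) + (p2 + yc - q2 - yb) by ring.
have splityE (p r1 r2 q s1 s2 t : C) :
    p + (r1 + r2) - q - (s1 + s2) = (p + r1 - t - s1) + (t + r2 - q - s2) by ring.
apply: bisection => //.
- move=> a b c d e h1 h2 h3 h4 h5 h6 h7.
  have [ha hc hd he] := rect_sub h1 (le_trans h2 h3) h4 h5 h6 h7.
  have EX t : y0 <= t <= y1 -> xside F a c t = xside F a b t + xside F b c t.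
    by move=> ht; apply: cint_chasles; [rewrite h2|exact: xside_cont].
  by rewrite /circulation !EX//; exact: splitxE.
- move=> a b c d e h1 h2 h3 h4 h5 h6 h7.
  have [ha hb hc he] := rect_sub h1 h2 h3 h4 (le_trans h5 h6) h7.
  have EY t : x0 <= t <= x1 -> yside F c e t = yside F c d t + yside F d e t.
    by move=> ht; apply: cint_chasles; [rewrite h5|exact: yside_cont].
  by rewrite /circulation !EY//; exact: splityE.
move=> x y hx' hy' e e0; have [d hd] := dF x y hx' hy'.
pose w0 := W (ofR x) (ofR y).
pose K := 8 * L ^+ 2 + 1; have K0 : 0 < K by rewrite /K; have := sqr_ge0 L; lra.
have e'0 : 0 < e / K by rewrite divr_gt0.
have [s s0 hs] := (dC_epsP _ _ _).1 hd _ e'0.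
have L40 : 0 < 4 * L + 1 by have := L0; lra.
exists (s / (4 * L + 1)); first by rewrite divr_gt0.
move=> a b c t h1 /andP[ax xb] h3 h4 /andP[cy yt] h6.
rewrite !ltr_pdivlMr// => hb1 hb2.
pose A w := F w0 + d * (w - w0).
pose E w := F w - A w.
have dA w : dC A w d.
  apply: dC_eq (dCD (dC_cst (F w0) w) (dCMl d (dCB (dC_id w) (dC_cst w0 w)))).
  by rewrite subr0 mulr1 add0r.
have cA : cont_image A by move=> u v _ _; exact: dC_cont (dA _).
have cE : cont_image E by move=> u v hu hv; apply: contCB; [exact: cF|exact: cA].
have -> : F = (fun w => A w + E w) by apply/funext => w; rewrite /E subrKC.
have hab := le_trans ax xb; have hct := le_trans cy yt.
have EA : circulation A a b c t = 0.
  apply: (@circulation_exact A (fun w => F w0 * w + d / 2 * (w - w0) ^+ 2) a b c t cA _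
    h1 hab h3 h4 hct h6) => w.
  apply: dC_eq (dCD (dCMl (F w0) (dC_id w))
    (dCMl (d / 2) (dCX 2 (dCB (dC_id w) (dC_cst w0 w))))).
  by rewrite /A /= expr1 subr0 !mulr1; field.
rewrite (circulationD cA cE h1 hab h3 h4 hct h6) EA add0r.
pose T := (b - a) + (t - c).
have T0 : 0 <= T by rewrite addr_ge0 ?subr_ge0.
apply: le_trans (circulation_bound (M := e / K * (2 * (L * T))) cE _ _ _ _ _ _ _ _) _ => //.
- by rewrite mulr_ge0 ?(ltW e'0)// mulr_ge0// mulr_ge0.
- move=> u v /andP[au ub] /andP[cv vt].
  have D1 : `|u - x| <= b - a by rewrite ler_norml; apply/andP; split; lra.
  have D2 : `|v - y| <= t - c by rewrite ler_norml; apply/andP; split; lra.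
  have hu : x0 <= u <= x1 by rewrite (le_trans h1 au) (le_trans ub h3).
  have hv : y0 <= v <= y1 by rewrite (le_trans h4 cv) (le_trans vt h6).
  have lip : cmod (W (ofR u) (ofR v) - w0) <= 2 * (L * T).
    apply: le_trans (square_lip hu hv hx' hy') _.
    by rewrite ler_wpM2l// ler_wpM2l// lerD.
  have := hs (W (ofR u) (ofR v) - w0); rewrite -/w0 subrKC => H.
  have -> : E (W (ofR u) (ofR v)) = F (W (ofR u) (ofR v)) - F w0 - d * (W (ofR u) (ofR v) - w0).
    by rewrite /E /A; ring.
  apply: le_trans (H _) _; last by rewrite ler_wpM2l// ltW.
  apply: le_lt_trans lip _; move: hb1 hb2; rewrite /T.
  have : 0 <= b - a by rewrite subr_ge0.
  have : 0 <= t - c by rewrite subr_ge0.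
  move: (b - a) (t - c) => p q; nra.
rewrite -/T; have -> : 4 * (e / K * (2 * (L * T)) * L * T) = e * T ^+ 2 * (8 * L ^+ 2 / K).
  by field; rewrite gt_eqF.
by rewrite ler_piMr ?mulr_ge0 ?sqr_ge0 ?(ltW e0)// ler_pdivrMr// mul1r /K; lra.
Qed.

End GoursatSquare.

(** * Cauchy's formula and Taylor series *)

Section Cauchy.
Variable R : realType.
Local Notation C := (Cplx R).
Variables (h : C -> C) (r rho : R).
Hypothesis rho0 : 0 < rho.
Hypothesis rhor : rho < r.
Hypothesis dh : forall z, cmod z < r -> exists d, dC h z d.

Definition circ (y : C) : C := ofR rho * cexp (ic * y).

Lemma dC_circ y : dC circ y (ic * circ y).
Proof.
apply: dC_eq (dCMl (ofR rho) (dC_cexp_comp (dCMl ic (dC_id y)))).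
by rewrite /circ mulr1; ring.
Qed.

Lemma circ_cont y : {for y, continuous circ}.
Proof. exact: dC_cont (dC_circ y). Qed.

Lemma cmod_circ (y : R) : cmod (circ (ofR y)) = rho.
Proof.
rewrite /circ cmodM cmod_ofR gtr0_norm// cmod_cexp RepM /= mul0r mulr0 subrr.
by rewrite expR0 mulr1.
Qed.

Lemma circ_neq0 y : circ y != 0.
Proof. by rewrite mulf_neq0 ?cexp_neq0// ofR_eq0 gt_eqF. Qed.

Lemma circ_period : circ (ofR (pi *+ 2)) = circ (ofR 0).
Proof. by rewrite /circ -/(@tau R) cexp_tau ofR0 mulr0 cexp0. Qed.

Lemma h_cont z : cmod z < r -> {for z, continuous h}.
Proof. by move=> /dh[d] /dC_cont. Qed.

Lemma pi2_ge0 : 0 <= pi *+ 2 :> R.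
Proof. by rewrite mulrn_wge0// pi_ge0. Qed.

Lemma dC_quotient a w : cmod w < r -> w != a -> exists d,
  dC (fun w => (h w - h a) / (w - a)) w d.
Proof.
move=> wr wa; have [d hd] := dh wr.
have D1 : dC (fun w => h w - h a) w d.
  by apply: dC_eq (dCB hd (dC_cst (h a) _)); rewrite subr0.
have D2 : dC (fun w => w - a) w 1.
  by apply: dC_eq (dCB (dC_id w) (dC_cst a _)); rewrite subr0.
exists ((d * (w - a) - (h w - h a) * 1) / (w - a) ^+ 2).
by apply: (@dC_div R (fun w => h w - h a) (fun w => w - a)); rewrite ?subr_eq0.
Qed.

(** The contours a + x (circ y - a), for x from l to 1, sweep the region
between a small contour around a and the whole circle.  The two sides y = 0 and
y = 2 pi of the parameter rectangle cancel by periodicity, and x >= l > 0 keeps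
the contours away from the singularity a. *)
Lemma cauchy_annulus (a : C) (l : R) : cmod a < rho -> 0 < l <= 1 ->
  let F w := (h w - h a) / (w - a) in
  cint (fun y => F (circ y) * (ic * circ y)) 0 (pi *+ 2) =
  cint (fun y => F (a + ofR l * (circ y - a)) * (ofR l * (ic * circ y))) 0 (pi *+ 2).
Proof.
move=> ha /andP[l0 l1] F.
pose W (x y : C) := a + x * (circ y - a).
pose W1 (x y : C) := circ y - a.
pose W2 (x y : C) := x * (ic * circ y).
have hin (x : R) : l <= x <= 1 -> 0 <= x <= 1 by move=> /andP[h1 ->]; rewrite andbT; lra.
have H := @goursat_square R W W1 W2 l 1 0 (pi *+ 2) (2 * rho) _ _ _ _ _ _ _ F l1 pi2_ge0 _.
have {H} : circulation W W1 W2 F l 1 0 (pi *+ 2) = 0.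
  apply: H.
  - by rewrite mulr_ge0// ltW.
  - move=> x y _ _; apply: dC_eq (dCD (dC_cst a _) (dCM (dC_id _) (dC_cst (circ (ofR y) - a) _))).
    by rewrite /W1 mul1r mulr0 addr0 add0r.
  - move=> x y _ _; apply: dC_eq (dCD (dC_cst a _) (dCMl (ofR x) (dCB (dC_circ _) (dC_cst a _)))).
    by rewrite /W2 subr0 add0r.
  - by move=> x y _ _; exact: contC_cst.
  - move=> x y _ _; apply: contCM; first exact: contC_cst.
    by apply: contCM; [exact: contC_cst|exact: circ_cont].
  - move=> x y _ _; rewrite /W1; apply: le_trans (cmodB _ _) _; rewrite cmod_circ.
    by move: (cmod a) ha => q; lra.
  - move=> x y /hin/andP[xx0 xx1] _; rewrite /W2 cmodM [cmod (ic * _)]cmodM cmod_ofR cmod_ic mul1r cmod_circ ger0_norm//.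
    by have := rho0; nra.
  move=> x y hx _; have /andP[xx0 xx1] := hin _ hx.
  have x0 : 0 < x by case/andP: hx => hx _; lra.
  have Wr : cmod (W (ofR x) (ofR y)) < r.
    apply: le_lt_trans rhor.
    have -> : W (ofR x) (ofR y) = ofR (1 - x) * a + ofR x * circ (ofR y).
      by rewrite /W ofRB ofR1; ring.
    apply: le_trans (cmodD _ _) _; rewrite [cmod (_ * a)]cmodM [cmod (_ * circ _)]cmodM !cmod_ofR cmod_circ !ger0_norm ?subr_ge0//.
    by have := rho0; nra.
  have Wa : W (ofR x) (ofR y) - a != 0.
    have ca : circ (ofR y) - a != 0.
      by rewrite subr_eq0; apply/eqP => E; move: ha; rewrite -E cmod_circ ltxx.
    by rewrite /W addrC addKr mulf_neq0// ofR_eq0 gt_eqF.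
  by apply: (dC_quotient Wr); rewrite -subr_eq0.
rewrite /circulation.
have -> : xside W W1 F l 1 (pi *+ 2) = xside W W1 F l 1 0.
  by apply: cint_eq => u _; rewrite /W /W1 circ_period.
have E (p q t : C) : p + q - p - t = q - t by ring.
rewrite E => /eqP; rewrite subr_eq0 => /eqP H.
transitivity (yside W W2 F 0 (pi *+ 2) 1); last by rewrite H.
by apply: cint_eq => u _; rewrite /W /W2 ofR1 !mul1r subrKC.
Qed.

End Cauchy.

Section CauchyCircle.
Variable R : realType.
Local Notation C := (Cplx R).

Lemma cintB (f g : C -> C) (s t : R) : ccont f s t -> ccont g s t ->
  cint (fun u => f u - g u) s t = cint f s t - cint g s t.
Proof.
move=> hf hg; have hg' : ccont (fun u => -1 * g u) s t.
  by move=> u /hg H; apply: contCM; [exact: contC_cst|].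
rewrite -[X in _ - X]mul1r -mulNr -(cintZ (-1) hg) -(cintD hf hg').
by apply: cint_eq => u _; rewrite mulN1r.
Qed.

Lemma ccont_bounded (f : C -> C) (s t : R) : s <= t -> ccont f s t ->
  exists2 M : R, 0 <= M & forall u, s <= u <= t -> cmod (f (ofR u)) <= M.
Proof.
move=> st hf.
have [|u _ hu] := @EVT_max R (fun v => cmod (f (ofR v))) s t st.
  apply: continuous_in_subspaceT => u; rewrite inE /= in_itv /= => /hf /contCP H.
  apply/cvgrPdist_lt => e e0; have [d d0 hd] := H e e0.
  apply/nbhs_ballP; exists d => //= v; rewrite /ball /= => vd.
  have : cmod (f (ofR v) - f (ofR u)) < e.
    by apply: hd; rewrite -ofRB cmod_ofR distrC.
  apply: le_lt_trans; rewrite ler_norml; apply/andP; split.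
    by have := cmod_sub_ge (f (ofR v)) (f (ofR u)); lra.
  by have := cmod_sub_ge (f (ofR u)) (f (ofR v)); rewrite cmod_distC; lra.
exists (cmod (f (ofR u))); first exact: cmod_ge0.
by move=> v hv; apply: hu; rewrite in_itv.
Qed.

Variables (h : C -> C) (r rho : R).
Hypothesis rho0 : 0 < rho.
Hypothesis rhor : rho < r.
Hypothesis dh : forall z, cmod z < r -> exists d, dC h z d.
Local Notation circ := (circ rho).
Local Notation T := (pi *+ 2).

Lemma circ_subr_neq0 (a : C) (y : R) : cmod a < rho -> circ (ofR y) - a != 0.
Proof.
by move=> ha; rewrite subr_eq0; apply/eqP => E; move: ha; rewrite -E (cmod_circ rho0) ltxx.
Qed.

Lemma hcirc_cont (y : R) : {for ofR y, continuous (fun y => h (circ y))}.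
Proof.
apply: contC_comp; first exact: circ_cont.
by apply: (h_cont dh); rewrite (cmod_circ rho0).
Qed.

(** The quotient is bounded near a, where h is differentiable, and the length of
the inner contour in [cauchy_annulus] is proportional to l: let l tend to 0. *)
Lemma cauchy_kernel a : cmod a < rho ->
  cint (fun y => (h (circ y) - h a) / (circ y - a) * (ic * circ y)) 0 T = 0.
Proof.
move=> ha; set I := cint _ _ _; apply/eqP; rewrite -cmod_eq0 eq_le cmod_ge0 andbT.
apply/ler_addgt0Pr => e e0; rewrite add0r.
have [d hd] := dh (lt_trans ha rhor).
have [s s0 hs] := (dC_epsP _ _ _).1 hd 1 ltr01.
pose M := cmod d + 1; have M0 : 0 < M by rewrite /M; have := cmod_ge0 d; lra.
have T0 : 0 < T :> R by rewrite pmulrn_lgt0// pi_gt0.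
(* s / (4 rho) bounds the difference quotient on the contour by M; the last
   term bounds the integral by e *)
pose l := Num.min 1 (Num.min (s / (4 * rho)) (e / (2 * (M * rho * T)))).
have l0 : 0 < l by rewrite !lt_min ltr01 !divr_gt0 ?mulr_gt0.
have l1 : l <= 1 by rewrite ge_min lexx.
have ls : l * (4 * rho) <= s.
  by rewrite -ler_pdivlMr ?mulr_gt0// !ge_min lexx orbT.
have le : l * (2 * (M * rho * T)) <= e.
  by rewrite -ler_pdivlMr ?mulr_gt0// !ge_min lexx !orbT.
have -> : I = _ := cauchy_annulus rho0 rhor dh ha (introT andP (conj l0 l1)).
have Win (y : R) : cmod (a + ofR l * (circ (ofR y) - a)) < r.
  apply: le_lt_trans rhor.
  have -> : a + ofR l * (circ (ofR y) - a) = ofR (1 - l) * a + ofR l * circ (ofR y).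
    by rewrite ofRB ofR1; ring.
  apply: le_trans (cmodD _ _) _; rewrite [cmod (_ * a)]cmodM [cmod (_ * circ _)]cmodM !cmod_ofR (cmod_circ rho0).
  rewrite !ger0_norm ?subr_ge0 ?(ltW l0)//.
  have : (1 - l) * cmod a <= (1 - l) * rho by rewrite ler_wpM2l ?subr_ge0// ltW.
  by lra.
have Wa (y : R) : a + ofR l * (circ (ofR y) - a) != a.
  by rewrite -subr_eq0 addrC addKr mulf_neq0 ?circ_subr_neq0// ofR_eq0 gt_eqF.
apply: le_trans (cint_bound (M := M * (l * rho)) (ltW T0) _ _) _.
- move=> y _; apply: contCM; last first.
    by apply: contCM; [exact: contC_cst|apply: contCM; [exact: contC_cst|exact: circ_cont]].
  have dW : dC (fun y => a + ofR l * (circ y - a)) (ofR y) (ofR l * (ic * circ (ofR y))).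
    apply: dC_eq (dCD (dC_cst a _) (dCMl (ofR l) (dCB (dC_circ rho _) (dC_cst a _)))).
    by rewrite subr0 add0r.
  have [q /dC_cont hq] := dC_quotient dh (Win y) (Wa y).
  apply: (@contC_comp R (fun w => (h w - h a) / (w - a))); last exact: hq.
  exact: dC_cont dW.
- move=> y _; rewrite cmodM; apply: ler_pM; rewrite ?cmod_ge0//; last first.
    by rewrite cmodM [cmod (ic * _)]cmodM cmod_ofR cmod_ic mul1r (cmod_circ rho0) ger0_norm// ltW.
  set w := a + _.
  have wa : 0 < cmod (w - a) by rewrite cmod_gt0 subr_eq0 Wa.
  rewrite cmodM cmodV ler_pdivrMr//.
  have := hs (w - a); rewrite subrKC mul1r => H.
  have -> : h w - h a = (h w - h a - d * (w - a)) + d * (w - a) by ring.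
  apply: le_trans (cmodD _ _) _; rewrite [cmod (d * _)]cmodM /M mulrDl mul1r addrC lerD2l.
  apply: H; rewrite /w addrC addKr cmodM cmod_ofR gtr0_norm//.
  apply: lt_le_trans ls; rewrite ltr_pM2l//.
  apply: le_lt_trans (cmodB _ _) _; rewrite (cmod_circ rho0).
  by move: ha rho0; move: (cmod a) => q; lra.
apply: le_trans le; rewrite subr0 le_eqVlt; apply/orP; left; apply/eqP; ring.
Qed.

Lemma circV_dC k y : dC (fun y => circ y ^- k) y (- k%:R * (ic * circ y ^- k)).
Proof.
apply: dC_eq (dCV _ (dCX k (dC_circ rho y))); last first.
  by rewrite expf_neq0// circ_neq0.
case: k => [|k]; first by rewrite !mul0r !oppr0 !mul0r.
by rewrite /= !exprS; field; rewrite expf_neq0// circ_neq0.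
Qed.

Lemma circV_cont k (y : C) : {for y, continuous (fun y => circ y ^- k)}.
Proof. exact: dC_cont (circV_dC k y). Qed.

Lemma cint_circV k : cint (fun y => ic * circ y ^- k) 0 T = if k is 0 then tau else 0.
Proof.
case: k => [|k].
  rewrite (@cint_FTC R _ (fun y => ic * y)) ?pi2_ge0//.
  - by rewrite ofR0 mulr0 subr0.
  - by move=> y _; apply: contCM; [exact: contC_cst|exact: circV_cont].
  by move=> y _; rewrite expr0 invr1; exact: dCMl (dC_id _).
rewrite (@cint_FTC R _ (fun y => - (k.+1%:R)^-1 * circ y ^- k.+1)) ?pi2_ge0//.
- by rewrite circ_period subrr.
- by move=> y _; apply: contCM; [exact: contC_cst|exact: circV_cont].
move=> y _; apply: dC_eq (dCMl _ (circV_dC k.+1 _)).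
by rewrite mulrA mulrNN mulVf ?mul1r ?pnatr_eq0.
Qed.

(** Cauchy's integral for the k-th Taylor coefficient of h at 0, with
dw = i circ(y) dy. *)
Definition cauchy_coef (k : nat) : C :=
  tau^-1 * cint (fun y => h (circ y) * (ic * circ y ^- k)) 0 T.

Lemma tau_neq0 : tau != 0 :> C.
Proof.
rewrite mulf_neq0//; first by rewrite -cmod_gt0 cmod_ic.
by rewrite ofR_eq0 mulrn_eq0 /= gt_eqF// pi_gt0.
Qed.

Lemma cauchy_coef_bound : exists B : R, forall k, cmod (cauchy_coef k) * rho ^+ k <= B.
Proof.
have [M M0 hM] := @ccont_bounded _ 0 T (pi2_ge0 R) (fun y _ => @hcirc_cont y).
exists ((cmod (tau : C))^-1 * (2 * (M * (T - 0)))) => k.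
rewrite cmodM cmodV -mulrA ler_wpM2l ?invr_ge0 ?cmod_ge0//.
have rk : 0 < rho ^+ k by rewrite exprn_gt0.
rewrite -ler_pdivlMr//.
have -> : 2 * (M * (T - 0)) / rho ^+ k = 2 * (M / rho ^+ k * (T - 0)) by ring.
apply: (@cint_bound R (fun y => h (circ y) * (ic * circ y ^- k)) 0 T _ (pi2_ge0 R)).
  move=> y _; apply: contCM; first exact: hcirc_cont.
  by apply: contCM; [exact: contC_cst|exact: circV_cont].
move=> y hy; rewrite cmodM cmodM cmod_ic mul1r cmodV cmodX (cmod_circ rho0).
by rewrite ler_wpM2r ?hM// invr_ge0 ltW.
Qed.

(** The kernel k0 = circ / (circ - a) satisfies k0 = 1 + (a / circ) k0.
Using this n times in [cauchy_kernel] gives the n-th partial sum and a remainder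
of order (|a| / rho) ^+ n, without integrating an infinite series. *)
Lemma cauchy_coef_sum a : cmod a < rho -> psum cauchy_coef a @ \oo --> h a.
Proof.
move=> ha; pose G y := (h (circ y) - h a) * ic.
pose k0 y := circ y / (circ y - a).
have Gc (y : R) : {for ofR y, continuous G}.
  apply: contCM; last exact: contC_cst.
  by apply: contCB; [exact: hcirc_cont|exact: contC_cst].
have kc (y : R) : {for ofR y, continuous k0}.
  apply: contCM; first exact: circ_cont.
  have D : dC (fun y => circ y - a) (ofR y) (ic * circ (ofR y)).
    by apply: dC_eq (dCB (dC_circ rho _) (dC_cst a _)); rewrite subr0.
  by apply: dC_cont (dCV _ D); exact: circ_subr_neq0.
have GVc k (y : R) : {for ofR y, continuous (fun y => G y * circ y ^- k)}.
  by apply: contCM; [exact: Gc|exact: circV_cont].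
have GVkc k (y : R) : {for ofR y, continuous (fun y => G y * circ y ^- k * k0 y)}.
  by apply: contCM; [exact: GVc|exact: kc].
have E0 : cint (fun y => G y * circ y ^- 0 * k0 y) 0 T = 0.
  rewrite -(cauchy_kernel ha); apply: cint_eq => y _.
  by rewrite /G /k0 expr0 invr1 mulr1; ring.
have En n : \sum_(k < n) a ^+ k * cint (fun y => G y * circ y ^- k) 0 T +
    a ^+ n * cint (fun y => G y * circ y ^- n * k0 y) 0 T = 0.
  elim: n => [|n IH]; first by rewrite big_ord0 add0r E0 mulr0.
  rewrite -[RHS]IH big_ord_recr /= -addrA; congr (_ + _).
  rewrite exprSr -mulrA -mulrDr; congr (_ * _).
  rewrite -cintZ; last by move=> y _; exact: GVkc.
  rewrite -cintD; last 2 first.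
  - by move=> y _; exact: GVc.
  - by move=> y _; apply: contCM; [exact: contC_cst|exact: GVkc].
  apply: cint_eq => y _; rewrite /k0 exprS.
  have c0 : circ (ofR y) != 0 by exact: circ_neq0.
  have ca := circ_subr_neq0 y ha.
  by field; rewrite ca expf_neq0 ?c0.
have Ek k : cint (fun y => G y * circ y ^- k) 0 T =
    tau * cauchy_coef k - h a * (if k is 0 then tau else 0).
  rewrite /cauchy_coef mulrA divff ?tau_neq0// mul1r -cint_circV.
  have c1 : ccont (fun y => h (circ y) * (ic * circ y ^- k)) 0 T.
    move=> y _; apply: contCM; first exact: hcirc_cont.
    by apply: contCM; [exact: contC_cst|exact: circV_cont].
  have c2 : ccont (fun y => ic * circ y ^- k) 0 T.
    by move=> y _; apply: contCM; [exact: contC_cst|exact: circV_cont].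
  have c3 : ccont (fun y => h a * (ic * circ y ^- k)) 0 T.
    by move=> y hy; apply: contCM; [exact: contC_cst|exact: c2].
  rewrite -(@cintZ R (fun y => ic * circ y ^- k) (h a) 0 T c2) -(cintB c1 c3).
  by apply: cint_eq => y _; rewrite /G; ring.
have [M M0 hM] := @ccont_bounded (fun y => G y * k0 y) 0 T (pi2_ge0 R)
   (fun y _ => contCM (@Gc y) (@kc y)).
pose q := cmod a / rho.
have q01 : 0 <= q < 1.
  by rewrite divr_ge0 ?cmod_ge0 ?(ltW rho0)//= ltr_pdivrMr// mul1r.
pose B := (cmod (tau : C))^-1 * (2 * (M * (T - 0))).
have t0 : 0 < cmod (tau : C) by rewrite cmod_gt0 tau_neq0.
have main n : cmod (psum cauchy_coef a n.+1 - h a) <= B * q ^+ n.+1.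
  have sumE : \sum_(k < n.+1) a ^+ k * cint (fun y => G y * circ y ^- k) 0 T =
     tau * (psum cauchy_coef a n.+1 - h a).
    under eq_bigr => k _ do rewrite Ek mulrBr.
    rewrite sumrB mulrBr; congr (_ - _).
      by rewrite /psum mulr_sumr; apply: eq_bigr => k _; ring.
    by rewrite big_ord_recl big1 ?addr0 => [|k _]; rewrite /= ?mulr0//; ring.
  have := En n.+1; rewrite sumE => /eqP; rewrite addr_eq0 => /eqP E.
  have {E} : cmod tau * cmod (psum cauchy_coef a n.+1 - h a) =
     cmod (a ^+ n.+1 * cint (fun y => G y * circ y ^- n.+1 * k0 y) 0 T).
    by rewrite -cmodM E cmodN.
  move=> E; rewrite /B -mulrA mulrC ler_pdivlMr// mulrC E cmodM cmodX.
  have rn : 0 < rho ^+ n.+1 by rewrite exprn_gt0.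
  have -> : 2 * (M * (T - 0)) * q ^+ n.+1 =
     cmod a ^+ n.+1 * (2 * (M / rho ^+ n.+1 * (T - 0))).
    by rewrite /q expr_div_n; ring.
  rewrite ler_wpM2l ?exprn_ge0 ?cmod_ge0//.
  apply: (@cint_bound R (fun y => G y * circ y ^- n.+1 * k0 y) 0 T _ (pi2_ge0 R)).
    by move=> y _; exact: GVkc.
  move=> y hy; rewrite mulrAC cmodM cmodV cmodX (cmod_circ rho0).
  by rewrite ler_wpM2r ?hM// invr_ge0 ltW.
rewrite -(cvg_shiftS (psum cauchy_coef a)).
apply/cvgCP => e e0; have [N hN] := geo_lim0 B q01 e0.
exists N => // n /= nN; apply: le_lt_trans (main n) _; apply: hN.
exact: leq_trans nN (leqnSn n).
Qed.

End CauchyCircle.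

Section Taylor.
Variable R : realType.
Local Notation C := (Cplx R).

(** Two circles give the same coefficients, since power series are determined
by their sum; hence the same series represents h on all smaller disks. *)
Lemma taylor_disk (h : C -> C) (r : R) : 0 < r ->
  (forall z, cmod z < r -> exists d, dC h z d) ->
  exists c, radius_ge c r /\ forall z, cmod z < r -> h z = PS c z.
Proof.
move=> r0 dh.
have one (rho : R) : 0 < rho -> rho < r -> radius_ge (cauchy_coef h rho) rho /\
    forall z, cmod z < rho -> h z = PS (cauchy_coef h rho) z.
  move=> rho0 rhor; split.
    move=> s /andP[s0 sr]; have [B hB] := cauchy_coef_bound rho0 rhor dh.
    exists B => n; apply: le_trans (hB n); rewrite ler_wpM2l ?cmod_ge0//.
    by rewrite lerXn2r ?nnegrE ?(ltW s0) ?(ltW rho0)// ltW.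
  by move=> z zr; rewrite (PS_lim (cauchy_coef_sum rho0 rhor dh zr)).
pose c := cauchy_coef h (r / 2).
have r20 : 0 < r / 2 by lra.
have r2r : r / 2 < r by lra.
have [c1 c2] := one _ r20 r2r.
have big (rho : R) : r / 2 < rho -> rho < r -> cauchy_coef h rho = c.
  move=> h1 h2; have rho0 : 0 < rho by lra.
  have [e1 e2] := one _ rho0 h2.
  apply/funext; apply: (PS_inj (radius_le (ltW h1) e1) c1 r20 r20 (lexx _)).
  by move=> z /andP[_ zr]; exact: etrans (esym (e2 z (lt_trans zr h1))) (c2 z zr).
have mid (s : R) : s < r -> exists rho : R, [/\ r / 2 < rho, s < rho & rho < r].
  move=> sr; exists ((Num.max s (r / 2) + r) / 2).
  have : s <= Num.max s (r / 2) by rewrite le_max lexx.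
  have : r / 2 <= Num.max s (r / 2) by rewrite le_max lexx orbT.
  have : Num.max s (r / 2) < r by rewrite gt_max sr.
  by move: (Num.max _ _) => x; split; lra.
exists c; split.
  move=> s /andP[s0 sr]; have [rho [h1 h2 h3]] := mid s sr.
  have [e1 _] := one rho (lt_trans s0 h2) h3.
  by rewrite -(big rho h1 h3); apply: e1; rewrite s0.
move=> z zr; have [rho [h1 h2 h3]] := mid _ zr.
have [_ e2] := one rho (le_lt_trans (cmod_ge0 z) h2) h3.
by rewrite -(big rho h1 h3); exact: e2.
Qed.

(** The Schwarzian needs three derivatives where the definition of a
solution only provides one; this lemma supplies the others. *)
Lemma holomorphic_derivative (g : C -> C) (z0 : C) :
  (\forall w \near z0, derivable g w 1) ->
  exists g' : C -> C, \forall w \near z0, dC g w (g' w) /\ derivable g' w 1.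
Proof.
move=> /nbhsCP[r r0 H].
have [|c [hc Hc]] := @taylor_disk (fun z => g (z0 + z)) r r0.
  move=> z zr; have /H hz : cmod (z0 + z - z0) < r by rewrite addrC addKr.
  exists (derive1 g (z0 + z) * (0 + 1)).
  apply: (@dC_comp R g (fun z => z0 + z)); last exact: dC_derivable.
  exact: dCD (dC_cst _ _) (dC_id _).
pose g' w := PS (fun n => n.+1%:R * c n.+1) (w - z0).
have shift (f : C -> C) w d : dC f (w - z0) d -> dC (fun v => f (v - z0)) w d.
  move=> hf; rewrite -[d]mulr1 -[X in _ * X]subr0.
  by apply: (@dC_comp R f (fun v => v - z0)); [exact: dCB (dC_id _) (dC_cst _ _)|].
exists g'; apply/nbhsCP; exists r => // w wr; split.
  apply: (@dC_near R (fun v => PS c (v - z0))).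
    apply/nbhsCP; exists (r - cmod (w - z0)); first by rewrite subr_gt0.
    move=> v hv; rewrite -Hc; first by rewrite subrKC.
    by have := cmod_triangle v w z0; lra.
  by apply: shift; exact: dC_PS hc wr.
apply: dC_ex; apply: shift; apply: (dC_PS _ wr).
exact: radius_shift (radius_natM hc).
Qed.

End Taylor.

(** * Frobenius solutions *)

Section Frobenius.
Variable R : realType.
Local Notation C := (Cplx R).

Lemma strong_recursion (T : Type) (step : nat -> seq T -> T) :
  exists c : nat -> T, forall n, c n = step n (mkseq c n).
Proof.
pose pre := fix pre n := if n is m.+1 then rcons (pre m) (step m (pre m)) else [::].
exists (fun n => step n (pre n)) => n; congr step.
by elim: n => //= n IH; rewrite mkseqS -IH.
Qed.

Definition frob_sum (a c : nat -> C) n : C := \sum_(i < n) a (n - i)%N * c i.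

Lemma frob_exists (a g ka : nat -> C) (c0 : C) :
  exists c : nat -> C, c 0%N = c0 /\
    forall n, (0 < n)%N -> c n = (g n - frob_sum a c n / 2) / ka n.
Proof.
have [c hc] := strong_recursion (fun n s => if n == 0%N then c0 else
   (g n - (\sum_(i < n) a (n - i)%N * s`_i) / 2) / ka n).
exists c; split; first by rewrite hc.
case=> // n _; rewrite hc /=; congr ((_ - _ / 2) / _).
by apply: eq_bigr => i _; rewrite nth_mkseq.
Qed.

(** Let A q^i with q < 1 bound |a_i| s^i.  If |c_i| s^i <= B for all i < n, then
|frob_sum a c n| s^n <= A B / (1 - q), so that the bound B also holds for n once
|ka n| is at least A / (1 - q) + 1.  Finitely many n remain. *)
Lemma frob_radius (a g ka c : nat -> C) (r : R) : radius_ge a r -> radius_ge g r ->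
  (forall M : R, exists N, forall n, (N <= n)%N -> M <= cmod (ka n)) ->
  (forall n, (0 < n)%N -> ka n * c n = g n - frob_sum a c n / 2) ->
  radius_ge c r.
Proof.
move=> ha hg hka hc s /andP[s0 sr].
have [|A [q [A0 q01 hA]]] := radius_geometric ha (x := s); first by rewrite sr ltW.
have [|G hG] := hg s; first by rewrite s0.
have G0 : 0 <= G by have := hG 0%N; rewrite expr0 mulr1; have := cmod_ge0 (g 0%N); lra.
have d0 : 0 < 1 - q by case/andP: q01; lra.
have [N hN] := hka (A / (1 - q) + 1).
have A1 : 0 <= A / (1 - q) by rewrite divr_ge0// ltW.
pose B := G + \sum_(i < N.+1) cmod (c i) * s ^+ i.
have pos i : 0 <= cmod (c i) * s ^+ i by rewrite mulr_ge0 ?cmod_ge0// exprn_ge0// ltW.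
have B0 : 0 <= B by rewrite addr_ge0// sumr_ge0.
have GB : G <= B by rewrite lerDl sumr_ge0.
exists B; elim/ltn_ind => n IH; case: (leqP n N) => nN.
  apply: (@le_trans _ _ (\sum_(i < N.+1) cmod (c i) * s ^+ i)); last by rewrite lerDr.
  have nN1 : (n < N.+1)%N by rewrite ltnS.
  by rewrite (bigD1 (Ordinal nN1)) //= lerDl sumr_ge0.
have n0 : (0 < n)%N by case: n nN {IH}.
have k0 : 0 < cmod (ka n) by apply: lt_le_trans (hN n (ltnW nN)); lra.
rewrite -(ler_pM2l k0) mulrA -cmodM hc//.
apply: (@le_trans _ _ ((A / (1 - q) + 1) * B)); last first.
  by rewrite ler_wpM2r// hN// ltnW.
have sn : 0 <= s ^+ n by rewrite exprn_ge0// ltW.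
apply: le_trans (ler_wpM2r sn (cmodB _ _)) _; rewrite mulrDl addrC mulrDl mul1r.
apply: lerD; last exact: le_trans GB.
rewrite cmodM cmodV cmod_nat mulrAC ler_pdivrMr//.
apply: (@le_trans _ _ (A / (1 - q) * B)); last first.
  have : 0 <= A / (1 - q) * B by rewrite mulr_ge0.
  by lra.
apply: le_trans (ler_wpM2r sn (cmod_sum _ _ _)) _; rewrite mulr_suml.
apply: (@le_trans _ _ (\sum_(i < n) A * q ^+ (n - i) * B)).
  apply: ler_sum => i _; rewrite cmodM.
  have -> : s ^+ n = s ^+ (n - i) * s ^+ i by rewrite -exprD subnK// ltnW.
  rewrite mulrACA; apply: ler_pM; rewrite ?mulr_ge0 ?cmod_ge0 ?exprn_ge0 ?(ltW s0)//.
  exact: IH.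
rewrite -mulr_suml ler_wpM2r// -mulr_sumr ler_wpM2l//.
have q0 : 0 <= q by case/andP: q01.
rewrite (reindex_inj rev_ord_inj) /=; apply: (@le_trans _ _ (\sum_(i < n) q ^+ i)).
  apply: ler_sum => i _; rewrite subnS.
  have : (n - (n - i.+1) = i.+1)%N by rewrite subKn.
  by rewrite subnS => ->; apply: ler_wiXn2l => //; case/andP: q01 => _ /ltW.
exact: geo_sum.
Qed.

(** The function z^rho c(z) of z = exp x, which is single-valued in x. *)
Definition exp_series (rho : C) (c : nat -> C) (z : C) : C := cexp (rho * z) * PS c (cexp z).
(** The operator d/dx = z d/dz on the coefficients of [exp_series rho c]. *)
Definition euler (rho : C) (c : nat -> C) (n : nat) : C := (rho + n%:R) * c n.

Lemma radius_euler rho c r : radius_ge c r -> radius_ge (euler rho c) r.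
Proof.
move=> hc; have -> : euler rho c = (fun n => rho * c n + n%:R * c n).
  by apply/funext => n; rewrite /euler mulrDl.
by apply: radius_add; [exact: radius_scale|exact: radius_natM].
Qed.

Lemma PS_euler rho c r z : radius_ge c r -> cmod z < r ->
  PS (euler rho c) z = rho * PS c z + PS (fun n => n%:R * c n) z.
Proof.
move=> hc zr; have -> : euler rho c = (fun n => rho * c n + n%:R * c n).
  by apply/funext => n; rewrite /euler mulrDl.
by rewrite (PS_add (radius_scale rho hc) (radius_natM hc) zr) (PS_scale rho hc zr).
Qed.

Lemma dC_exp_series rho c r z : radius_ge c r -> cmod (cexp z) < r ->
  dC (exp_series rho c) z (exp_series rho (euler rho c) z).
Proof.
move=> hc zr; rewrite /exp_series (PS_euler rho hc zr).
apply: dC_eq (dCM (dC_cexp_comp (dCMl rho (dC_id z))) (dC_PS_cexp hc zr)).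
by rewrite mulr1; ring.
Qed.

Lemma exp_series_mul rho c b r z : radius_ge c r -> radius_ge b r -> cmod (cexp z) < r ->
  exp_series rho (cauchy_prod c b) z = PS b (cexp z) * exp_series rho c z.
Proof. by move=> hc hb zr; rewrite /exp_series (PS_mul hc hb zr); ring. Qed.

Lemma exp_series_shift rho c (m : int) z :
  exp_series rho c (z + m%:~R * tau) = cexp (m%:~R * tau * rho) * exp_series rho c z.
Proof.
rewrite /exp_series [cexp (z + _)]cexpD cexp_int mulr1 mulrDr cexpD.
by rewrite [rho * (_ * _)]mulrC; ring.
Qed.

(** The coefficients of Q(z) = (1/2 - z^2 phi(z)) / 2.  Since exp has Schwarzian
derivative - 1/2, the equation S_f = phi in z = exp x means that f o exp has
Schwarzian derivative - 2 Q(exp x), as have the quotients of solutions of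
u'' = Q(exp x) u. *)
Definition Qcoef (delta : C) (a : nat -> C) (n : nat) : C :=
  if n is 0 then delta ^+ 2 / 4 else - a n / 2.

Definition sol (Qc : nat -> C) (r : R) (u u' : C -> C) : Prop :=
  forall z, cmod (cexp z) < r -> dC u z (u' z) /\ dC u' z (PS Qc (cexp z) * u z).

Lemma radius_Qcoef delta a r : radius_ge a r -> radius_ge (Qcoef delta a) r.
Proof.
move=> ha s hs; have [B hB] := ha s hs; case/andP: hs => s0 _.
exists (Num.max (cmod (delta ^+ 2 / 4)) B) => -[|n]; rewrite le_max.
  by rewrite expr0 mulr1 lexx.
apply/orP; right; apply: le_trans (hB n.+1); rewrite ler_wpM2r ?exprn_ge0 ?(ltW s0)//.
rewrite /Qcoef cmodM cmodN cmodV cmod_nat ler_pdivrMr//; have := cmod_ge0 (a n.+1); lra.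
Qed.

Lemma cauchy_prod_Qcoef delta a c n :
  cauchy_prod c (Qcoef delta a) n = delta ^+ 2 / 4 * c n - frob_sum a c n / 2.
Proof.
rewrite /cauchy_prod big_ord_recr /= subnn /= addrC mulrC; congr (_ + _).
rewrite /frob_sum mulr_suml -sumrN; apply: eq_bigr => i _.
have := ltn_ord i; case E : (n - i)%N => [|k]; first by rewrite -subn_gt0 E.
by move=> _; rewrite /Qcoef; ring.
Qed.

Lemma frob_growth (b : C) (M : R) : exists N : nat, forall n : nat, (N <= n)%N ->
  M <= cmod (n%:R * (n%:R + b)).
Proof.
pose x := `|M| + cmod b + 1; have x0 : 0 <= x by rewrite /x addr_ge0// addr_ge0// cmod_ge0.
exists (Num.bound x) => n hn.
have h1 : x < n%:R.
  by apply: lt_le_trans (archi_boundP x0) _; rewrite ler_nat.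
rewrite cmodM cmod_nat.
have h2 : n%:R - cmod b <= cmod (n%:R + b).
  by have := cmod_sub_ge n%:R (- b); rewrite opprK cmodN cmod_nat.
have b0 := cmod_ge0 b; have M1 := ler_norm M; have M0 := normr_ge0 M.
have h3 : M <= cmod (n%:R + b) by move: h1; rewrite /x; lra.
have h4 : 1 <= n%:R :> R by move: h1; rewrite /x; lra.
apply: le_trans h3 _; rewrite ler_peMl ?cmod_ge0//.
Qed.

(** The last clause is the monodromy of the two solutions around the puncture,
up to a factor k that disappears in their quotient. *)
Definition basis_data (Qc : nat -> C) (r : R) (delta beta : C)
    (u1 u1' u2 u2' : C -> C) (w : C) : Prop :=
  [/\ sol Qc r u1 u1', sol Qc r u2 u2', w != 0,
      (forall z, cmod (cexp z) < r -> u1 z * u2' z - u1' z * u2 z = w) &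
      forall z (m : int), cmod (cexp z) < r ->
        exists2 k : C, k != 0 &
          u1 (z + m%:~R * tau) = k * u1 z /\
          u2 (z + m%:~R * tau) =
            k * (cexp (- (m%:~R * tau * delta)) * u2 z + m%:~R * tau * beta * u1 z)].

Variables (a : nat -> C) (r : R) (delta beta : C) (d : nat) (h k : nat -> C).
Hypothesis r0 : 0 < r.
Hypothesis ha : radius_ge a r.
Hypothesis bd : beta = 0 \/ delta = d%:R.
Hypothesis h0 : h 0%N = 1.
Hypothesis hh : forall n, (0 < n)%N -> n%:R * (n%:R + delta) * h n = - frob_sum a h n / 2.
(** The coefficients of - 2 beta sol1', the contribution of the factor x in
beta x sol1 to the equation for the other summand of [sol2]; the exponent
delta / 2 of sol1 is brought to - delta / 2 at the price of a shift by d. *)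
Definition resonance (n : nat) : C := - 2 * beta * unshift d (euler (delta / 2) h) n.
Hypothesis hk : forall n, n%:R * (n%:R - delta) * k n = resonance n - frob_sum a k n / 2.

Lemma radius0 : radius_ge (fun _ : nat => 0 : C) r.
Proof. by move=> s _; exists 0 => n; rewrite cmod0 mul0r. Qed.

Lemma radius_h : radius_ge h r.
Proof.
apply: (frob_radius ha radius0 (frob_growth delta)) => n n0.
by rewrite hh// sub0r mulNr.
Qed.

Lemma radius_resonance : radius_ge resonance r.
Proof. by apply: radius_scale; apply: radius_unshift; apply: radius_euler; exact: radius_h. Qed.

Lemma radius_k : radius_ge k r.
Proof.
by apply: (frob_radius ha radius_resonance (frob_growth (- delta))) => n _; rewrite hk.
Qed.

Definition sol1 (z : C) : C := exp_series (delta / 2) h z.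
Definition sol1' (z : C) : C := exp_series (delta / 2) (euler (delta / 2) h) z.
Definition sol2 (z : C) : C := beta * z * sol1 z + exp_series (- delta / 2) k z.
Definition sol2' (z : C) : C :=
  beta * sol1 z + beta * z * sol1' z + exp_series (- delta / 2) (euler (- delta / 2) k) z.

Local Notation Qc := (Qcoef delta a).

Lemma sol1_sol : sol Qc r sol1 sol1'.
Proof.
move=> z zr; split; first exact: dC_exp_series radius_h zr.
apply: dC_eq (dC_exp_series _ (radius_euler _ radius_h) zr).
rewrite /sol1 -(exp_series_mul _ radius_h (radius_Qcoef delta ha) zr); congr exp_series.
apply/funext => n; rewrite cauchy_prod_Qcoef; case: n => [|n].
  by rewrite /euler /frob_sum big_ord0; field.
by rewrite -mulNr -hh// /euler; field.
Qed.

Lemma exp_series_unshift z c : radius_ge c r -> cmod (cexp z) < r ->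
  beta * exp_series (delta / 2) c z = beta * exp_series (- delta / 2) (unshift d c) z.
Proof.
move=> hc zr; case: bd => [->|E]; first by rewrite !mul0r.
rewrite /exp_series (PS_unshift d hc zr) -cexpMn -E [cexp (- delta / 2 * z) * _]mulrA -cexpD.
by congr (_ * (cexp _ * _)); field.
Qed.

Lemma sol2_sol : sol Qc r sol2 sol2'.
Proof.
move=> z zr; have [d1 d1'] := sol1_sol zr.
have bz : dC (fun z => beta * z) z beta.
  by apply: dC_eq (dCMl beta (dC_id z)); rewrite mulr1.
split; first exact: dCD (dCM bz d1) (dC_exp_series _ radius_k zr).
apply: dC_eq (dCD (dCD (dCMl beta d1) (dCM bz d1')) (dC_exp_series _ (radius_euler _ radius_k) zr)).
have key : 2 * (beta * sol1' z) + exp_series (- delta / 2) (euler (- delta / 2) (euler (- delta / 2) k)) z =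
    PS Qc (cexp z) * exp_series (- delta / 2) k z.
  rewrite -(exp_series_mul _ radius_k (radius_Qcoef delta ha) zr) /sol1'.
  rewrite (exp_series_unshift (radius_euler _ radius_h) zr).
  have -> : cauchy_prod k Qc = (fun n => - 1 * resonance n +
      euler (- delta / 2) (euler (- delta / 2) k) n).
    apply/funext => n; rewrite cauchy_prod_Qcoef /euler.
    have -> : frob_sum a k n / 2 = resonance n - n%:R * (n%:R - delta) * k n.
      by rewrite hk; ring.
    by field.
  rewrite /exp_series (PS_add (radius_scale _ radius_resonance) (radius_euler _ (radius_euler _ radius_k)) zr).
  rewrite (PS_scale _ radius_resonance zr) /resonance.
  rewrite (PS_scale _ (radius_unshift d (radius_euler _ radius_h)) zr).
  by ring.
by rewrite /sol2 mulrDr -key; ring.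
Qed.

(** The Wronskian is constant on the half-plane, and equal to V(exp x) for a
function V that is continuous at 0; its value is therefore V 0. *)
Lemma wronskian_const z : cmod (cexp z) < r ->
  sol1 z * sol2' z - sol1' z * sol2 z = beta * 0 ^+ d - delta * k 0%N.
Proof.
pose W z := sol1 z * sol2' z - sol1' z * sol2 z.
(* the Wronskian in terms of exp x, since exp(delta x) = exp(x) ^+ d unless beta = 0 *)
pose V z := beta * (z ^+ d * PS h z ^+ 2) + (PS h z * PS (euler (- delta / 2) k) z -
  PS (euler (delta / 2) h) z * PS k z).
have dW x : cmod (cexp x) < r -> dC W x 0.
  move=> xr; have [d1 d1'] := sol1_sol xr; have [d2 d2'] := sol2_sol xr.
  by apply: dC_eq (dCB (dCM d1 d2') (dCM d1' d2)); ring.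
have WV x : cmod (cexp x) < r -> W x = V (cexp x).
  move=> xr; have E : cexp (delta / 2 * x) * cexp (- delta / 2 * x) = 1.
    by rewrite -cexpD -[RHS]cexp0; congr cexp; field.
  have E2 : beta * cexp (delta / 2 * x) ^+ 2 = beta * cexp x ^+ d.
    case: bd => [->|Ed]; first by rewrite !mul0r.
    by rewrite -cexpMn -cexpMn -Ed; congr (_ * cexp _); field.
  rewrite /W /V /sol2' /sol2 /sol1 /sol1' /exp_series.
  move: (cexp (delta / 2 * x)) (cexp (- delta / 2 * x)) E E2 => p q E E2.
  rewrite [beta * (cexp x ^+ d * _)]mulrA -E2.
  move: (PS h _) (PS (euler (delta / 2) h) _) (PS k _) (PS (euler _ k) _) => s t u v.
  transitivity (beta * p ^+ 2 * s ^+ 2 + p * q * (s * v - t * u)); first by ring.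
  by rewrite E mul1r.
have const x y : cmod (cexp x) < r -> cmod (cexp y) < r -> W x = W y.
  rewrite !cmod_cexp => xr yr; rewrite -[x](subrKC y); apply: dC0_segment => t /andP[t0 t1].
  apply: dW; rewrite cmod_cexp RepD Rep_ofRM RepB.
  have lt u v : u <= v -> expR v < r -> expR u < r.
    by move=> uv; apply: le_lt_trans; rewrite ler_expR.
  have [xy|/ltW xy] := leP (Rep x) (Rep y).
    apply: lt yr; have : 0 <= t * (Rep y - Rep x) by rewrite mulr_ge0// subr_ge0.
    by lra.
  apply: lt xr; have : 0 <= (1 - t) * (Rep x - Rep y) by rewrite mulr_ge0// subr_ge0.
  by lra.
move=> zr; rewrite -/(W z).
have V0 : V 0 = beta * 0 ^+ d - delta * k 0%N.
  by rewrite /V !PS0 /euler h0; field.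
have cz : cmod (0 : C) < r by rewrite cmod0.
have [v dV] : exists v, dC V 0 v.
  eexists; apply: dCD.
    apply: dCMl; apply: dCM; first exact: (dCX d (dC_id 0)).
    exact: (dCX 2 (dC_PS radius_h cz)).
  apply: dCB; apply: dCM.
  - exact: dC_PS radius_h cz.
  - exact: dC_PS (radius_euler _ radius_k) cz.
  - exact: dC_PS (radius_euler _ radius_h) cz.
  - exact: dC_PS radius_k cz.
apply/eqP; rewrite -subr_eq0 -cmod_eq0 eq_le cmod_ge0 andbT.
apply/ler_addgt0Pr => e e0; rewrite add0r -V0.
have [x x0 hx] := (contCP _ _).1 (dC_cont dV) _ e0.
(* a point z = y > 0 close to 0, and in the disk *)
pose y := Num.min x r / 2.
have m0 : 0 < Num.min x r by rewrite lt_min x0.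
have y0 : 0 < y by rewrite divr_gt0.
have yx : y < x by apply: (@lt_le_trans _ _ (Num.min x r)); [rewrite /y; lra|rewrite ge_min lexx].
have yr : y < r by apply: (@lt_le_trans _ _ (Num.min x r)); [rewrite /y; lra|rewrite ge_min lexx orbT].
have [zy Ezy] := @cexp_surj R (ofR y) (negbT (etrans (ofR_eq0 y) (gt_eqF y0))).
have cy : cmod (ofR y) = y by rewrite cmod_ofR gtr0_norm.
have zyr : cmod (cexp zy) < r by rewrite Ezy cy.
rewrite (const z zy zr zyr) (WV _ zyr); apply: ltW; apply: hx.
by rewrite Ezy subr0 cy.
Qed.

Lemma frobenius_basis : beta * 0 ^+ d - delta * k 0%N != 0 ->
  basis_data Qc r delta beta sol1 sol1' sol2 sol2' (beta * 0 ^+ d - delta * k 0%N).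
Proof.
move=> w0; split; [exact: sol1_sol|exact: sol2_sol|exact: w0|exact: wronskian_const|].
move=> z m zr; pose t := m%:~R * tau : C.
exists (cexp (t * (delta / 2))); first exact: cexp_neq0.
rewrite /sol1 exp_series_shift; split => //.
rewrite /sol2 /sol1 !exp_series_shift -/t.
have E : cexp (t * (delta / 2)) * cexp (- (t * delta)) = cexp (t * (- delta / 2)).
  by rewrite -cexpD; congr cexp; field.
have E2 : beta * cexp (- (t * delta)) = beta.
  case: bd => [->|Ed]; first by rewrite mul0r.
  rewrite cexpN; have -> : t * delta = (m * d%:Z)%:~R * tau.
    by rewrite /t Ed intrM -pmulrn; ring.
  by rewrite cexp_int invr1 mulr1.
rewrite -E; move: (cexp (t * (delta / 2))) (cexp _) E2 => p q E2.
move: (exp_series _ h z) (exp_series _ k z) => S T; ring: E2.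
Qed.

End Frobenius.

(** * Resonance and the determinant *)

Section Resonance.
Variable R : realType.
Local Notation C := (Cplx R).

Lemma natC_eq (m n : nat) : (m%:R == n%:R :> C) = (m == n).
Proof. exact: eqr_nat. Qed.

Lemma frob_sum_eq (a c c' : nat -> C) n : (forall i, (i < n)%N -> c i = c' i) ->
  frob_sum a c n = frob_sum a c' n.
Proof. by move=> H; apply: eq_bigr => i _; rewrite H. Qed.

(** Row i is twice the recursion at step n = i + 1.  In the last row, where
n = d, the second summand vanishes: this is the resonant step. *)
Lemma holonomy_matrix_mul (a x : nat -> C) (d : nat) (i : 'I_d) :
  \sum_(j < d) holonomy_matrix a d i j * x j =
  frob_sum a x i.+1 + 2 * (i.+1%:R * (i.+1%:R - d%:R)) * x i.+1.
Proof.
pose f (j : nat) := (if (j <= i)%N then a (i - j).+1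
    else if j == i.+1 then 2 * j%:R * (j%:R - d%:R) else 0) * x j.
rewrite (eq_bigr (fun j : 'I_d => f j)); last by move=> j _; rewrite mxE.
rewrite -(big_mkord predT f) (@big_cat_nat _ _ _ i.+1) ?ltn_ord//=.
congr (_ + _).
  rewrite big_mkord; apply: eq_bigr => j _; rewrite /f -ltnS ltn_ord.
  by rewrite subSn// -ltnS ltn_ord.
have [id|] := ltnP i.+1 d.
  rewrite big_ltn// big1_seq ?addr0.
    by rewrite /f ltnn eqxx -mulrA.
  move=> j; rewrite mem_index_iota => /andP[_ /andP[h1 h2]].
  by rewrite /f leqNgt (ltnW h1)/= gtn_eqF// mul0r.
move=> di; have -> : i.+1 = d by apply/eqP; rewrite eqn_leq di ltn_ord.
by rewrite big_geq// subrr !mulr0 mul0r.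
Qed.

(** By the rows other than the last, a vector in the kernel is a multiple of
(c 0, ..., c d.-1); the last row then says that the sum vanishes. *)
Lemma holonomy_det (a c : nat -> C) (d : nat) : (0 < d)%N -> c 0%N = 1 ->
  (forall n, (0 < n < d)%N -> n%:R * (n%:R - d%:R) * c n = - frob_sum a c n / 2) ->
  \det (holonomy_matrix a d) = 0 <-> frob_sum a c d = 0.
Proof.
move=> d0 c0 hc.
have ka n : (0 < n < d)%N -> (n%:R * (n%:R - d%:R) : C) != 0.
  move=> /andP[n0 nd]; rewrite mulf_neq0//; first by rewrite pnatr_eq0 -lt0n.
  by rewrite subr_eq0 natC_eq ltn_eqF.
rewrite -det_tr; split; last first.
  move=> fd; apply/eqP/det0P; exists (\row_(j < d) c j).
    apply/eqP => /matrixP/(_ 0 (Ordinal d0)); rewrite !mxE c0 => /eqP.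
    by rewrite oner_eq0.
  apply/rowP => i; rewrite !mxE.
  rewrite (eq_bigr (fun j : 'I_d => holonomy_matrix a d i j * c j)); last first.
    by move=> j _; rewrite !mxE mulrC.
  rewrite holonomy_matrix_mul; have [id|] := ltnP i.+1 d.
    by rewrite -mulrA hc//; field.
  move=> di; have -> : i.+1 = d by apply/eqP; rewrite eqn_leq di ltn_ord.
  by rewrite fd subrr !mulr0 mul0r addr0.
move=> /eqP/det0P[v v0 vA].
pose x (n : nat) : C := if insub n is Some i then v 0 i else 0.
have xv (i : 'I_d) : x i = v 0 i by rewrite /x valK.
have eqn (i : 'I_d) : frob_sum a x i.+1 + 2 * (i.+1%:R * (i.+1%:R - d%:R)) * x i.+1 = 0.
  rewrite -holonomy_matrix_mul.
  have := congr1 (fun M : 'rV_d => M 0 i) vA; rewrite mxE [RHS]mxE => E.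
  rewrite -[RHS]E; apply: eq_bigr => j _.
  by rewrite xv [in RHS]mxE mulrC.
(* both x and c satisfy the steps 1, ..., d - 1 of the recursion *)
have xc n : (n < d)%N -> x n = x 0%N * c n.
  elim/ltn_ind: n => -[|n] IH nd; first by rewrite c0 mulr1.
  have ka0 : n.+1%:R * (n.+1%:R - d%:R) != 0 :> C by apply: ka.
  apply: (mulfI ka0); rewrite mulrCA hc//.
  have E : frob_sum a x n.+1 = x 0%N * frob_sum a c n.+1.
    rewrite /frob_sum mulr_sumr; apply: eq_bigr => j _.
    by rewrite IH//; [ring|exact: ltn_trans nd].
  have := eqn (Ordinal (ltnW nd)); rewrite /= E => /eqP; rewrite addr_eq0 => /eqP H.
  have -> : x 0%N * (- frob_sum a c n.+1 / 2) = - (x 0%N * frob_sum a c n.+1) / 2 by ring.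
  by rewrite H; field.
have x0 : x 0%N != 0.
  apply: contra_neq v0 => x0; apply/rowP => i.
  by rewrite mxE -xv xc// x0 mul0r.
have dd : (d.-1 < d)%N by rewrite prednK.
have := eqn (Ordinal dd); rewrite /= prednK// subrr !mulr0 mul0r addr0 => H.
apply: (mulfI x0); rewrite mulr0 -H /frob_sum mulr_sumr; apply: eq_bigr => j _.
by rewrite (xc j)//; ring.
Qed.

Variables (a : nat -> C) (r : R).
Hypothesis r0 : 0 < r.
Hypothesis ha : radius_ge a r.

Lemma frob_coefs_plus (delta : C) : (forall n, (0 < n)%N -> n%:R + delta != 0) ->
  exists h : nat -> C, h 0%N = 1 /\ forall n, (0 < n)%N ->
    n%:R * (n%:R + delta) * h n = - frob_sum a h n / 2.
Proof.
move=> H; have [h [h0 hh]] := frob_exists a (fun=> 0) (fun n => n%:R * (n%:R + delta)) 1.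
exists h; split => // n n0; rewrite hh// sub0r mulrC divfK ?mulNr//.
by rewrite mulf_neq0 ?H// pnatr_eq0 -lt0n.
Qed.

Definition has_basis (delta beta : C) : Prop := exists u1 u1' u2 u2' w,
  basis_data (Qcoef delta a) r delta beta u1 u1' u2 u2' w.

Lemma basis_nonint (delta : C) : (forall n : int, delta <> n%:~R) ->
  has_basis delta 0.
Proof.
move=> H; have H1 n : (0 < n)%N -> n%:R + delta != 0.
  move=> _; rewrite addrC addr_eq0; apply/eqP => E; apply: (H (- n%:Z)).
  by rewrite E mulrNz.
have H2 n : (0 < n)%N -> n%:R - delta != 0.
  by move=> _; rewrite subr_eq0; apply/eqP => E; apply: (H n%:Z); rewrite -E.
have [h [h0 hh]] := frob_coefs_plus H1.
have [k [k0 hk]] := frob_exists a (fun=> 0) (fun n => n%:R * (n%:R - delta)) 1.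
have bd : (0 : C) = 0 \/ delta = 0%:R by left.
have hk' n : n%:R * (n%:R - delta) * k n = resonance delta 0 0 h n - frob_sum a k n / 2.
  rewrite /resonance mulr0 mul0r; case: n => [|n].
    by rewrite /frob_sum big_ord0; ring.
  by rewrite hk// mulrC divfK// mulf_neq0 ?H2// pnatr_eq0.
have := frobenius_basis r0 ha bd h0 hh hk'; rewrite k0 mul0r sub0r mulr1 => B.
do 5 eexists; apply: B; rewrite oppr_eq0; apply/eqP => E.
by apply: (H 0); rewrite E.
Qed.

Lemma basis_zero : has_basis 0 1.
Proof.
have H1 n : (0 < n)%N -> n%:R + 0 != 0 :> C by move=> n0; rewrite addr0 pnatr_eq0 -lt0n.
have [h [h0 hh]] := frob_coefs_plus H1.
have [k [k0 hk]] := frob_exists a (resonance 0 1 0 h) (fun n => n%:R * (n%:R - 0)) 0.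
have bd : (1 : C) = 0 \/ (0 : C) = 0%:R by right.
have hk' n : n%:R * (n%:R - 0) * k n = resonance 0 1 0 h n - frob_sum a k n / 2.
  case: n => [|n].
    by rewrite /frob_sum big_ord0 /resonance /unshift /euler ltnn subnn /=; ring.
  by rewrite hk// mulrC divfK// mulf_neq0 ?pnatr_eq0// subr0 pnatr_eq0.
have := frobenius_basis r0 ha bd h0 hh hk'; rewrite expr0 mul0r subr0 mulr1 => B.
by do 5 eexists; apply: B; rewrite oner_eq0.
Qed.

(** Steps n < d of the recursion do not involve beta, and at n = d the left side
vanishes, which fixes beta; k d is arbitrary. *)
Lemma basis_posint (d : nat) : (0 < d)%N -> exists beta,
  has_basis d%:R beta /\ (beta = 0 <-> \det (holonomy_matrix a d) = 0).
Proof.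
move=> d0; have dC0 : d%:R != 0 :> C by rewrite pnatr_eq0 -lt0n.
have H1 n : (0 < n)%N -> n%:R + d%:R != 0 :> C.
  by move=> n0; rewrite -natrD pnatr_eq0 addn_eq0 negb_and -!lt0n n0.
have ka n : (0 < n)%N -> n != d -> (n%:R * (n%:R - d%:R) : C) != 0.
  move=> n0 nd; rewrite mulf_neq0//; first by rewrite pnatr_eq0 -lt0n.
  by rewrite subr_eq0 natC_eq.
have [h [h0 hh]] := frob_coefs_plus H1.
have [c [c0 hc]] := frob_exists a (fun=> 0) (fun n => n%:R * (n%:R - d%:R)) 1.
pose beta : C := - frob_sum a c d / (2 * d%:R).
have [k [k0 hk]] := frob_exists a (resonance d%:R beta d h) (fun n => n%:R * (n%:R - d%:R)) 1.
(* c is the solution without resonance; k agrees with it below d *)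
have ck n : (n < d)%N -> k n = c n.
  elim/ltn_ind: n => -[|n] IH nd; first by rewrite k0 c0.
  rewrite hk// hc// /resonance /unshift nd mulr0; congr ((_ - _ / _) / _).
  by apply: frob_sum_eq => i hi; apply: IH => //; exact: ltn_trans nd.
have hk' n : n%:R * (n%:R - d%:R) * k n = resonance d%:R beta d h n - frob_sum a k n / 2.
  have [->|n0] := posnP n.
    by rewrite /frob_sum big_ord0 /resonance /unshift d0; ring.
  have [E|nd] := eqVneq n d; last by rewrite hk// mulrC divfK// ka.
  rewrite E subrr mulr0 mul0r (frob_sum_eq a ck) /resonance /unshift ltnn subnn /euler h0 /beta.
  by field.
exists beta; split.
  have bd : beta = 0 \/ d%:R = d%:R :> C by right.
  have := frobenius_basis r0 ha bd h0 hh hk'.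
  rewrite expr0n (gtn_eqF d0) /= mulr0 sub0r k0 mulr1 => B.
  by do 5 eexists; apply: B; rewrite oppr_eq0.
have hc' n : (0 < n < d)%N -> n%:R * (n%:R - d%:R) * c n = - frob_sum a c n / 2.
  by move=> /andP[n0 nd]; rewrite hc// sub0r mulrC divfK ?mulNr// ka// ltn_eqF.
rewrite (holonomy_det d0 c0 hc') /beta; split => [/eqP|->]; last by rewrite oppr0 mul0r.
rewrite mulf_eq0 oppr_eq0 invr_eq0 mulf_eq0 (negbTE dC0) orbF.
by rewrite (pnatr_eq0 _ 2) orbF => /eqP.
Qed.

End Resonance.

(** * Moebius transformations in homogeneous coordinates *)

Section Sphere.
Variable K : numFieldType.
Implicit Types (x y : K) (M N : 'M[K]_2).

(** The point with homogeneous coordinates [x : y]. *)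
Definition hom x y : sphere K := if y == 0 then None else Some (x / y).
Definition nonzero2 x y : bool := (x != 0) || (y != 0).

Lemma moebius_hom M x y : nonzero2 x y ->
  moebius M (hom x y) = hom (M 0 0 * x + M 0 1 * y) (M 1 0 * x + M 1 1 * y).
Proof.
rewrite /nonzero2 /hom; have [->|y0 _] := eqVneq y 0.
  rewrite orbF => x0 /=; rewrite !mulr0 !addr0 mulf_eq0 (negbTE x0) orbF.
  by case: eqP => // /eqP c0; congr Some; field; rewrite x0 c0.
rewrite /=.
have -> : M 1 0 * (x / y) + M 1 1 = (M 1 0 * x + M 1 1 * y) / y by field.
rewrite mulf_eq0 invr_eq0 (negbTE y0) orbF; case: eqP => // /eqP c0.
by congr Some; field; rewrite y0 c0.
Qed.

Lemma hom_eq x y x' y' : nonzero2 x y -> nonzero2 x' y' ->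
  (hom x y = hom x' y') <-> x * y' = x' * y.
Proof.
rewrite /nonzero2 /hom => h h'; move: h h'.
have [->|y0] := eqVneq y 0; have [->|y'0] := eqVneq y' 0; rewrite /= ?orbF ?mulr0.
- by [].
- move=> x0 _; split => // /eqP.
  by rewrite mulf_eq0 (negbTE x0) (negbTE y'0).
- move=> _ x0; split => // /esym /eqP.
  by rewrite mulf_eq0 (negbTE x0) (negbTE y0).
move=> _ _; split => [[H]|H]; last by congr Some; apply/eqP; rewrite eqr_div// H.
by apply/eqP; rewrite -eqr_div// H.
Qed.

Lemma sphere_hom (w : sphere K) : exists x y, nonzero2 x y /\ w = hom x y.
Proof.
case: w => [x|]; last by exists 1, 0; rewrite /nonzero2 /hom oner_eq0 eqxx.
by exists x, 1; rewrite /nonzero2 /hom oner_eq0 orbT divr1.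
Qed.

Lemma sphere_inv_hom x y : nonzero2 x y -> sphere_inv (hom x y) = hom y x.
Proof.
rewrite /nonzero2 /hom; have [->|y0 _] := eqVneq y 0.
  by rewrite orbF /= => x0; rewrite (negbTE x0) mul0r.
rewrite /= mulf_eq0 invr_eq0 (negbTE y0) orbF; case: eqP => // _.
by rewrite invf_div.
Qed.

Lemma det22 M : \det M = M 0 0 * M 1 1 - M 0 1 * M 1 0.
Proof.
rewrite (expand_det_row _ 0) !big_ord_recl big_ord0 addr0 /cofactor !det_mx11 !mxE /=.
rewrite !add0n expr0 mul1r expr1 mulN1r mulrN.
by congr (M _ _ * M _ _ - M _ _ * M _ _); apply: val_inj.
Qed.

Lemma Some_sphere_inv x y : Some x = sphere_inv (Some y) -> y != 0 /\ y^-1 = x.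
Proof. by rewrite /sphere_inv; case: eqP => // /eqP y0 [->]. Qed.

Lemma sphere_inv_Some x y : sphere_inv (Some x) = Some y -> y != 0 /\ y^-1 = x.
Proof.
by rewrite /sphere_inv; case: eqP => // /eqP x0 [<-]; rewrite invr_eq0 invrK.
Qed.

Lemma sphere_inv_inj x y : sphere_inv (Some x) = sphere_inv (Some y) -> y = x.
Proof.
rewrite /sphere_inv; case: eqP => [->|_]; case: eqP => // _ [] /invr_inj //.
Qed.

Lemma unit22 M : (M \in unitmx) = (M 0 0 * M 1 1 - M 0 1 * M 1 0 != 0).
Proof. by rewrite unitmxE det22 unitfE. Qed.

Lemma nonzero2_moebius M x y : M \in unitmx -> nonzero2 x y ->
  nonzero2 (M 0 0 * x + M 0 1 * y) (M 1 0 * x + M 1 1 * y).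
Proof.
rewrite unit22 => d0; apply: contraLR; rewrite /nonzero2 negb_or !negbK => /andP[/eqP e1 /eqP e2].
rewrite negb_or !negbK; set D := _ - _ in d0.
have Ex : D * x = 0.
  transitivity (M 1 1 * (M 0 0 * x + M 0 1 * y) - M 0 1 * (M 1 0 * x + M 1 1 * y)).
    by rewrite /D; ring.
  by rewrite e1 e2 !mulr0 subrr.
have Ey : D * y = 0.
  transitivity (M 0 0 * (M 1 0 * x + M 1 1 * y) - M 1 0 * (M 0 0 * x + M 0 1 * y)).
    by rewrite /D; ring.
  by rewrite e1 e2 !mulr0 subrr.
by move/eqP: Ex; move/eqP: Ey; rewrite !mulf_eq0 !(negbTE d0) /= => -> ->.
Qed.

Lemma mulmx22 M N (i j : 'I_2) : (M *m N) i j = M i 0 * N 0 j + M i 1 * N 1 j.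
Proof.
rewrite mxE !big_ord_recl big_ord0 addr0; congr (M i _ * N _ j + M i _ * N _ j);
  exact: val_inj.
Qed.

Lemma moebius_mul M N w : N \in unitmx -> moebius (M *m N) w = moebius M (moebius N w).
Proof.
move=> uN; have [x [y [xy ->]]] := sphere_hom w.
rewrite !moebius_hom ?nonzero2_moebius// !mulmx22.
by congr hom; ring.
Qed.

Lemma moebius1 w : moebius (1%:M : 'M[K]_2) w = w.
Proof.
have [x [y [xy ->]]] := sphere_hom w; rewrite moebius_hom// !mxE /=.
by rewrite !mul1r !mul0r addr0 add0r.
Qed.

Lemma moebiusK M : M \in unitmx -> cancel (moebius M) (moebius (invmx M)).
Proof. by move=> uM w; rewrite -moebius_mul// mulVmx// moebius1. Qed.

Lemma moebiusVK M : M \in unitmx -> cancel (moebius (invmx M)) (moebius M).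
Proof. by move=> uM w; rewrite -moebius_mul ?unitmx_inv// mulmxV// moebius1. Qed.

Definition mx22 (a b c d : K) : 'M[K]_2 :=
  \matrix_(i < 2, j < 2) if i == 0 then (if j == 0 then a else b)
                         else (if j == 0 then c else d).

Lemma mx22E a b c d : [/\ mx22 a b c d 0 0 = a, mx22 a b c d 0 1 = b,
  mx22 a b c d 1 0 = c & mx22 a b c d 1 1 = d].
Proof. by split; rewrite mxE. Qed.

Lemma mx22_unit a b c d : (mx22 a b c d \in unitmx) = (a * d - b * c != 0).
Proof. by rewrite unit22; have [-> -> -> ->] := mx22E a b c d. Qed.

Lemma moebius_affine (l b : K) : moebius (mx22 l b 0 1) = option_map (fun z => l * z + b).
Proof.
apply/funext => -[z|]; rewrite /moebius !mxE /=; last by rewrite eqxx.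
by rewrite mul0r add0r oner_eq0 divr1.
Qed.

(** M and N agree at [x : y] when a quadratic form in (x, y) vanishes; the three
hypotheses say that its coefficients are 0. *)
Lemma moebius_quadratic M N : M \in unitmx -> N \in unitmx ->
  M 0 0 * N 1 0 - N 0 0 * M 1 0 = 0 ->
  M 0 0 * N 1 1 + M 0 1 * N 1 0 - N 0 0 * M 1 1 - N 0 1 * M 1 0 = 0 ->
  M 0 1 * N 1 1 - N 0 1 * M 1 1 = 0 -> moebius M = moebius N.
Proof.
move=> uM uN A B D; apply/funext => w; have [x [y [xy ->]]] := sphere_hom w.
rewrite !moebius_hom//; apply/hom_eq; rewrite ?nonzero2_moebius//.
apply/eqP; rewrite -subr_eq0; apply/eqP.
transitivity ((M 0 0 * N 1 0 - N 0 0 * M 1 0) * x ^+ 2 +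
   (M 0 0 * N 1 1 + M 0 1 * N 1 0 - N 0 0 * M 1 1 - N 0 1 * M 1 0) * x * y +
   (M 0 1 * N 1 1 - N 0 1 * M 1 1) * y ^+ 2); first by ring.
by rewrite A B D !mul0r !addr0.
Qed.

End Sphere.

(** * The Schwarzian derivative in the two charts of the sphere *)

Section Jets.
Variable R : realType.
Local Notation C := (Cplx R).

Lemma near_near (z : C) (P : C -> Prop) : (\forall w \near z, P w) ->
  \forall w \near z, \forall v \near w, P v.
Proof.
move=> /nbhsCP[d d0 H]; apply/nbhsCP; exists d => // w hw.
apply/nbhsCP; exists (d - cmod (w - z)); first by rewrite subr_gt0.
by move=> v hv; apply: H; have := cmod_triangle v w z; lra.
Qed.

Lemma near_at (z : C) (P : C -> Prop) : (\forall w \near z, P w) -> P z.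
Proof. exact: nbhs_singleton. Qed.

Lemma cont_near (g : C -> C) (z : C) (P : C -> Prop) : {for z, continuous g} ->
  (\forall w \near g z, P w) -> \forall w \near z, P (g w).
Proof.
move=> /contCP hg /nbhsCP[d d0 H]; apply/nbhsCP; have [s s0 hs] := hg d d0.
by exists s => // w /hs /H.
Qed.

Lemma neq0_near (x : C) : x != 0 -> \forall w \near x, w != 0.
Proof.
move=> x0; apply/nbhsCP; exists (cmod x); first by rewrite cmod_gt0.
move=> w; apply: contraTN => /eqP ->; rewrite sub0r cmodN ltxx //.
Qed.

Lemma cont_neq0 (g : C -> C) (z : C) : {for z, continuous g} -> g z != 0 ->
  \forall w \near z, g w != 0.
Proof. by move=> hg /neq0_near; exact: cont_near hg. Qed.

Definition jet (g g1 g2 g3 : C -> C) (z : C) : Prop :=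
  \forall w \near z, [/\ dC g w (g1 w), dC g1 w (g2 w) & dC g2 w (g3 w)].

Lemma jet_exists (g : C -> C) (z : C) : (\forall w \near z, derivable g w 1) ->
  exists g1 g2 g3, jet g g1 g2 g3 z.
Proof.
move=> /holomorphic_derivative [g1 h1].
have /holomorphic_derivative [g2 h2] : \forall w \near z, derivable g1 w 1.
  by apply: filterS h1 => w [].
have /holomorphic_derivative [g3 h3] : \forall w \near z, derivable g2 w 1.
  by apply: filterS h2 => w [].
exists g1, g2, g3; apply: filterS3 h1 h2 h3 => w [? _] [? _] [? _]; split => //.
Qed.

Definition schwarz_expr (a b c : C) : C := c / a - 3 / 2 * (b / a) ^+ 2.

Lemma schwarzian_val (g g1 g2 : C -> C) (z d : C) :
  (\forall w \near z, dC g w (g1 w)) -> (\forall w \near z, dC g1 w (g2 w)) ->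
  dC g2 z d -> derive1 g z = g1 z /\ schwarzian g z = schwarz_expr (g1 z) (g2 z) d.
Proof.
move=> h1 h2 h3.
have e1 : \forall w \near z, g1 w = derive1 g w.
  by apply: filterS h1 => w /dC_derive1.
have e2 : \forall w \near z, g2 w = derive1 (derive1 g) w.
  apply: filterS2 h2 (near_near e1) => w hw ew.
  by have /dC_derive1 := dC_near ew hw.
have e3 : derive1 (derive1 (derive1 g)) z = d.
  by have /dC_derive1 := dC_near e2 h3.
have E1 : derive1 g z = g1 z := esym (near_at e1).
have E2 : derive1 (derive1 g) z = g2 z := esym (near_at e2).
split; first exact: E1.
have -> : schwarzian g z = schwarz_expr (derive1 g z) (derive1 (derive1 g) z)
  (derive1 (derive1 (derive1 g)) z) by [].
have congr_expr (x x' y y' t t' : C) : x = x' -> y = y' -> t = t' ->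
  schwarz_expr x y t = schwarz_expr x' y' t' by move=> -> -> ->.
exact: (congr_expr _ _ _ _ _ _ E1 E2 e3).
Qed.

Lemma schwarzian_jet g g1 g2 g3 (z : C) : jet g g1 g2 g3 z ->
  derive1 g z = g1 z /\ schwarzian g z = schwarz_expr (g1 z) (g2 z) (g3 z).
Proof.
move=> H; apply: schwarzian_val; last by have [] := near_at H.
  by apply: filterS H => w [].
by apply: filterS H => w [].
Qed.

Lemma jet_near g h g1 g2 g3 (z : C) : (\forall w \near z, g w = h w) ->
  jet g g1 g2 g3 z -> jet h g1 g2 g3 z.
Proof.
move=> /near_near E; apply: filterS2 E => w Ew [h1 h2 h3]; split => //.
exact: dC_near h1.
Qed.

Lemma jet_inv g g1 g2 g3 (z : C) : jet g g1 g2 g3 z -> (\forall w \near z, g w != 0) ->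
  jet (fun w => (g w)^-1) (fun w => - g1 w / g w ^+ 2)
    (fun w => - g2 w / g w ^+ 2 + 2 * g1 w ^+ 2 / g w ^+ 3)
    (fun w => - g3 w / g w ^+ 2 + 6 * g1 w * g2 w / g w ^+ 3 - 6 * g1 w ^+ 3 / g w ^+ 4) z.
Proof.
apply: filterS2 => w [h1 h2 h3] g0.
have p2 : g w ^+ 2 != 0 by rewrite expf_neq0.
have p3 : g w ^+ 3 != 0 by rewrite expf_neq0.
split; first exact: dCV g0 h1.
  apply: dC_eq (@dC_div R (fun w => - g1 w) (fun w => g w ^+ 2) w _ _ p2 (dCN h2) (dCX 2 h1)).
  by field.
apply: dC_eq (dCD (@dC_div R (fun w => - g2 w) (fun w => g w ^+ 2) w _ _ p2 (dCN h3) (dCX 2 h1))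
  (@dC_div R (fun w => 2 * g1 w ^+ 2) (fun w => g w ^+ 3) w _ _ p3 (dCMl 2 (dCX 2 h2)) (dCX 3 h1))).
by field.
Qed.

(** The chart g may vary from point to point; [schwarz_jet] removes this
freedom. *)
Definition schwarz_at (phi : C -> C) (f : C -> sphere C) (z : C) : Prop :=
  exists g : C -> C,
    [/\ (\forall w \near z, derivable g w 1), derive1 g z != 0,
        schwarzian g z = phi z
      & (\forall w \near z, f w = Some (g w)) \/
        (\forall w \near z, f w = sphere_inv (Some (g w)))].

(** Two charts for f at the same point are equal or inverse to each other, and
S_g = S_(1/g); hence the chart g chosen at z works at all points near z. *)
Lemma schwarz_jet (phi : C -> C) (f : C -> sphere C) (z : C) :
  (\forall w \near z, schwarz_at phi f w) ->
  exists g g1 g2 g3 : C -> C,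
    [/\ jet g g1 g2 g3 z,
        (\forall w \near z, g1 w != 0),
        (\forall w \near z, schwarz_expr (g1 w) (g2 w) (g3 w) = phi w)
      & (\forall w \near z, f w = Some (g w)) \/
        (\forall w \near z, f w = sphere_inv (Some (g w)))].
Proof.
move=> H; have [g [dg g0 _ fg]] := near_at H.
have [g1 [g2 [g3 J]]] := jet_exists dg.
have g10 : g1 z != 0 by have [<- _] := schwarzian_jet J.
have c1 : {for z, continuous g1} by have [_ h _] := near_at J; exact: dC_cont h.
exists g, g1, g2, g3; split => //; first exact: cont_neq0.
have fg' : \forall w \near z, (\forall v \near w, f v = Some (g v)) \/
    (\forall v \near w, f v = sphere_inv (Some (g v))).
  case: fg => /near_near E; first by apply: filterS E => w; left.
  by apply: filterS E => w; right.
apply: filterS3 H fg' (near_near J) => w [k [dk k0 Sk fk]] fgw Jw.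
have [k1 [k2 [k3 Jk]]] := jet_exists dk.
have [Dk Vk] := schwarzian_jet Jk.
have [_ <-] := schwarzian_jet Jw; rewrite -Sk.
have same : (\forall v \near w, k v = g v) -> schwarzian g w = schwarzian k w.
  by move=> E; have [_ ->] := schwarzian_jet (jet_near E Jk); rewrite Vk.
have inv : (\forall v \near w, k v != 0 /\ (k v)^-1 = g v) -> schwarzian g w = schwarzian k w.
  move=> E; have E0 : \forall v \near w, k v != 0 by apply: filterS E => v [].
  have E1 : \forall v \near w, (k v)^-1 = g v by apply: filterS E => v [].
  have [_ ->] := schwarzian_jet (jet_near E1 (jet_inv Jk E0)).
  have kw := near_at E0; rewrite Vk /schwarz_expr; field.
  by rewrite -Dk k0 kw.
case: fgw => fgw; case: fk => fkw.
- apply: same; apply: filterS2 fgw fkw => v E1 E2.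
  by have := etrans (esym E2) E1; case.
- apply: inv; apply: filterS2 fgw fkw => v E1 E2.
  exact: Some_sphere_inv (etrans (esym E1) E2).
- apply: inv; apply: filterS2 fgw fkw => v E1 E2.
  exact: sphere_inv_Some (etrans (esym E1) E2).
apply: same; apply: filterS2 fgw fkw => v E1 E2.
exact: sphere_inv_inj (etrans (esym E1) E2).
Qed.

End Jets.

(** * Local solutions of the Schwarzian equation *)

Section LinearODE.
Variable R : realType.
Local Notation C := (Cplx R).

(** On a small disk a bound b for |D| improves to b / 2, by the mean value
inequality; hence all the bounds 1 / 2 ^+ n hold. *)
Lemma linear_ode1_zero (D E : C -> C) (z : C) :
  (\forall w \near z, dC D w (E w * D w)) -> {for z, continuous E} -> D z = 0 ->
  \forall w \near z, D w = 0.
Proof.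
move=> hD hE D0.
pose K := cmod (E z) + 1; have K0 : 0 < K by rewrite /K; have := cmod_ge0 (E z); lra.
have [d1 d10 H1] := (nbhsCP _ _).1 hD.
have [d2 d20 H2] := (contCP _ _).1 hE 1 ltr01.
have [d3 d30 H3] := (contCP _ _).1 (dC_cont (near_at hD)) 1 ltr01.
pose d := Num.min (Num.min d1 d2) (Num.min d3 (1 / (4 * K))).
have d0 : 0 < d by rewrite !lt_min d10 d20 d30 divr_gt0 ?mulr_gt0.
have [L1 L2 L3 L4] : [/\ d <= d1, d <= d2, d <= d3 & d * (4 * K) <= 1].
  split; try by rewrite !ge_min lexx ?orbT.
  by rewrite -ler_pdivlMr ?mulr_gt0// !ge_min lexx !orbT.
have bE w : cmod (w - z) < d -> cmod (E w) <= K.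
  move=> hw; have := H2 w (lt_le_trans hw L2); have := cmod_sub_ge (E w) (E z).
  by rewrite /K; lra.
have main n w : cmod (w - z) < d -> cmod (D w) <= 1 * (1 / 2) ^+ n.
  elim: n w => [|n IH] w hw.
    have := H3 w (lt_le_trans hw L3); rewrite D0 subr0 expr0 mulr1.
    exact: ltW.
  have seg (t : R) : 0 <= t <= 1 -> cmod (z + ofR t * (w - z) - z) < d.
    move=> /andP[t0 t1]; rewrite addrC addKr cmodM cmod_ofR ger0_norm//.
    by apply: le_lt_trans hw; rewrite ler_piMl// cmod_ge0.
  have := @mean_value R D (fun v => E v * D v) z (w - z) (K * (1 / 2) ^+ n).
  rewrite D0 subr0 subrKC => MV.
  have {MV} : cmod (D w) <= 2 * (K * (1 / 2) ^+ n * cmod (w - z)).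
    apply: MV => t ht; first by apply: H1; exact: lt_le_trans (seg t ht) L1.
    rewrite cmodM; apply: ler_pM; rewrite ?cmod_ge0//; first by apply: bE; exact: seg.
    by have := IH _ (seg t ht); rewrite mul1r.
  rewrite exprS => h; apply: le_trans h _.
  have q0 : 0 <= (1 / 2 : R) ^+ n by rewrite exprn_ge0//; lra.
  have : (K * cmod (w - z)) * (1 / 2) ^+ n <= (1 / 4) * (1 / 2) ^+ n.
    by rewrite ler_wpM2r//; have : K * cmod (w - z) <= K * d; [rewrite ler_wpM2l// ltW|lra].
  by move: ((1 / 2) ^+ n) (cmod (w - z)) => q x; lra.
apply/nbhsCP; exists d => // w hw; apply/eqP; rewrite -cmod_eq0 eq_le cmod_ge0 andbT.
apply/ler_addgt0Pr => e e0; rewrite add0r.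
have h : 0 <= (1 / 2 : R) < 1 by lra.
have [N hN] := geo_lim0 1 h e0.
by apply: le_trans (main N w hw) _; exact: ltW (hN N (leqnn N)).
Qed.

Variables (Qc : nat -> C) (r : R) (delta beta : C) (u1 u1' u2 u2' : C -> C) (w0 : C).
Hypothesis B : basis_data Qc r delta beta u1 u1' u2 u2' w0.
Variable phi : C -> C.
Hypothesis phiQ : forall w, 0 < cmod w < r -> w ^+ 2 * phi w = 1 / 2 - 2 * PS Qc w.
Local Notation Q z := (PS Qc (cexp z)).
Local Notation inH z := (cmod (cexp z) < r).

Lemma half_plane_near (z : C) : inH z -> \forall v \near z, inH v.
Proof.
move=> zr; apply: (@cont_near R (@cexp R) z (fun w => cmod w < r) (dC_cont (dC_cexp z))).
apply/nbhsCP.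
exists (r - cmod (cexp z)); first by rewrite subr_gt0.
by move=> v hv; have := cmod_sub_ge v (cexp z); lra.
Qed.

(** The developing map of the projective structure, on the half-plane. *)
Definition Phi (z : C) : sphere C := hom (u2 z) (u1 z).

Lemma w0_neq0 : w0 != 0. Proof. by case: B. Qed.
Lemma wronskianE z : inH z -> u1 z * u2' z - u1' z * u2 z = w0.
Proof. by case: B => _ _ _ H _; exact: H. Qed.
Lemma u1_sol z : inH z -> dC u1 z (u1' z) /\ dC u1' z (Q z * u1 z).
Proof. by case: B => H _ _ _ _; exact: H. Qed.
Lemma u2_sol z : inH z -> dC u2 z (u2' z) /\ dC u2' z (Q z * u2 z).
Proof. by case: B => _ H _ _ _; exact: H. Qed.

Lemma Phi_nonzero z : inH z -> nonzero2 (u2 z) (u1 z).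
Proof.
move=> zr; apply: contraTT w0_neq0; rewrite /nonzero2 negb_or !negbK => /andP[/eqP e2 /eqP e1].
by rewrite -(wronskianE zr) e1 e2 mul0r mulr0 subrr.
Qed.

Definition lin (a b : C) (z : C) : C := a * u2 z + b * u1 z.
Definition lin' (a b : C) (z : C) : C := a * u2' z + b * u1' z.

Lemma lin_sol a b z : inH z -> dC (lin a b) z (lin' a b z) /\
  dC (lin' a b) z (Q z * lin a b z).
Proof.
move=> zr; have [d1 d1'] := u1_sol zr; have [d2 d2'] := u2_sol zr.
split; first exact: dCD (dCMl a d2) (dCMl b d1).
by apply: dC_eq (dCD (dCMl a d2') (dCMl b d1')); rewrite /lin; ring.
Qed.

Lemma lin_wronskian a b c d z : inH z ->
  lin c d z * lin' a b z - lin' c d z * lin a b z = (a * d - b * c) * w0.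
Proof. by move=> zr; rewrite -(wronskianE zr) /lin /lin'; ring. Qed.

Lemma moebius_Phi M z : inH z ->
  moebius M (Phi z) = hom (lin (M 0 0) (M 0 1) z) (lin (M 1 0) (M 1 1) z).
Proof. by move=> zr; rewrite /Phi moebius_hom ?Phi_nonzero. Qed.

(** As u'' = Q u, the vanishing of the form and of its first two derivatives at
z is a linear system for (a, b, c) whose matrix is essentially the symmetric
square of the Wronskian matrix, hence invertible. *)
Lemma quadratic_vanish (a b c : C) z : inH z ->
  (\forall v \near z, a * u2 v ^+ 2 + b * (u1 v * u2 v) + c * u1 v ^+ 2 = 0) ->
  [/\ a = 0, b = 0 & c = 0].
Proof.
move=> zr H.
pose q v := a * u2 v ^+ 2 + b * (u1 v * u2 v) + c * u1 v ^+ 2.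
pose q' v := a * (2 * u2 v * u2' v) + b * (u1' v * u2 v + u1 v * u2' v) + c * (2 * u1 v * u1' v).
have dq v : inH v -> dC q v (q' v).
  move=> vr; have [d1 d1'] := u1_sol vr; have [d2 d2'] := u2_sol vr.
  apply: dC_eq (dCD (dCD (dCMl a (dCX 2 d2)) (dCMl b (dCM d1 d2))) (dCMl c (dCX 2 d1))).
  by rewrite /q' /= !expr1.
have H' : \forall v \near z, q' v = 0.
  apply: filterS2 (near_near H) (half_plane_near zr) => v Hv vr.
  apply: dC_uniq (dq v vr) _; apply: (@dC_near R (fun=> 0)); last exact: dC_cst.
  by apply: filterS Hv => t ht; rewrite /q ht.
have dq' : dC q' z (a * (2 * (u2' z ^+ 2 + Q z * u2 z ^+ 2)) +
    b * (2 * (u1' z * u2' z) + 2 * Q z * (u1 z * u2 z)) +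
    c * (2 * (u1' z ^+ 2 + Q z * u1 z ^+ 2))).
  have [d1 d1'] := u1_sol zr; have [d2 d2'] := u2_sol zr.
  apply: dC_eq (dCD (dCD (dCMl a (dCM (dCMl 2 d2) d2'))
    (dCMl b (dCD (dCM d1' d2) (dCM d1 d2')))) (dCMl c (dCM (dCMl 2 d1) d1'))).
  by ring.
have E0 := near_at H; have E1 := near_at H'.
have E2 : a * (2 * (u2' z ^+ 2 + Q z * u2 z ^+ 2)) +
    b * (2 * (u1' z * u2' z) + 2 * Q z * (u1 z * u2 z)) +
    c * (2 * (u1' z ^+ 2 + Q z * u1 z ^+ 2)) = 0.
  apply: dC_uniq dq' _; apply: (@dC_near R (fun=> 0)); last exact: dC_cst.
  by apply: filterS H' => t ht; rewrite ht.
have E3 : a * u2' z ^+ 2 + b * (u1' z * u2' z) + c * u1' z ^+ 2 = 0.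
  have -> : 0 = (0 - 2 * Q z * 0) / 2 :> C by rewrite mulr0 subrr mul0r.
  by rewrite -{1}E2 -E0; field.
have Ew := wronskianE zr; have w20 : w0 ^+ 2 != 0 by rewrite expf_neq0// w0_neq0.
move: E0 E1 E3; rewrite /q'; move: (u1 z) (u1' z) (u2 z) (u2' z) Ew => x x' y y' Ew E0 E1 E3.
have a0 : a = 0.
  apply: (mulfI w20); rewrite mulr0 -Ew.
  transitivity (x' ^+ 2 * (a * y ^+ 2 + b * (x * y) + c * x ^+ 2) -
    x * x' * (a * (2 * y * y') + b * (x' * y + x * y') + c * (2 * x * x')) +
    x ^+ 2 * (a * y' ^+ 2 + b * (x' * y') + c * x' ^+ 2)); first by ring.
  by rewrite E0 E1 E3 !mulr0 subrr addr0.
have c0 : c = 0.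
  apply: (mulfI w20); rewrite mulr0 -Ew.
  transitivity (y' ^+ 2 * (a * y ^+ 2 + b * (x * y) + c * x ^+ 2) -
    y * y' * (a * (2 * y * y') + b * (x' * y + x * y') + c * (2 * x * x')) +
    y ^+ 2 * (a * y' ^+ 2 + b * (x' * y') + c * x' ^+ 2)); first by ring.
  by rewrite E0 E1 E3 !mulr0 subrr addr0.
split => //; apply: (mulfI w20); rewrite mulr0 -Ew.
move: E0 E1 E3; rewrite a0 c0 !mul0r !addr0 !add0r => E0 E1 E3.
transitivity ((b * (x' * y + x * y')) * (x' * y + x * y') - 4 * (b * (x * y)) * (x' * y')).
  by ring.
by rewrite E0 E1 mulr0 !mul0r subrr.
Qed.

(** M and N agree along Phi when a quadratic form vanishes along (u2, u1). *)
Lemma moebius_uniq M N z : M \in unitmx -> N \in unitmx -> inH z ->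
  (\forall v \near z, moebius M (Phi v) = moebius N (Phi v)) ->
  moebius M = moebius N.
Proof.
move=> uM uN zr H.
have := @quadratic_vanish (M 0 0 * N 1 0 - N 0 0 * M 1 0)
  (M 0 0 * N 1 1 + M 0 1 * N 1 0 - N 0 0 * M 1 1 - N 0 1 * M 1 0)
  (M 0 1 * N 1 1 - N 0 1 * M 1 1) z zr.
case; last by move=> *; exact: moebius_quadratic.
apply: filterS2 H (half_plane_near zr) => v Hv vr.
have nz := Phi_nonzero vr.
move: Hv; rewrite !moebius_Phi// => /(hom_eq (nonzero2_moebius uM nz) (nonzero2_moebius uN nz)).
by rewrite /lin => /eqP; rewrite -subr_eq0 => /eqP E; rewrite -[RHS]E; ring.
Qed.

(** For a chart g of f, let k = g o exp and N = k'' / k'.  The Schwarzian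
equation reads N' = N^2 / 2 - 2 Q.  Let p solve p'' = Q p with p' = - N p / 2 at
z.  Then D = p' + N p / 2 satisfies D' = N D / 2 and D(z) = 0, so D = 0 near z.
This in turn shows that k p solves the same linear equation as p, and
k = (k p) / p is a quotient of two combinations of u1 and u2. *)
Lemma schwarz_local (f : C -> sphere C) z : inH z ->
  (\forall v \near cexp z, schwarz_at phi f v) ->
  exists2 M : 'M[C]_2, M \in unitmx &
    \forall v \near z, f (cexp v) = moebius M (Phi v).
Proof.
move=> zr /schwarz_jet [g [g1 [g2 [g3 [J g10 gS fg]]]]].
have cz := dC_cont (dC_cexp z).
have J' := cont_near cz J; have g10' := cont_near cz g10; have gS' := cont_near cz gS.
have Hz := half_plane_near zr.
pose k v := g (cexp v).
pose k1 v := g1 (cexp v) * cexp v.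
pose N v := g2 (cexp v) / g1 (cexp v) * cexp v + 1.
pose N' v := (g3 (cexp v) * g1 (cexp v) - g2 (cexp v) * g2 (cexp v)) / g1 (cexp v) ^+ 2
  * cexp v * cexp v + g2 (cexp v) / g1 (cexp v) * cexp v.
have dk : \forall v \near z, dC k v (k1 v).
  by apply: filterS J' => v [h _ _]; exact: dC_comp (dC_cexp v) h.
have dk1 : \forall v \near z, dC k1 v (k1 v * N v).
  apply: filterS2 J' g10' => v [_ h _] v0.
  apply: dC_eq (dCM (dC_comp (dC_cexp v) h) (dC_cexp v)).
  by rewrite /k1 /N; field.
have dN : \forall v \near z, dC N v (N' v).
  apply: filterS2 J' g10' => v [_ h1 h2] v0.
  have D := @dC_div R (fun v => g2 (cexp v)) (fun v => g1 (cexp v)) v _ _ v0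
    (dC_comp (dC_cexp v) h2) (dC_comp (dC_cexp v) h1).
  apply: dC_eq (dCD (dCM D (dC_cexp v)) (dC_cst 1 v)).
  by rewrite /N'; field.
have N'E : \forall v \near z, N' v = N v ^+ 2 / 2 - 2 * Q v.
  apply: filterS3 Hz g10' gS' => v vr v0 Sv.
  have e0 := cexp_neq0 v.
  have hv : 0 < cmod (cexp v) < r by rewrite vr cmod_gt0 e0.
  have -> : 2 * Q v = 1 / 2 - cexp v ^+ 2 * phi (cexp v) by rewrite phiQ//; ring.
  by rewrite -Sv /N' /N /schwarz_expr; field.
pose m := - N z / 2.
have w0n := w0_neq0.
(* Cramer's rule for the solution p with p z = 1 and p' z = m *)
pose pa := (u1 z * m - u1' z) / w0; pose pb := (u2' z - m * u2 z) / w0.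
have pz : lin pa pb z = 1.
  transitivity ((u1 z * u2' z - u1' z * u2 z) / w0); last by rewrite wronskianE// divff.
  by rewrite /lin /pa /pb; ring.
have p'z : lin' pa pb z = m.
  transitivity (m * (u1 z * u2' z - u1' z * u2 z) / w0); last by rewrite wronskianE// mulfK.
  by rewrite /lin' /pa /pb; ring.
pose p := lin pa pb; pose p' := lin' pa pb.
have dp : \forall v \near z, dC p v (p' v) /\ dC p' v (Q v * p v).
  by apply: filterS Hz => v vr; exact: lin_sol.
pose D v := p' v + 1 / 2 * (N v * p v).
have D0 : \forall v \near z, D v = 0.
  apply: (@linear_ode1_zero D (fun v => 1 / 2 * N v)).
  - apply: filterS3 dp dN N'E => v [h1 h2] h3 h4.
    apply: dC_eq (dCD h2 (dCMl (1 / 2) (dCM h3 h1))).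
    by rewrite h4 /D; field.
  - by apply: dC_cont; exact: dCMl (near_at dN).
  by rewrite /D /p /p' pz p'z /m; field.
pose s v := k v * p v.
pose s1 v := k1 v * p v + k v * p' v.
have ds : \forall v \near z, dC s v (s1 v).
  by apply: filterS2 dk dp => v h1 [h2 _]; exact: dCM h1 h2.
have ds1 : \forall v \near z, dC s1 v (Q v * s v).
  have dd : \forall v \near z, dC k v (k1 v) /\ dC k1 v (k1 v * N v).
    by apply: filterS2 dk dk1.
  apply: filterS3 dd dp D0 => v [h1 h2] [h3 h4] h5.
  apply: dC_eq (dCD (dCM h2 h3) (dCM h1 h4)).
  transitivity (Q v * s v + 2 * k1 v * D v); last by rewrite h5 mulr0 addr0.
  by rewrite /D /s; field.
pose al v := (u1 v * s1 v - u1' v * s v) / w0.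
pose be v := (s v * u2' v - s1 v * u2 v) / w0.
have alc : \forall v \near z, al v = al z.
  apply: dC0_near; apply: filterS3 Hz ds ds1 => v vr h1 h2.
  have [d1 d1'] := u1_sol vr.
  apply: dC_eq (dCM (dCB (dCM d1 h2) (dCM d1' h1)) (dC_cst w0^-1 v)).
  by ring.
have bec : \forall v \near z, be v = be z.
  apply: dC0_near; apply: filterS3 Hz ds ds1 => v vr h1 h2.
  have [d2 d2'] := u2_sol vr.
  apply: dC_eq (dCM (dCB (dCM h1 d2') (dCM h2 d2)) (dC_cst w0^-1 v)).
  by ring.
have sE : \forall v \near z, s v = lin (al z) (be z) v.
  apply: filterS3 Hz alc bec => v vr <- <-.
  transitivity (s v * (u1 v * u2' v - u1' v * u2 v) / w0); first by rewrite wronskianE// mulfK.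
  by rewrite /lin /al /be; ring.
have s1z : s1 z = lin' (al z) (be z) z.
  transitivity (s1 z * (u1 z * u2' z - u1' z * u2 z) / w0); first by rewrite wronskianE// mulfK.
  by rewrite /lin' /al /be; ring.
have det0 : al z * pb - be z * pa != 0.
  have : (al z * pb - be z * pa) * w0 != 0.
    rewrite -(lin_wronskian _ _ _ _ zr) -s1z -(near_at sE) -/(p z) -/(p' z).
    have -> : p z * s1 z - p' z * s z = k1 z * p z ^+ 2 by rewrite /s1 /s; ring.
    rewrite /p pz expr1n mulr1 /k1 mulf_neq0 ?cexp_neq0//.
    exact: (near_at g10').
  by rewrite mulf_eq0 negb_or => /andP[].
have p0 : \forall v \near z, p v != 0.
  apply: cont_neq0; first by have [h _] := near_at dp; exact: dC_cont h.
  by rewrite /p pz oner_neq0.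
have kE : \forall v \near z, nonzero2 (s v) (p v) /\ Some (k v) = hom (s v) (p v).
  apply: filterS p0 => v pv; rewrite /nonzero2 pv orbT /hom (negbTE pv); split => //.
  by rewrite /s mulfK.
have key : \forall v \near z, [/\ nonzero2 (s v) (p v), Some (k v) = hom (s v) (p v),
    s v = lin (al z) (be z) v & inH v].
  by apply: filterS3 kE sE Hz => v [? ?] ? ?; split.
case: fg => /(cont_near cz) fg.
  exists (mx22 (al z) (be z) pa pb); first by rewrite mx22_unit.
  apply: filterS2 key fg => v [_ h1 h3 vr] h2; rewrite moebius_Phi//.
  have [-> -> -> ->] := mx22E (al z) (be z) pa pb.
  exact: etrans h2 (etrans h1 (congr1 (fun t => hom t (p v)) h3)).
exists (mx22 pa pb (al z) (be z)).
  rewrite mx22_unit; have -> : pa * be z - pb * al z = - (al z * pb - be z * pa) by ring.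
  by rewrite oppr_eq0.
apply: filterS2 key fg => v [nz h1 h3 vr] h2; rewrite moebius_Phi//.
have [-> -> -> ->] := mx22E pa pb (al z) (be z).
have h4 : sphere_inv (Some (k v)) = hom (p v) (s v) by rewrite h1 sphere_inv_hom.
exact: etrans h2 (etrans h4 (congr1 (fun t => hom (p v) t) h3)).
Qed.

End LinearODE.

(** * Branches of the logarithm *)

Section LocalLog.
Variable R : realType.
Local Notation C := (Cplx R).

Definition log_coef (n : nat) : C := if n is k.+1 then (-1) ^+ k / k.+1%:R else 0.

Lemma radius_sign : radius_ge (fun n => (-1) ^+ n : C) 1.
Proof.
move=> s /andP[s0 s1]; exists 1 => n.
by rewrite cmodX cmodN cmod1 expr1n mul1r exprn_ile1// ltW.
Qed.

Lemma radius_log : radius_ge log_coef 1.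
Proof.
move=> s /andP[s0 s1]; exists 1 => -[|n]; first by rewrite cmod0 mul0r.
have sn : 0 <= s ^+ n.+1 <= 1 by rewrite exprn_ge0 ?exprn_ile1// ltW.
case/andP: sn => sn0 sn1.
rewrite /log_coef cmodM cmodX cmodN cmod1 expr1n mul1r cmodV cmod_nat.
by rewrite mulrC ler_pdivrMr// (le_trans sn1)// mul1r ler1n.
Qed.

Lemma dC_log x : cmod x < 1 -> dC (PS log_coef) x (1 + x)^-1.
Proof.
move=> x1; apply: dC_eq (dC_PS radius_log x1).
have -> : (fun n => n.+1%:R * log_coef n.+1) = (fun n => (-1) ^+ n).
  by apply/funext => n; rewrite /log_coef mulrC divfK// pnatr_eq0.
have nz : 1 + x != 0.
  rewrite addrC addr_eq0; apply: contraTneq x1 => ->.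
  by rewrite cmodN cmod1 ltxx.
apply: (mulIf nz); rewrite mulVf//.
have := PS_recl radius_sign x1; rewrite expr0.
have -> : (fun n => (-1) ^+ n.+1) = (fun n => -1 * (-1) ^+ n) :> (nat -> C).
  by apply/funext => n; rewrite exprS.
rewrite (PS_scale (-1) radius_sign x1) => E.
by rewrite mulrDr mulr1 {1}E; ring.
Qed.

(** L is z0 + log(1 + (w - c) / c) with c = exp z0, and exp(L w) / w has
derivative 0.  The bound on L w - z0 serves to compare branches: two branches
that differ by less than 2 pi are equal. *)
Lemma local_log (z0 : C) : exists (L : C -> C) (rho : R),
  [/\ 0 < rho, L (cexp z0) = z0 &
   forall w, cmod (w - cexp z0) < rho ->
     [/\ dC L w (w^-1), cexp (L w) = w & cmod (L w - z0) < 1]].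
Proof.
set c := cexp z0; have c0 : c != 0 := cexp_neq0 z0.
have nc : 0 < cmod c by rewrite cmod_gt0.
pose L w := z0 + PS log_coef ((w - c) / c).
have Lc : L c = z0 by rewrite /L subrr mul0r PS0 addr0.
have arg w : cmod (w - c) < cmod c -> cmod ((w - c) / c) < 1.
  by move=> hw; rewrite [cmod ((w - c) / c)]cmodM cmodV ltr_pdivrMr// mul1r.
have dL w : cmod (w - c) < cmod c -> dC L w (w^-1) /\ w != 0.
  move=> hw; have w0 : w != 0.
    by apply: contraTneq hw => ->; rewrite sub0r cmodN ltxx.
  split => //.
  have da : dC (fun w => (w - c) / c) w c^-1.
    apply: dC_eq (dCM (dCB (dC_id w) (dC_cst c w)) (dC_cst c^-1 w)).
    by rewrite subr0 mul1r mulr0 addr0.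
  apply: dC_eq (dCD (dC_cst z0 w) (dC_comp da (dC_log (arg w hw)))).
  have -> : 1 + (w - c) / c = w / c by field.
  by rewrite add0r invf_div; field; rewrite c0 w0.
have eL w : cmod (w - c) < cmod c -> cexp (L w) = w.
  move=> hw; have [_ w0] := dL w hw.
  pose f v := cexp (L v) / v.
  have : f w = f c.
    rewrite -[w](subrKC c); apply: dC0_segment => t /andP[t0 t1].
    have /dL [d1 v0] : cmod (c + ofR t * (w - c) - c) < cmod c.
      rewrite addrC addKr cmodM cmod_ofR ger0_norm//.
      by apply: le_lt_trans hw; rewrite ler_piMl// cmod_ge0.
    apply: dC_eq (@dC_div R (fun v => cexp (L v)) (fun v => v) _ _ _ v0 (dC_comp d1 (dC_cexp _)) (dC_id _)).
    by field.
  rewrite /f Lc divff// => /eqP; rewrite -subr_eq0 -(mulfV w0) -mulrBl mulf_eq0.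
  by rewrite invr_eq0 (negbTE w0) orbF subr_eq0 => /eqP.
have cL : {for c, continuous L}.
  by have [|h _] := dL c; [rewrite subrr cmod0|exact: dC_cont h].
have [d d0 hd] := (contCP _ _).1 cL 1 ltr01.
exists L, (Num.min d (cmod c)); split; [by rewrite lt_min d0|exact: Lc|].
move=> w; rewrite lt_min => /andP[h1 h2]; split; [by case: (dL w h2)|exact: eL|].
by rewrite -Lc; exact: hd.
Qed.

End LocalLog.

(** * Continuation along paths *)

Section Connected.
Variable R : realType.

Lemma unit_interval_connected (P : R -> Prop) :
  (forall t, 0 <= t <= 1 -> exists2 d : R, 0 < d &
     forall s, 0 <= s <= 1 -> `|s - t| < d -> (P s <-> P t)) ->
  P 0 -> P 1.
Proof.
move=> H P0.
pose S := [set t : R | 0 <= t <= 1 /\ P t].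
have S0 : S 0 by split; rewrite // lexx ler01.
have hS : has_sup S by split; [exists 0|exists 1 => t [/andP[]]].
pose c := sup S.
have c01 : 0 <= c <= 1.
  apply/andP; split; first exact: sup_upper_bound.
  by apply: ge_sup; [exists 0|move=> t [/andP[]]].
have [d d0 hd] := H c c01.
have [t [t01 Pt] tc] := sup_adherent d0 hS.
have tle : t <= c by apply: sup_upper_bound => //; split.
have Pc : P c.
  by apply/(hd t t01) => //; rewrite ler0_norm ?subr_le0// -/c in tc *; lra.
have [c1|c1] := ltP c 1; last first.
  by have <- : c = 1 by apply/eqP; rewrite eq_le c1; case/andP: c01 => _ ->.
pose s := Num.min 1 (c + d / 2).
have sc : c < s by rewrite lt_min c1 /=; lra.
have sd : s <= c + d / 2 by rewrite ge_min lexx orbT.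
have s01 : 0 <= s <= 1.
  by rewrite ge_min lexx /= andbT; case/andP: c01 => c0 _; lra.
have Ps : P s by apply/(hd s s01) => //; rewrite gtr0_norm; lra.
have : s <= c by apply: sup_upper_bound => //; split.
by lra.
Qed.

End Connected.

Section Holonomy.
Variable R : realType.
Local Notation C := (Cplx R).
Variables (Qc : nat -> C) (r : R) (delta beta : C) (u1 u1' u2 u2' : C -> C) (w0 : C).
Hypothesis B : basis_data Qc r delta beta u1 u1' u2 u2' w0.
Variable phi : C -> C.
Hypothesis phiQ : forall w, 0 < cmod w < r -> w ^+ 2 * phi w = 1 / 2 - 2 * PS Qc w.
Local Notation Q z := (PS Qc (cexp z)).
Local Notation inH z := (cmod (cexp z) < r).
Local Notation Phi := (Phi u1 u2).

(** The converse of [schwarz_local] in one chart: as the Wronskian k of s and p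
is constant, s / p composed with the logarithm l has derivative k / (w p^2). *)
Lemma schwarz_quotient (s s1 p p1 : C -> C) (k : C) (l : C -> C) (z : C) :
  (forall v, inH v -> dC s v (s1 v)) ->
  (forall v, inH v -> dC p v (p1 v) /\ dC p1 v (Q v * p v)) ->
  (forall v, inH v -> p v * s1 v - p1 v * s v = k) -> k != 0 ->
  (\forall w \near z, [/\ dC l w (w^-1), cexp (l w) = w & w != 0 /\ cmod w < r]) ->
  p (l z) != 0 ->
  [/\ (\forall w \near z, derivable (fun w => s (l w) / p (l w)) w 1),
      derive1 (fun w => s (l w) / p (l w)) z != 0 &
      schwarzian (fun w => s (l w) / p (l w)) z = phi z].
Proof.
move=> hs hp hk k0 hl pz.
have [lz ez [z0 zr]] := near_at hl.
have pn : \forall w \near z, p (l w) != 0.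
  apply: (@cont_neq0 R (fun w => p (l w))) => //.
  have [|h _] := hp (l z); first by rewrite ez.
  exact: dC_cont (dC_comp lz h).
pose g1 w := k / (w * p (l w) ^+ 2).
pose g2 w := - k * (p (l w) + 2 * p1 (l w)) / (w ^+ 2 * p (l w) ^+ 3).
have dpl w : dC l w (w^-1) -> cexp (l w) = w -> cmod w < r ->
   dC (fun w => p (l w)) w (p1 (l w) / w).
  move=> h1 h2 h3; have [|h _] := hp (l w); first by rewrite h2.
  exact: dC_comp h1 h.
have dp1l w : dC l w (w^-1) -> cexp (l w) = w -> cmod w < r ->
   dC (fun w => p1 (l w)) w (PS Qc w * p (l w) / w).
  move=> h1 h2 h3; have [|_ h] := hp (l w); first by rewrite h2.
  by rewrite -[X in PS Qc X]h2; exact: dC_comp h1 h.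
have D1 : \forall w \near z, dC (fun w => s (l w) / p (l w)) w (g1 w).
  apply: filterS2 hl pn => w [h1 h2 [w0' wr]] pw.
  have inw : inH (l w) by rewrite h2.
  have ds := dC_comp h1 (hs (l w) inw).
  apply: dC_eq (@dC_div R (fun w => s (l w)) (fun w => p (l w)) w _ _ pw ds (dpl w h1 h2 wr)).
  by rewrite /g1 -(hk (l w) inw); field; rewrite pw w0'.
have D2 : \forall w \near z, dC g1 w (g2 w).
  apply: filterS2 hl pn => w [h1 h2 [w0' wr]] pw.
  have nz : w * p (l w) ^+ 2 != 0 by rewrite mulf_neq0// expf_neq0.
  have den : dC (fun w => w * p (l w) ^+ 2) w (p (l w) ^+ 2 + 2 * p (l w) * p1 (l w)).
    apply: dC_eq (dCM (dC_id w) (dCX 2 (dpl w h1 h2 wr))).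
    by rewrite /=; field.
  apply: dC_eq (@dC_div R (fun=> k) (fun w => w * p (l w) ^+ 2) w _ _ nz (dC_cst k w) den).
  by rewrite /g2; field; rewrite pw w0'.
have nz3 : z ^+ 2 * p (l z) ^+ 3 != 0 by rewrite mulf_neq0// expf_neq0.
have num : dC (fun w => - k * (p (l w) + 2 * p1 (l w))) z
    (- k * (p1 (l z) / z + 2 * (PS Qc z * p (l z) / z))).
  exact: dCMl (dCD (dpl z lz ez zr) (dCMl 2 (dp1l z lz ez zr))).
have den3 : dC (fun w => w ^+ 2 * p (l w) ^+ 3) z
    (2 * z * p (l z) ^+ 3 + 3 * z * p (l z) ^+ 2 * p1 (l z)).
  apply: dC_eq (dCM (dCX 2 (dC_id z)) (dCX 3 (dpl z lz ez zr))).
  by rewrite /=; field.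
have D3 := @dC_div R (fun w => - k * (p (l w) + 2 * p1 (l w)))
  (fun w => w ^+ 2 * p (l w) ^+ 3) z _ _ nz3 num den3.
have [E1 E2] := schwarzian_val D1 D2 D3.
split; first by apply: filterS D1 => w; exact: dC_ex.
  by rewrite E1 /g1 mulf_neq0// invr_neq0// mulf_neq0// expf_neq0.
have hz : 0 < cmod z < r by rewrite zr cmod_gt0 z0.
have -> : phi z = (1 / 2 - 2 * PS Qc z) / z ^+ 2 by rewrite -phiQ//; field.
by rewrite E2 /schwarz_expr /g1 /g2; field; rewrite pz z0 k0.
Qed.

(** Numerator and denominator of M o Phi do not vanish together; where the
denominator is 0 the chart 1 / f is used. *)
Lemma schwarz_of_Phi (M : 'M[C]_2) (f : C -> sphere C) (l : C -> C) (z : C) :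
  M \in unitmx ->
  (\forall w \near z, [/\ dC l w (w^-1), cexp (l w) = w & w != 0 /\ cmod w < r]) ->
  (\forall w \near z, f w = moebius M (Phi (l w))) ->
  schwarz_at phi f z.
Proof.
move=> uM hl hf.
pose s := lin u1 u2 (M 0 0) (M 0 1); pose s1 := lin' u1' u2' (M 0 0) (M 0 1).
pose p := lin u1 u2 (M 1 0) (M 1 1); pose p1 := lin' u1' u2' (M 1 0) (M 1 1).
have ls a b v : inH v -> dC (lin u1 u2 a b) v (lin' u1' u2' a b v) /\
    dC (lin' u1' u2' a b) v (Q v * lin u1 u2 a b v) by move=> vr; exact: (lin_sol B).
have det0 : M 0 0 * M 1 1 - M 0 1 * M 1 0 != 0 by rewrite -unit22.
have wn := w0_neq0 B.
have Wps v : inH v -> p v * s1 v - p1 v * s v = (M 0 0 * M 1 1 - M 0 1 * M 1 0) * w0.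
  by move=> vr; exact: (lin_wronskian B).
have hf' : \forall w \near z, nonzero2 (s (l w)) (p (l w)) /\ f w = hom (s (l w)) (p (l w)).
  apply: filterS2 hl hf => w [h1 h2 [h3 h4]] ->.
  have wr : inH (l w) by rewrite h2.
  split; last exact: (moebius_Phi B).
  exact: (nonzero2_moebius uM (Phi_nonzero B wr)).
have [lz ez [z0 zr]] := near_at hl.
have cl (q q1 : C -> C) : (forall v, inH v -> dC q v (q1 v)) ->
    {for z, continuous (fun w => q (l w))}.
  by move=> hq; apply: dC_cont; apply: dC_comp lz (hq _ _); rewrite ez.
have [pz|pz] := eqVneq (p (l z)) 0; last first.
  have [h1 h2 h3] := @schwarz_quotient s s1 p p1 _ l z (fun v vr => proj1 (ls _ _ v vr))
    (ls _ _) Wps (mulf_neq0 det0 wn) hl pz.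
  exists (fun w => s (l w) / p (l w)); split => //; left.
  have pn : \forall w \near z, p (l w) != 0.
    apply: (@cont_neq0 R (fun w => p (l w))) => //.
    by apply: (cl _ p1) => v vr; have [] := ls (M 1 0) (M 1 1) v vr.
  by apply: filterS2 hf' pn => w [_ ->] pw; rewrite /hom (negbTE pw).
have sz : s (l z) != 0.
  by have [] := near_at hf'; rewrite /nonzero2 pz eqxx orbF.
have Wsp v : inH v -> s v * p1 v - s1 v * p v = - ((M 0 0 * M 1 1 - M 0 1 * M 1 0) * w0).
  by move=> vr; rewrite -(Wps v vr); ring.
have kn : - ((M 0 0 * M 1 1 - M 0 1 * M 1 0) * w0) != 0 by rewrite oppr_eq0 mulf_neq0.
have [h1 h2 h3] := @schwarz_quotient p p1 s s1 _ l z (fun v vr => proj1 (ls _ _ v vr))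
  (ls _ _) Wsp kn hl sz.
exists (fun w => p (l w) / s (l w)); split => //; right.
have sn : \forall w \near z, s (l w) != 0.
  apply: (@cont_neq0 R (fun w => s (l w))) => //.
  by apply: (cl _ s1) => v vr; have [] := ls (M 0 0) (M 0 1) v vr.
apply: filterS2 hf' sn => w [nz ->] sw.
have -> : Some (p (l w) / s (l w)) = hom (p (l w)) (s (l w)) by rewrite /hom (negbTE sw).
by rewrite sphere_inv_hom// /nonzero2 sw orbT.
Qed.

(** The effect on Phi of m turns around the puncture. *)
Definition deck (m : int) : 'M[C]_2 :=
  mx22 (cexp (- (m%:~R * tau * delta))) (m%:~R * tau * beta) 0 1.

Lemma deck_unit m : deck m \in unitmx.
Proof. by rewrite mx22_unit mulr1 mulr0 subr0 cexp_neq0. Qed.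

Lemma Phi_shift z m : inH z -> Phi (z + m%:~R * tau) = moebius (deck m) (Phi z).
Proof.
move=> zr; have [k k0 [E1 E2]] : exists2 k : C, k != 0 &
    u1 (z + m%:~R * tau) = k * u1 z /\
    u2 (z + m%:~R * tau) =
      k * (cexp (- (m%:~R * tau * delta)) * u2 z + m%:~R * tau * beta * u1 z).
  by case: B => _ _ _ _ H; exact: H.
have zr' : inH (z + m%:~R * tau) by rewrite cexpD cexp_int mulr1.
have nz' := nonzero2_moebius (deck_unit m) (Phi_nonzero B zr).
rewrite (moebius_hom _ (Phi_nonzero B zr)); apply: (hom_eq (Phi_nonzero B zr') nz').2.
rewrite E1 E2 /deck; have [-> -> -> ->] := mx22E (cexp (- (m%:~R * tau * delta))) (m%:~R * tau * beta) 0 1.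
by ring.
Qed.

Lemma near_shift (z a : C) (P : C -> Prop) : (\forall v \near z, P v) ->
  \forall v \near (z + a), P (v - a).
Proof.
move=> /nbhsCP[d d0 H]; apply/nbhsCP; exists d => // v hv; apply: H.
by rewrite -addrA -opprD [a + z]addrC.
Qed.

(** The other logarithms are the z + m tau, where [Phi_shift] and [moebius_uniq]
leave only one possible factor.  In particular, whether M occurs at some
logarithm depends on N alone. *)
Lemma other_log (M N : 'M[C]_2) (G : C -> sphere C) z : M \in unitmx -> N \in unitmx ->
  inH z -> (\forall v \near z, G (cexp v) = moebius N (Phi v)) ->
  (exists2 x, cexp x = cexp z & \forall v \near x, G (cexp v) = moebius M (Phi v)) <->
  (exists m, moebius (M *m deck m) = moebius N).
Proof.
move=> uM uN zr hG; split.
  move=> [x /cexp_eq [m ->]] hx; exists m.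
  apply: (moebius_uniq B _ uN zr); first by rewrite unitmx_mul uM deck_unit.
  have := near_shift (- (m%:~R * tau)) hx; rewrite addrK => hx'.
  apply: filterS3 hG hx' (half_plane_near zr) => v h1; rewrite opprK => h2 vr.
  rewrite moebius_mul ?deck_unit// -Phi_shift// -h2 -h1.
  by rewrite cexpD cexp_int mulr1.
move=> [m hm]; exists (z + m%:~R * tau); first by rewrite cexpD cexp_int mulr1.
apply: filterS2 (near_shift (m%:~R * tau) hG) (near_shift (m%:~R * tau) (half_plane_near zr)).
move=> v h vr; have -> : cexp v = cexp (v - m%:~R * tau) by rewrite cexpB cexp_int divr1.
rewrite h -hm moebius_mul ?deck_unit// -Phi_shift//.
by rewrite subrK.
Qed.

Local Notation U := (punctured_disk (ofR r : C)).

Lemma punctured_diskE z : U z <-> z != 0 /\ cmod z < r.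
Proof.
rewrite /punctured_disk /= normE -ofR0 !ofR_lt cmod_gt0; split => [/andP//|[-> ->]//].
Qed.

Lemma ballE (x y : C) (e : R) : ball x (ofR e) y <-> cmod (y - x) < e.
Proof. by rewrite /ball /= normE ofR_lt cmod_distC. Qed.

Lemma ball_near (x : C) (e : C) (y : C) : ball x e y -> \forall w \near y, ball x e w.
Proof.
rewrite /ball /= => h; have e0 : 0 < e by apply: le_lt_trans h.
have [d d0 E] := gt0_ofR e0; subst e.
move: h; rewrite normE ofR_lt cmod_distC => h; apply/nbhsCP; exists (d - cmod (y - x)).
  by rewrite subr_gt0.
move=> w hw; rewrite normE ofR_lt cmod_distC; have := cmod_triangle w y x; lra.
Qed.

Lemma schwarz_near (f : C -> sphere C) (x e y : C) : schwarz_solution phi (ball x e) f ->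
  ball x e y -> \forall w \near y, schwarz_at phi f w.
Proof. by move=> hf /ball_near; apply: filterS => w /hf. Qed.

(** The times t at which the current germ is M o Phi at some logarithm of p t
form an open and closed set.  Indeed, near a given time the germ is N o Phi with
a fixed N, and by [other_log] the property only depends on N.  In this way no
lift of the path p to the half-plane is needed. *)
Lemma continuation_factor (p : R -> C) (F : R -> C -> sphere C) (e : R -> C)
    (M : 'M[C]_2) (x0 : C) :
  {within [set t : R | 0 <= t <= 1], continuous p} ->
  (forall t : R, 0 <= t <= 1 -> U (p t)) ->
  continuation_along phi U p F e -> M \in unitmx ->
  cexp x0 = p 0 -> (\forall v \near x0, F 0 (cexp v) = moebius M (Phi v)) ->
  exists2 x1, cexp x1 = p 1 & \forall v \near x1, F 1 (cexp v) = moebius M (Phi v).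
Proof.
move=> cp pU cF uM ex0 hx0.
pose A t := exists2 x, cexp x = p t & \forall v \near x, F t (cexp v) = moebius M (Phi v).
apply: (@unit_interval_connected R A); last by exists x0.
move=> t t01; have [pt0 ptr] := (punctured_diskE _).1 (pU t t01).
have [z ez] := cexp_surj pt0.
have zr : inH z by rewrite ez.
have [et0 _ sF nF] := cF t t01.
have ball0 : ball (p t) (e t) (p t) by exact: ballxx.
have sz : \forall w \near cexp z, schwarz_at phi (F t) w by rewrite ez; exact: schwarz_near sF ball0.
have [N uN hN] := schwarz_local B phiQ zr sz.
have [L [rho [rho0 Lz hL]]] := local_log z.
have [d1 d10 H1] := (nbhsCP _ _).1 (near_near hN).
have cL : {for cexp z, continuous L}.
  by have [|h _ _] := hL (cexp z); [rewrite subrr cmod0|exact: dC_cont h].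
have [d2 d20 H2] := (contCP _ _).1 cL d1 d10.
have d30 : 0 < Num.min rho d2 by rewrite lt_min rho0.
move/subspace_continuousP : (cp) => cp'.
move/cvgCP : (cp' t t01) => /(_ _ d30) /nbhs_ballP [d4 /= d40 H4].
have [d5 /= d50 H5] := (nbhs_ballP _ _).1 nF.
exists (Num.min d4 d5); first by rewrite lt_min d40.
move=> s s01; rewrite lt_min => /andP[s4 s5].
have {}H4 : cmod (p s - p t) < Num.min rho d2.
  by apply: (H4 s) => //; rewrite /ball /= distrC.
have {H5} [bs FE] : ball (p t) (e t) (p s) /\
    (forall w, ball (p t) (e t) w -> ball (p s) (e s) w -> F s w = F t w).
  by apply: (H5 s) => //; rewrite /ball /= distrC.
move: H4; rewrite lt_min -ez => /andP[q1 q2].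
have [_ eLs _] := hL (p s) q1.
have {q2} := H2 _ q2; rewrite Lz => /H1 near_s.
have [es0 _ _ _] := cF s s01.
have bs' : ball (p s) (e s) (p s) by exact: ballxx.
pose y := L (p s).
have ey : cexp y = p s := eLs.
have yr : inH y by rewrite ey; have [] := (punctured_diskE _).1 (pU s s01).
have near_y : \forall v \near y, F s (cexp v) = moebius N (Phi v).
  have b1 : \forall v \near y, ball (p t) (e t) (cexp v).
    apply: (@cont_near R (@cexp R) y (ball (p t) (e t)) (dC_cont (dC_cexp y))).
    by rewrite ey; exact: ball_near bs.
  have b2 : \forall v \near y, ball (p s) (e s) (cexp v).
    apply: (@cont_near R (@cexp R) y (ball (p s) (e s)) (dC_cont (dC_cexp y))).
    by rewrite ey; exact: ball_near bs'.
  apply: filterS3 near_s b1 b2 => v h1 h2 h3.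
  exact: etrans (FE _ h2 h3) h1.
have E1 := other_log uM uN zr hN; have E2 := other_log uM uN yr near_y.
have E3 : A t <-> exists m, moebius (M *m deck m) = moebius N.
  by rewrite -E1 /A -ez.
have E4 : A s <-> exists m, moebius (M *m deck m) = moebius N.
  by rewrite -E2 /A -ey.
by rewrite E3 E4.
Qed.

(** The loop leads from a logarithm x0 to some x0 + m tau, and the germ there is
both g o M o Phi and M o Phi shifted by m tau, that is M o T_m o Phi. *)
Lemma holonomy_conj (D : set C) (f0 : C -> sphere C) (p : R -> C)
    (g : sphere C -> sphere C) :
  (forall y, D y -> \forall w \near y, schwarz_at phi f0 w) ->
  is_moebius g -> holonomy_along phi U D f0 p g ->
  exists2 M : 'M[C]_2, M \in unitmx &
    exists m, g \o moebius M = moebius M \o moebius (deck m).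
Proof.
move=> hD [G uG ->] [cp pU p01 Dp [F [e [cF F0 F1]]]].
have z01 : 0 <= (0 : R) <= 1 by rewrite lexx ler01.
have [p00 p0r] := (punctured_diskE _).1 (pU 0 z01).
have [x0 ex0] := cexp_surj p00.
have xr : inH x0 by rewrite ex0.
have sz : \forall w \near cexp x0, schwarz_at phi f0 w by rewrite ex0; exact: hD.
have [M uM hM] := schwarz_local B phiQ xr sz.
have cx := dC_cont (dC_cexp x0).
have hF0 : \forall v \near x0, F 0 (cexp v) = moebius M (Phi v).
  have F0' : \forall v \near x0, F 0 (cexp v) = f0 (cexp v).
    apply: (@cont_near R (@cexp R) x0 (fun w => F 0 w = f0 w) cx).
    rewrite ex0; exact: F0.
  by apply: filterS2 F0' hM => v h1 h2; exact: etrans h1 h2.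
have [x1 ex1 hx1] := continuation_factor cp pU cF uM ex0 hF0.
have /cexp_eq [m Em] : cexp x1 = cexp x0 by rewrite ex1 ex0.
exists M => //; exists m.
have cx1 := dC_cont (dC_cexp x1).
have F1' : \forall v \near x1, F 1 (cexp v) = moebius G (f0 (cexp v)).
  apply: (@cont_near R (@cexp R) x1 (fun w => F 1 w = moebius G (f0 w)) cx1).
  rewrite ex1; exact: F1.
have back (P : C -> Prop) : (\forall v \near x1, P v) -> \forall v \near x0, P (v + m%:~R * tau).
  by move=> /(near_shift (- (m%:~R * tau))); rewrite Em addrK; apply: filterS => v; rewrite opprK.
have E : moebius (G *m M) = moebius (M *m deck m).
  have uGM : G *m M \in unitmx by rewrite unitmx_mul uG uM.
  have uMd : M *m deck m \in unitmx by rewrite unitmx_mul uM deck_unit.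
  apply: (moebius_uniq B uGM uMd xr).
  apply: filterS3 (back _ hx1) (back _ F1') (filterI hM (half_plane_near xr)) => v h1 h2 [h3 vr].
  rewrite !moebius_mul ?deck_unit// -Phi_shift// -h1 h2.
  by rewrite cexpD cexp_int mulr1 h3.
apply/funext => w; have := congr1 (fun q => q w) E.
by rewrite (moebius_mul G w uM) (moebius_mul M w (deck_unit m)).
Qed.

End Holonomy.

(** * The simple loop around the puncture *)

Section SimpleLoop.
Variable R : realType.
Local Notation C := (Cplx R).
Variables (Qc : nat -> C) (r : R) (delta beta : C) (u1 u1' u2 u2' : C -> C) (w0 : C).
Hypothesis B : basis_data Qc r delta beta u1 u1' u2 u2' w0.
Variable phi : C -> C.
Hypothesis phiQ : forall w, 0 < cmod w < r -> w ^+ 2 * phi w = 1 / 2 - 2 * PS Qc w.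
Local Notation Phi := (Phi u1 u2).
Local Notation U := (punctured_disk (ofR r : C)).

Definition turn (t : R) : C := cexp (ofR t * tau).

Lemma cmod_turn t : cmod (turn t) = 1.
Proof. by rewrite cmod_cexp Rep_ofRM Rep_tau mulr0 expR0. Qed.

Lemma turn_neq0 t : turn t != 0. Proof. exact: cexp_neq0. Qed.

Lemma turn0 : turn 0 = 1. Proof. by rewrite /turn ofR0 mul0r cexp0. Qed.
Lemma turn1 : turn 1 = 1. Proof. by rewrite /turn ofR1 mul1r cexp_tau. Qed.

Lemma turn_cont (c : C) (t e : R) : 0 < e ->
  exists2 d : R, 0 < d & forall s, `|s - t| < d -> cmod (c * turn s - c * turn t) < e.
Proof.
move=> e0; have dc : dC (fun z => c * cexp (z * tau)) (ofR t) (c * (cexp (ofR t * tau) * (1 * tau + ofR t * 0))).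
  by apply: dCMl; apply: dC_cexp_comp; exact: dCM (dC_id _) (dC_cst _ _).
have [d d0 hd] := (contCP _ _).1 (dC_cont dc) e e0.
by exists d => // s hs; apply: hd; rewrite -ofRB cmod_ofR.
Qed.

(** The loop is the circle c exp(t tau), with the germs M o Phi o l_t, where
l_t(w) = L(w / exp(t tau)) + t tau is a local logarithm L at c turned by t. *)
Lemma simple_loop (c e : C) (f0 : C -> sphere C) : 0 < e -> ball c e `<=` U ->
  schwarz_solution phi (ball c e) f0 ->
  exists2 M : 'M[C]_2, M \in unitmx &
    exists g, [/\ is_moebius g, (exists p : R -> C, holonomy_along phi U (ball c e) f0 p g)
      & g \o moebius M = moebius M \o moebius (deck delta beta 1)].
Proof.
move=> e0 hD hf0.
have [e' e'0 Ee] := gt0_ofR e0; subst e.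
have cc : ball c (ofR e') c by exact: ballxx.
have [c0 cr] := (punctured_diskE _ _).1 (hD _ cc).
have [z0 ez] := cexp_surj c0.
have zr : cmod (cexp z0) < r by rewrite ez.
have sz : \forall w \near cexp z0, schwarz_at phi f0 w by rewrite ez; exact: schwarz_near hf0 cc.
have [M uM hM] := schwarz_local B phiQ zr sz.
have [L [rho [rho0 Lz hL]]] := local_log z0.
rewrite ez in Lz hL.
have cL : {for c, continuous L}.
  by have [|h _ _] := hL c; [rewrite subrr cmod0|exact: dC_cont h].
have nL : \forall w \near c, f0 (cexp (L w)) = moebius M (Phi (L w)).
  by apply: (@cont_near R L c (fun v => f0 (cexp v) = moebius M (Phi v)) cL); rewrite Lz.
have nb : \forall w \near c, cexp (L w) = w.
  by apply/nbhsCP; exists rho => // w /hL [].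
have nr : \forall w \near c, cmod w < r.
  apply/nbhsCP; exists (r - cmod c); first by rewrite subr_gt0.
  by move=> w hw; have := cmod_sub_ge w c; lra.
pose T := deck delta beta 1.
have uT : T \in unitmx by exact: deck_unit.
have uG : M *m T *m invmx M \in unitmx by rewrite !unitmx_mul uM uT unitmx_inv uM.
have GM w : moebius (M *m T *m invmx M) (moebius M w) = moebius M (moebius T w).
  have ui : invmx M \in unitmx by rewrite unitmx_inv.
  by rewrite (moebius_mul _ _ ui) moebiusK// (moebius_mul _ _ uT).
exists M => //; exists (moebius (M *m T *m invmx M)); split; last first.
- by apply/funext => w; exact: GM.
- pose q := Num.min rho e'.
  have q0 : 0 < q by rewrite lt_min rho0.
  have qr : q <= rho by rewrite ge_min lexx.
  have qe : q <= e' by rewrite ge_min lexx orbT.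
  pose p (t : R) : C := c * turn t.
  pose l (t : R) (w : C) : C := L (w / turn t) + ofR t * tau.
  have rot t w : cmod (w - p t) = cmod (w / turn t - c).
    have -> : w - p t = (w / turn t - c) * turn t.
      by rewrite mulrBl divfK ?turn_neq0.
    by rewrite cmodM cmod_turn mulr1.
  have rotr t w : cmod (w - p t) < q -> cmod (w / turn t - c) < rho.
    by rewrite rot => h; exact: lt_le_trans h qr.
  have inU t w : cmod (w - p t) < q -> w != 0 /\ cmod w < r.
    rewrite rot => h; have /hD /punctured_diskE [h1 h2] : ball c (ofR e') (w / turn t).
      by apply/ballE; exact: lt_le_trans h qe.
    split; first by apply: contraNneq h1 => ->; rewrite mul0r.
    by move: h2; rewrite cmodM cmodV cmod_turn invr1 mulr1.
  have lE t w : cmod (w - p t) < q ->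
      [/\ dC (l t) w (w^-1), cexp (l t w) = w & w != 0 /\ cmod w < r].
    move=> hw; have [h1 h2 _] := hL _ (rotr t w hw); have [w1 w2] := inU t w hw.
    have tn := turn_neq0 t.
    have dv : dC (fun w => w / turn t) w (turn t)^-1.
      apply: dC_eq (dCM (dC_id w) (dC_cst (turn t)^-1 w)).
      by rewrite mul1r mulr0 addr0.
    split; last by split.
      apply: dC_eq (dCD (dC_comp dv h1) (dC_cst (ofR t * tau) w)).
      by field; rewrite w1 tn.
    by rewrite /l cexpD h2 -/(turn t) divfK.
  have agree t s w : `|s - t| < 1 / 2 -> cmod (w - p t) < q -> cmod (w - p s) < q ->
      l s w = l t w.
    move=> st h1 h2.
    have [_ e1 _] := lE t w h1; have [_ e2 _] := lE s w h2.
    have [k Ek] := cexp_eq (etrans e2 (esym e1)).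
    (* the two logarithms of w differ by k tau, of modulus less than 1 + 1 + pi < 2 pi *)
    suff k0 : k = 0 by rewrite Ek k0 mul0r addr0.
    have [_ _ n1] := hL _ (rotr t w h1); have [_ _ n2] := hL _ (rotr s w h2).
    have E : k%:~R * tau = (L (w / turn s) - z0) - (L (w / turn t) - z0) + ofR (s - t) * tau.
      have -> : k%:~R * tau = l s w - l t w by rewrite Ek addrC addKr.
      by rewrite /l ofRB; ring.
    have ctau : cmod (tau : C) = pi *+ 2 by rewrite /tau cmodM cmod_ic mul1r cmod_ofR ger0_norm ?pi2_ge0.
    have pi2 := @pi_ge2 R.
    have : cmod (k%:~R * tau : C) < pi *+ 2.
      rewrite E; apply: le_lt_trans (cmodD _ _) _.
      apply: le_lt_trans (lerD (cmodB _ _) (lexx _)) _.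
      rewrite cmodM cmod_ofR ctau.
      have : `|s - t| * (pi *+ 2) <= 1 / 2 * (pi *+ 2) by rewrite ler_wpM2r ?pi2_ge0// ltW.
      move: pi2 n1 n2; rewrite ![pi *+ 2]mulr2n; move: (pi : R) => x; lra.
    rewrite cmodM ctau -(rmorph_int (real_complex R)) -/(ofR _) cmod_ofR gtr_pMl; last first.
      by rewrite pmulrn_lgt0// pi_gt0.
    by rewrite -intr_norm -[1]/(1%:~R) ltr_int -lez1D; case: k {Ek E} => [[|]|].
  have ballq t w : ball (p t) (ofR q) w <-> cmod (w - p t) < q by exact: ballE.
  have pc t d : 0 < d -> exists2 x : R, 0 < x & forall s, `|s - t| < x -> cmod (p s - p t) < d.
    exact: turn_cont.
  exists p; split.
  + apply: continuous_subspaceT => t; apply/cvgCP => d d0; have [x x0 hx] := pc t d d0.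
    apply/nbhs_ballP; exists x => //= s; rewrite /ball /= distrC; exact: hx.
  + by move=> t _; apply/punctured_diskE; apply: (inU t); rewrite subrr cmod0.
  + by rewrite /p turn0 turn1.
  + by rewrite /p turn0 mulr1.
  exists (fun t w => moebius M (Phi (l t w))), (fun=> ofR q); split.
  + move=> t t01; split.
    * by rewrite -ofR0 ofR_lt.
    * by move=> w /ballq hw; apply/punctured_diskE; exact: (inU t).
    * move=> w hw; apply: (schwarz_of_Phi B phiQ uM (l := l t)).
        by apply: filterS (ball_near hw) => v /ballq hv; exact: lE.
      by apply/nbhsCP; exists 1.
    have [x x0 hx] := pc t q q0.
    apply/nbhs_ballP; exists (Num.min x (1 / 2)) => /=; first by rewrite lt_min x0 divr_gt0.
    move=> s; rewrite /ball /= distrC lt_min => /andP[sx s2] _; split.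
      by apply/ballq; exact: hx.
    by move=> w /ballq h1 /ballq h2; rewrite (agree t s w).
  + rewrite /p turn0 mulr1; apply: filterS2 nL nb => w h1 h2.
    have -> : l 0 w = L w by rewrite /l turn0 divr1 ofR0 mul0r addr0.
    by rewrite -h1 h2.
  rewrite /p turn1 mulr1; apply: filterS3 nL nb nr => w h1 h2 h3.
  have -> : l 1 w = L w + 1%:~R * tau by rewrite /l turn1 divr1 ofR1.
  rewrite (Phi_shift B) ?h2// -GM; congr moebius.
  by rewrite -h1 h2.
- by exists (M *m T *m invmx M).
Qed.

End SimpleLoop.

(** * The expansion at the puncture *)

Section LaurentExpansion.
Variable R : realType.
Local Notation C := (Cplx R).

Lemma series_psum (u : nat -> C) n : series u n = \sum_(i < n) u i.
Proof. by rewrite /series /= big_mkord. Qed.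

Lemma radius_of_cvg (b : nat -> C) (z l : C) : z != 0 -> psum b z @ \oo --> l -> radius_ge b (cmod z).
Proof.
move=> z0 /cvgCP H; have [N _ hN] := H 1 ltr01.
have nz : 0 < cmod z by rewrite cmod_gt0.
pose B := 2 + \sum_(i < N.+1) cmod (b i) * cmod z ^+ i.
have pos i : 0 <= cmod (b i) * cmod z ^+ i by rewrite mulr_ge0 ?exprn_ge0 ?cmod_ge0.
have hB n : cmod (b n) * cmod z ^+ n <= B.
  have [nN|nN] := ltnP n N.+1.
    have : cmod (b n) * cmod z ^+ n <= \sum_(i < N.+1) cmod (b i) * cmod z ^+ i.
      by rewrite (bigD1 (Ordinal nN)) //= lerDl sumr_ge0.
    by rewrite /B; lra.
  have h1 := hN n (ltnW nN); have h2 := hN n.+1 (leqW (ltnW nN)).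
  have E : b n * z ^+ n = (psum b z n.+1 - l) - (psum b z n - l).
    by rewrite /psum big_ord_recr /=; ring.
  have : 0 <= \sum_(i < N.+1) cmod (b i) * cmod z ^+ i by rewrite sumr_ge0.
  rewrite -cmodX -cmodM E; have := cmodB (psum b z n.+1 - l) (psum b z n - l).
  by move: h1 h2 => /= h1 h2; rewrite /B; lra.
move=> s /andP[s0 sz]; exists B => n; apply: le_trans (hB n).
by rewrite ler_wpM2l ?cmod_ge0// lerXn2r ?nnegrE ?(ltW s0) ?(ltW nz)// ltW.
Qed.

Variables (delta : C) (a : nat -> C) (phi : C -> C) (r : R).
Hypothesis hphi : \forall z \near (0 : C)^',
  series (fun n : nat => a n.+1 * z ^ (n%:Z - 1)) @ \oo -->
    phi z - (1 - delta ^+ 2) / (2 * z ^+ 2).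
Hypothesis r0 : 0 < r.
Hypothesis holo : forall z, 0 < cmod z < r -> derivable phi z 1.

Definition zzphi_coef (n : nat) : C := if n is 0 then (1 - delta ^+ 2) / 2 else a n.
(** z^2 phi(z) with its singularity at 0 removed. *)
Definition zzphi (z : C) : C := if z == 0 then (1 - delta ^+ 2) / 2 else z ^+ 2 * phi z.

Lemma zzphi_near0 : exists2 d : R, 0 < d & forall z, 0 < cmod z < d ->
  psum zzphi_coef z @ \oo --> zzphi z.
Proof.
have H : nbhs (0 : C) (fun z : C => z != 0 ->
  series (fun n : nat => a n.+1 * z ^ (n%:Z - 1)) @ \oo -->
    phi z - (1 - delta ^+ 2) / (2 * z ^+ 2)) := hphi.
have [d d0 hd] := (nbhsCP _ _).1 H; exists d => // z /andP[nz zd].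
have z0 : z != 0 by rewrite -cmod_gt0.
have {hd} hd := hd z; rewrite subr0 in hd; have {hd} hd := hd zd z0.
rewrite -(cvg_shiftS (psum zzphi_coef z)).
have -> : (fun n => psum zzphi_coef z n.+1) = (fun n => (1 - delta ^+ 2) / 2 +
    z ^+ 2 * series (fun n : nat => a n.+1 * z ^ (n%:Z - 1)) n).
  apply/funext => n; rewrite /psum big_ord_recl expr0 mulr1 series_psum mulr_sumr.
  congr (_ + _); apply: eq_bigr => i _ /=.
  by rewrite expfzDr// exprN1 -exprnP /bump /= add1n exprS; field.
have -> : zzphi z = (1 - delta ^+ 2) / 2 +
    z ^+ 2 * (phi z - (1 - delta ^+ 2) / (2 * z ^+ 2)).
  by rewrite /zzphi (negbTE z0); field.
apply: cvgD; first exact: cvg_cst.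
by apply: cvgM; [exact: cvg_cst|exact: hd].
Qed.

(** The series is only known to converge near 0.  As z^2 phi(z) extends
holomorphically to the disk of radius r, its Taylor series there has the given
coefficients, so these define a series of radius at least r. *)
Lemma zzphi_expansion : radius_ge zzphi_coef r /\
  forall z, cmod z < r -> zzphi z = PS zzphi_coef z.
Proof.
have [d d0 hd] := zzphi_near0.
pose x : R := d / 2.
have x0 : 0 < x by rewrite divr_gt0.
have xd : x < d by rewrite /x; lra.
have nx : cmod (ofR x) = x by rewrite cmod_ofR gtr0_norm.
have rx : radius_ge zzphi_coef x.
  rewrite -nx; apply: radius_of_cvg (hd (ofR x) _); first by rewrite ofR_eq0 gt_eqF.
  by rewrite nx x0.
have near0 z : cmod z < x -> zzphi z = PS zzphi_coef z.
  move=> zx; have [->|z0] := eqVneq z 0; first by rewrite PS0 /zzphi eqxx.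
  by rewrite (PS_lim (hd z _))// cmod_gt0 z0 (lt_trans zx).
have [|c [crad hc]] := @taylor_disk R zzphi r r0.
  move=> z zr; have [->|z0] := eqVneq z 0.
    have c0 : cmod (0 : C) < x by rewrite cmod0.
    eexists; apply: dC_near (dC_PS rx c0).
    by apply/nbhsCP; exists x => // w; rewrite subr0 => /near0.
  have hz : 0 < cmod z < r by rewrite cmod_gt0 z0.
  eexists; apply: dC_near (dCM (dCX 2 (dC_id z)) (dC_derivable (holo hz))).
  apply: filterS (neq0_near z0) => w w0.
  by rewrite /zzphi (negbTE w0).
pose m := Num.min x r.
have m0 : 0 < m by rewrite lt_min x0.
have mx : m <= x by rewrite ge_min lexx.
have mr : m <= r by rewrite ge_min lexx orbT.
have E : c = zzphi_coef.
  apply/funext; apply: (PS_inj (radius_le mr crad) (radius_le mx rx) m0 m0 (lexx _)).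
  move=> z /andP[_ zm].
  exact: etrans (esym (hc z (lt_le_trans zm mr))) (near0 z (lt_le_trans zm mx)).
by rewrite -E.
Qed.

Lemma radius_a : radius_ge a r.
Proof.
have [h _] := zzphi_expansion; move=> s hs; have [B hB] := h s hs.
exists (Num.max B (cmod (a 0%N))) => -[|n]; rewrite le_max.
  by rewrite expr0 mulr1 lexx orbT.
by rewrite (hB n.+1).
Qed.

(** Only the square of delta enters: this allows delta to be replaced with
- delta, so that integers may be taken nonnegative. *)
Lemma phi_Qcoef (delta' : C) : delta' ^+ 2 = delta ^+ 2 ->
  forall w, 0 < cmod w < r -> w ^+ 2 * phi w = 1 / 2 - 2 * PS (Qcoef delta' a) w.
Proof.
move=> dd w /andP[w0 wr]; have [hb hE] := zzphi_expansion.
have -> : w ^+ 2 * phi w = zzphi w.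
  by rewrite /zzphi; case: eqP w0 => // ->; rewrite cmod0 ltxx.
rewrite hE// (PS_recl hb wr) (PS_recl (radius_Qcoef delta' radius_a) wr) /= dd.
have -> : (fun n => a n.+1) = (fun n => -2 * (- a n.+1 / 2)).
  by apply/funext => n; field.
have rq : radius_ge (fun n => - a n.+1 / 2) r := radius_shift (radius_Qcoef delta radius_a).
by rewrite (PS_scale _ rq wr); field.
Qed.

End LaurentExpansion.

(** * The type of the generator *)

Section Classification.
Variable R : realType.
Local Notation C := (Cplx R).

Lemma moebius_exp_id (M : 'M[C]_2) : M \in unitmx -> moebius M = id ->
  forall n : int, moebius (M ^ n) = id.
Proof.
move=> uM E.
have nat_id k : moebius (M ^+ k) = id /\ M ^+ k \in unitmx.
  elim: k => [|k [IH uk]].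
    by rewrite expr0; split; [apply/funext => w; exact: moebius1|exact: unitmx1].
  have uk1 : M *m M ^+ k \in unitmx by rewrite unitmx_mul uM uk.
  rewrite exprS; split; last exact: uk1.
  by apply/funext => w; rewrite (moebius_mul M w uk) IH E.
case=> k; first by have [] := nat_id k.
rewrite NegzE; have [hk uk] := nat_id k.+1.
have -> : M ^ (- k.+1%:Z) = invmx (M ^+ k.+1) by rewrite -exprnN.
apply/funext => w; have wE : moebius (M ^+ k.+1) w = w by rewrite hk.
by rewrite -{1}wE (moebiusK uk).
Qed.

Variables (phi : C -> C) (r : R) (c e : C) (f0 : C -> sphere C).
Variables (gamma : sphere C -> sphere C) (Qc : nat -> C) (delta beta : C).
Variables (u1 u1' u2 u2' : C -> C) (w0 : C).
Local Notation U := (punctured_disk (ofR r : C)).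
Hypothesis B : basis_data Qc r delta beta u1 u1' u2 u2' w0.
Hypothesis phiQ : forall w, 0 < cmod w < r -> w ^+ 2 * phi w = 1 / 2 - 2 * PS Qc w.
Hypothesis e0 : 0 < e.
Hypothesis hD : ball c e `<=` U.
Hypothesis hf0 : schwarz_solution phi (ball c e) f0.
Hypothesis hgamma : generates gamma (holonomy_group R phi U (ball c e) f0).

Lemma gamma_conj : exists2 M : 'M[C]_2, M \in unitmx &
  exists m, gamma \o moebius M = moebius M \o moebius (deck delta beta m).
Proof.
have [G uG [EG EH]] := hgamma.
have : holonomy_group R phi U (ball c e) f0 gamma.
  by rewrite EH; exists 1 => //; rewrite EG expr1z.
move=> [mg [p hp]]; apply: (holonomy_conj B phiQ _ mg hp) => y hy.
exact: schwarz_near hf0 hy.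
Qed.

(** A trivial generator makes the whole group trivial, in particular the
holonomy of the simple loop, which is conjugate to T_1.  Thus gamma need not be
identified with the holonomy of a particular loop. *)
Lemma gamma_id_deck : gamma = id -> moebius (deck delta beta 1) = id.
Proof.
have [G uG [EG EH]] := hgamma; move=> gid.
have [M uM [g [mg hp Eg]]] := simple_loop B phiQ e0 hD hf0.
have : holonomy_group R phi U (ball c e) f0 g by split.
rewrite EH => -[n _ gn].
have gi : g = id by rewrite -gn; apply: moebius_exp_id => //; rewrite -EG.
apply/funext => w; apply: (can_inj (moebiusK uM)).
by have := congr1 (fun q => q w) Eg; rewrite gi.
Qed.

Lemma deck_idP m : moebius (deck delta beta m) = id ->
  cexp (- (m%:~R * tau * delta)) = 1 /\ m%:~R * tau * beta = 0.
Proof.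
rewrite moebius_affine => H.
set l := cexp _; set b := _ * beta.
have H0 : l * 0 + b = 0 := Some_inj (congr1 (fun q => q (Some 0)) H).
have H1 : l * 1 + b = 1 := Some_inj (congr1 (fun q => q (Some 1)) H).
move: H0; rewrite mulr0 add0r => b0; split => //.
by move: H1; rewrite b0 addr0 mulr1.
Qed.

Lemma gamma_id (M : 'M[C]_2) m : M \in unitmx ->
  gamma \o moebius M = moebius M \o moebius (deck delta beta m) ->
  cexp (- (m%:~R * tau * delta)) = 1 -> m%:~R * tau * beta = 0 -> gamma = id.
Proof.
move=> uM Eg E1 E2; apply/funext => w.
have := congr1 (fun q => q (moebius (invmx M) w)) Eg.
rewrite /= moebiusVK// moebius_affine E1 E2 => ->.
have -> : option_map (fun z : C => 1 * z + 0) (moebius (invmx M) w) = moebius (invmx M) w.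
  by case: (moebius (invmx M) w) => //= z; rewrite mul1r addr0.
by rewrite moebiusVK.
Qed.

Lemma gamma_multiplier (M : 'M[C]_2) m : M \in unitmx -> beta = 0 ->
  gamma \o moebius M = moebius M \o moebius (deck delta beta m) ->
  moebius_conj gamma (option_map (fun z : C => cexp (- (m%:~R * tau * delta)) * z)).
Proof.
move=> uM b0 Eg; exists (moebius (invmx M)).
  by exists (invmx M); rewrite ?unitmx_inv.
apply/funext => w.
have := congr1 (fun q => q (moebius (invmx M) w)) Eg.
rewrite /= moebiusVK// => ->; rewrite moebiusK// moebius_affine b0 mulr0.
by case: (moebius (invmx M) w) => //= z; rewrite addr0.
Qed.

Lemma gamma_parabolic (M : 'M[C]_2) m : M \in unitmx ->
  gamma \o moebius M = moebius M \o moebius (deck delta beta m) ->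
  cexp (- (m%:~R * tau * delta)) = 1 -> m%:~R * tau * beta != 0 -> parabolic gamma.
Proof.
move=> uM Eg E1 b0; set b := m%:~R * tau * beta in b0.
have uS : mx22 b^-1 0 0 1 \in unitmx by rewrite mx22_unit mulr1 mulr0 subr0 invr_neq0.
have ui : invmx M \in unitmx by rewrite unitmx_inv.
exists (moebius (mx22 b^-1 0 0 1 *m invmx M)).
  by exists (mx22 b^-1 0 0 1 *m invmx M); [rewrite unitmx_mul uS ui|].
apply/funext => w; have := congr1 (fun q => q (moebius (invmx M) w)) Eg.
rewrite /= moebiusVK// => ->; rewrite !(moebius_mul _ _ ui) moebiusK// !moebius_affine E1.
by case: (moebius (invmx M) w) => //= z; congr Some; rewrite -/b; field.
Qed.

End Classification.

Section Multiplier.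
Variable R : realType.
Local Notation C := (Cplx R).

Lemma multiplier_norm (m : int) (delta : C) :
  `|cexp (- (m%:~R * tau * delta))| = ofR (expR (m%:~R * (pi *+ 2) * Imp delta)).
Proof.
rewrite normE cmod_cexp RepN -mulrA Rep_int RepM Rep_tau Imp_tau.
by rewrite mul0r sub0r mulrN opprK mulrA.
Qed.

Lemma multiplier_eq1 (delta : C) : cexp (- (1%:~R * tau * delta)) = 1 ->
  exists n : int, delta = n%:~R.
Proof.
move=> /cexp_eq1[k]; rewrite mul1r => H; exists (- k).
apply: (mulfI (tau_neq0 R)); rewrite mulrNz mulrN [tau * k%:~R]mulrC -H.
by rewrite opprK.
Qed.

Lemma multiplier_int (m n : int) : cexp (- (m%:~R * tau * n%:~R) : C) = 1.
Proof.
have -> : - (m%:~R * tau * n%:~R) = (- (m * n))%:~R * tau :> C.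
  by rewrite mulrNz intrM; ring.
exact: cexp_int.
Qed.

End Multiplier.

Theorem theorem3p1 (R : realType) (delta : Cplx R) (a : nat -> Cplx R)
  (phi : Cplx R -> Cplx R)
  (hphi : \forall z \near (0 : Cplx R)^',
     series (fun n : nat => a n.+1 * z ^ (n%:Z - 1)) @ \oo -->
       phi z - (1 - delta ^+ 2) / (2 * z ^+ 2))
  (r : Cplx R) (hr : 0 < r)
  (holo : holomorphic_on (punctured_disk r) phi)
  (c e : Cplx R) (he : 0 < e) (hD : ball c e `<=` punctured_disk r)
  (f0 : Cplx R -> sphere (Cplx R)) (hf0 : schwarz_solution phi (ball c e) f0)
  (gamma : sphere (Cplx R) -> sphere (Cplx R))
  (hgamma : generates gamma
     (holonomy_group R phi (punctured_disk r) (ball c e) f0)) :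
  [/\ ((forall n : int, delta <> n%:~R) ->
         gamma <> id /\
         (if delta \is Num.real then elliptic gamma else hyperbolic gamma)),
      (delta = 0 -> parabolic gamma)
    & (forall n : int, (1 <= `|n|)%N -> delta = n%:~R ->
         (parabolic gamma \/ gamma = id) /\
         (gamma = id <-> \det (holonomy_matrix a `|n|%N) = 0))].
Proof.
have [s s0 Er] := gt0_ofR hr; subst r.
have holo' z : 0 < cmod z < s -> derivable phi z 1.
  by move=> hz; apply: holo; rewrite /punctured_disk /= normE -ofR0 !ofR_lt.
have ha : radius_ge a s := radius_a hphi s0 holo'.
have hQ := phi_Qcoef hphi s0 holo'.
split.
- move=> nint.
  have [u1 [u1' [u2 [u2' [w0 B]]]]] := basis_nonint s0 ha nint.
  have phiQ := hQ delta erefl.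
  have gid : gamma <> id.
    move=> /(gamma_id_deck B phiQ he hD hf0 hgamma)/deck_idP[/multiplier_eq1[n En] _].
    exact: (nint n).
  split => //; have [M uM [m Eg]] := gamma_conj B phiQ hf0 hgamma.
  have conj := gamma_multiplier uM erefl Eg.
  have m0 : m != 0.
    apply/eqP => m0; apply: gid; apply: (gamma_id uM Eg); last by rewrite mulr0.
    by rewrite m0 !mul0r oppr0 cexp0.
  have := multiplier_norm m delta.
  case: ifP => [/complex_realP[y Ey]|dr] En.
    exists (cexp (- (m%:~R * tau * delta))) => //.
    by rewrite En Ey /= mulr0 expR0 ofR1.
  exists (cexp (- (m%:~R * tau * delta))) => //; split; first exact: cexp_neq0.
  apply/eqP => E1; have : ofR (expR (m%:~R * (pi *+ 2) * Imp delta)) = ofR 1.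
    by rewrite -En E1 ofR1.
  move/ofRI; rewrite -[RHS]expR0 => /expR_inj /eqP.
  rewrite !mulf_eq0 intr_eq0 (negbTE m0) mulrn_eq0 /= (gt_eqF (pi_gt0 R)) /= => /eqP d0.
  by move/negP: dr; apply; apply/complex_realP; exists (Rep delta); apply: cplx_eq.
- move=> d0; subst delta.
  have [u1 [u1' [u2 [u2' [w0 B]]]]] := basis_zero s0 ha.
  have phiQ := hQ 0 erefl.
  have [M uM [m Eg]] := gamma_conj B phiQ hf0 hgamma.
  have E1 : cexp (- (m%:~R * tau * 0)) = 1 :> Cplx R by rewrite mulr0 oppr0 cexp0.
  apply: (gamma_parabolic uM Eg E1); apply/eqP => E2.
  have /(gamma_id_deck B phiQ he hD hf0 hgamma)/deck_idP[_] := gamma_id uM Eg E1 E2.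
  by rewrite mul1r mulr1 => /eqP; rewrite (negbTE (tau_neq0 R)).
move=> n n1 En.
(* phi depends on delta ^+ 2 only, so |n| can take the place of delta = n *)
have dd : (`|n|%N%:R : Cplx R) ^+ 2 = delta ^+ 2.
  by rewrite En; case: (n) => k; rewrite ?NegzE ?mulrNz ?sqrrN.
have [beta [[u1 [u1' [u2 [u2' [w0 B]]]]] hbeta]] := basis_posint s0 ha n1.
have phiQ := hQ _ dd.
have [M uM [m Eg]] := gamma_conj B phiQ hf0 hgamma.
have E1 : cexp (- (m%:~R * tau * `|n|%N%:R)) = 1 :> Cplx R.
  exact: (multiplier_int R m `|n|%N%:Z).
have gb : gamma = id <-> beta = 0.
  split => [/(gamma_id_deck B phiQ he hD hf0 hgamma)/deck_idP[_ /eqP]|b0].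
    by rewrite mul1r mulf_eq0 (negbTE (tau_neq0 R)) => /eqP.
  by apply: (gamma_id uM Eg E1); rewrite b0 mulr0.
split; last exact: iff_trans gb hbeta.
have [E2|E2] := eqVneq (m%:~R * tau * beta) 0; [right|left].
  exact: gamma_id uM Eg E1 E2.
exact: gamma_parabolic uM Eg E1 E2.
Qed.
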